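(* Let $d\ge 2$ and $0<\alpha<2$. For $t>0$ and $x\in\mathbb{R}^d$ let \[P_t^\alpha(x)=(2\pi)^{-d}\int_{\mathbb{R}^d} e^{-ix\cdot\xi}e^{-t|\xi|^\alpha}\,d\xi .\] Then for every $c$ with $(d-1)/2<c<d$, every $t>0$ and every $x\neq 0$, \[P_t^\alpha(x)=\frac{t^{-d/\alpha}}{\alpha\pi^{d/2}}\,\frac{1}{2\pi i}\int_{c-i\infty}^{c+i\infty}\frac{\Gamma(\frac{z}{\alpha})\,\Gamma(\frac{d-z}{2})\,2^{-z}}{\Gamma(\frac{z}{2})}\,\big(t^{-1/\alpha}|x|\big)^{-d+z}\,dz,\] and $P_t^\alpha(x)$ has the asymptotic expansion (as $t^{-1/\alpha}|x|\to\infty$) \[P_t^\alpha(x)\sim\frac{t^{-d/\alpha}}{\pi^{d/2}}\sum_{n=1}^{\infty}\big(1-1_{\mathbb{Z}}(n\alpha/2)\big)\frac{(-1)^n}{n!}\,\frac{\Gamma(\frac{d+n\alpha}{2})\,2^{n\alpha}}{\Gamma(-\frac{n\alpha}{2})}\,\big(t^{-1/\alpha}|x|\big)^{-d-n\alpha}.\]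
   Context: $\Gamma$ is the Euler gamma function (meromorphically continued to $\mathbb{C}$, with $1/\Gamma$ entire). $1_{\mathbb{Z}}$ denotes the indicator function of the integers. The integral $\int_{c-i\infty}^{c+i\infty}$ is along the vertical line $\Re z=c$. $P_t^\alpha$ is the transition density of the symmetric $\alpha$-stable process in $\mathbb{R}^d$. *)

(* Defs.v *)
From HB Require Import structures.
From mathcomp Require Import all_boot all_order all_algebra.
From mathcomp Require Import all_classical all_reals all_analysis.
From mathcomp Require Import complex.
Set Implicit Arguments. Unset Strict Implicit. Unset Printing Implicit Defensive.
Import Order.TTheory GRing.Theory Num.Theory.
Local Open Scope ring_scope.
Local Open Scope complex_scope.

Section Defs.
Variable R : realType.

Definition Rint (f : R -> R) : R := Rintegral (@lebesgue_measure R) setT f.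
Definition Rint_pos (f : R -> R) : R :=
  Rintegral (@lebesgue_measure R) `]0, +oo[%classic f.

Definition cint (f : R -> R[i]) : R[i] :=
  Complex (Rint (fun y => complex.Re (f y))) (Rint (fun y => complex.Im (f y))).

Definition cexp (z : R[i]) : R[i] :=
  Complex (expR (complex.Re z) * cos (complex.Im z)) (expR (complex.Re z) * sin (complex.Im z)).

Definition cpow (r : R) (z : R[i]) : R[i] := cexp (z * (ln r)%:C).

(* Euler integral: Gamma(z) = int_0^oo s^(z-1) e^(-s) ds, valid for Re z > 0 *)
Definition GammaPos (z : R[i]) : R[i] :=
  Complex (Rint_pos (fun s => powR s (complex.Re z - 1) * cos (complex.Im z * ln s) * expR (- s)))
          (Rint_pos (fun s => powR s (complex.Re z - 1) * sin (complex.Im z * ln s) * expR (- s))).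

(* number of shifts n with Re z + n > 0 *)
Definition gshift (z : R[i]) : nat := (`|Num.floor (- complex.Re z)|%N).+1.

(* Meromorphic continuation: Gamma(z) = Gamma(z+n) / (z (z+1) ... (z+n-1)). *)
Definition Gamma (z : R[i]) : R[i] :=
  GammaPos (z + (gshift z)%:R) / \prod_(k < gshift z) (z + k%:R).

(* Entire reciprocal 1/Gamma(z) = z (z+1) ... (z+n-1) / Gamma(z+n)
   (vanishes at 0, -1, -2, ...). *)
Definition rGamma (z : R[i]) : R[i] :=
  (\prod_(k < gshift z) (z + k%:R)) / GammaPos (z + (gshift z)%:R).

Fixpoint iterint (n : nat) (f : seq R -> R) : R :=
  match n with
  | 0 => f [::]
  | n'.+1 => Rint (fun x => iterint n' (fun s => f (x :: s)))
  end.

Definition rint_Rd (d : nat) (f : 'rV[R]_d -> R) : R :=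
  iterint d (fun s => f (\row_(i < d) nth 0 s i)).

Definition cint_Rd (d : nat) (f : 'rV[R]_d -> R[i]) : R[i] :=
  Complex (rint_Rd (fun v => complex.Re (f v))) (rint_Rd (fun v => complex.Im (f v))).

Definition dotR (d : nat) (x y : 'rV[R]_d) : R := \sum_(i < d) x 0 i * y 0 i.
Definition enorm (d : nat) (x : 'rV[R]_d) : R := Num.sqrt (\sum_(i < d) x 0 i ^+ 2).

Definition stable_density (d : nat) (alpha t : R) (x : 'rV[R]_d) : R[i] :=
  ((2 * pi) ^- d)%:C *
  cint_Rd (fun xi : 'rV[R]_d =>
     cexp (Complex 0 (- dotR x xi)) * (expR (- (t * powR (enorm xi) alpha)))%:C).

(* int_{c - i oo}^{c + i oo} F(z) dz, parametrized z = c + i y, dz = i dy *)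
Definition vline_integral (c : R) (F : R[i] -> R[i]) : R[i] :=
  'i * cint (fun y => F (Complex c y)).

Definition asym_coef (d : nat) (alpha : R) (n : nat) : R :=
  (1 - ((n%:R * alpha / 2) \is a Num.int)%:R) * ((-1) ^+ n / (n`!)%:R)
  * complex.Re (Gamma (((d%:R + n%:R * alpha) / 2)%:C)) * powR 2 (n%:R * alpha)
  * complex.Re (rGamma ((- (n%:R * alpha / 2))%:C)).

End Defs.

(* Main.v *)
(** With [a = alpha / 2], the function [exp (- lam ^ a)] is a Laplace transform:
    [exp (- lam ^ a) = \int H w * exp (- lam * exp w) dw], where [H] is given by the
    vertical line integral of [Gamma s / Gamma (a s) * exp (a s w) / (2 pi)].  Applied to
    [lam = t ^ (2 / alpha) * |xi| ^ 2], it turns the Fourier integral of the density into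
    a mixture of Gaussian integrals, computed coordinate by coordinate.  Inserting the line
    integral for [H] and integrating out [w] yields the Mellin-Barnes formula; inserting
    instead the expansion of [H] obtained by moving the line of integration to the left
    across the poles of [Gamma] yields the asymptotic expansion.

    No Cauchy theorem is used to move the line.  On each strip between consecutive poles,
    [Gamma] is the Mellin transform of [exp (- b)] minus a Taylor polynomial, so that
    Fourier inversion gives the residues of [Gamma s * exp (- s v)].  Multiplying by
    polynomials is absorbed by [Gamma (s + 1) = s * Gamma s], and Euler's product, which
    approximates [1 / Gamma (a s)] by polynomials times exponentials, gives the general
    case by dominated convergence.  The domination comes from the exponential bounds
    [exp (- (pi / 2 - e) |y|)] for [Gamma] and [exp ((pi / 2 + e) |y|)] for Euler's
    products on vertical lines, together with [a < 1]. *)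

From HB Require Import structures.
From mathcomp Require Import all_boot all_order all_algebra.
From mathcomp Require Import all_classical all_reals all_analysis.
From mathcomp Require Import complex measurable_realfun ring lra.
Require Import Defs.
Import Order.TTheory GRing.Theory Num.Theory.
Import numFieldNormedType.Exports.
Set Implicit Arguments. Unset Strict Implicit. Unset Printing Implicit Defensive.
Local Open Scope classical_set_scope.
Local Open Scope ring_scope.
Local Open Scope complex_scope.

Local Notation normc := Normc.normc.
Local Notation Re := complex.Re.
Local Notation Im := complex.Im.
Local Notation mu := lebesgue_measure.

(** * Complex-valued Lebesgue integrals *)

Section ComplexBasics.
Variable R : realType.
Implicit Types (z : R[i]) (a b x y : R).

(** Integrals over the positive half-line are moved to the real line by u = exp w. Powers become
    exponentials, a Mellin transform on a vertical line becomes a Fourier transform, and dominations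
    reduce to exponential bounds at the two ends.

    [H] is known only as a line integral, so its Laplace transform is found by pairing: against exp
    (- lam * exp w), Fubini produces Gamma (a s) * lam ^ (- a s). The Gamma factor cancels 1 / Gamma
    (a s) and leaves the inverse Mellin transform of Gamma at lam ^ a. All of this converges
    absolutely because Gamma s decays at rate pi / 2 while 1 / Gamma (a s) grows at rate a * pi / 2.

    Residues are handled through a property of test functions E: on every line in strip N, the
    integral of Gamma * E is 2 pi times a constant, common to all strips, minus the weighted values
    of E at 0, ..., -(N - 1). Comparing two lines eliminates the constant, and only then is the
    limit in Euler's product taken.

    The remainder lives on Re s = -(N + 1/2), halfway between two poles. It is therefore smaller
    than the power of index N by a factor (t ^ (-1 / alpha) |x|) ^ (- alpha / 2), which turns a
    bound O into the required o. *)

Lemma complex_eta z : Complex (Re z) (Im z) = z.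
Proof. by case: z. Qed.

Lemma ReM z1 z2 : Re (z1 * z2) = Re z1 * Re z2 - Im z1 * Im z2.
Proof. by case: z1 => ? ?; case: z2. Qed.

Lemma ImM z1 z2 : Im (z1 * z2) = Re z1 * Im z2 + Im z1 * Re z2.
Proof. by case: z1 => ? ?; case: z2. Qed.

Lemma ReD z1 z2 : Re (z1 + z2) = Re z1 + Re z2.
Proof. by case: z1 => ? ?; case: z2. Qed.

Lemma ImD z1 z2 : Im (z1 + z2) = Im z1 + Im z2.
Proof. by case: z1 => ? ?; case: z2. Qed.

Lemma ReN z : Re (- z) = - Re z. Proof. by case: z. Qed.
Lemma ImN z : Im (- z) = - Im z. Proof. by case: z. Qed.

Lemma Re_sum (I : Type) (r : seq I) (P : pred I) (F : I -> R[i]) :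
  Re (\sum_(i <- r | P i) F i) = \sum_(i <- r | P i) Re (F i).
Proof. by elim/big_rec2 : _ => // i x z _ <-; rewrite ReD. Qed.

Lemma Im_sum (I : Type) (r : seq I) (P : pred I) (F : I -> R[i]) :
  Im (\sum_(i <- r | P i) F i) = \sum_(i <- r | P i) Im (F i).
Proof. by elim/big_rec2 : _ => // i x z _ <-; rewrite ImD. Qed.

Lemma normcE z : normc z = Num.sqrt (Re z ^+ 2 + Im z ^+ 2).
Proof. by case: z. Qed.

Lemma sqr_normc z : normc z ^+ 2 = Re z ^+ 2 + Im z ^+ 2.
Proof. by rewrite normcE sqr_sqrtr// addr_ge0// sqr_ge0. Qed.

Lemma normc_ge0 z : 0 <= normc z.
Proof. by rewrite normcE sqrtr_ge0. Qed.

Lemma normcR x : normc x%:C = `|x|.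
Proof. by rewrite /= expr0n /= addr0 sqrtr_sqr. Qed.

Lemma normc_eq0 z : (normc z == 0) = (z == 0).
Proof. by apply/eqP/eqP => [/Normc.eq0_normc//|->]; rewrite normcR normr0. Qed.

Lemma normc_prod (I : Type) (r : seq I) (F : I -> R[i]) :
  normc (\prod_(i <- r) F i) = \prod_(i <- r) normc (F i).
Proof.
by elim/big_rec2 : _ => [|i x z _ <-]; rewrite ?Normc.normcM// normcR normr1.
Qed.

Lemma Re_le_normc z : `|Re z| <= normc z.
Proof.
rewrite normcE -[leLHS]sqrtr_sqr ler_sqrt ?addr_ge0 ?sqr_ge0//.
by rewrite lerDl sqr_ge0.
Qed.

Lemma Im_le_normc z : `|Im z| <= normc z.
Proof.
rewrite normcE -[leLHS]sqrtr_sqr ler_sqrt ?addr_ge0 ?sqr_ge0//.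
by rewrite lerDr sqr_ge0.
Qed.

Lemma normc_le_ReIm z : normc z <= `|Re z| + `|Im z|.
Proof.
rewrite -[leRHS]ger0_norm ?addr_ge0// normcE -sqrtr_sqr ler_sqrt ?sqr_ge0//.
rewrite sqrrD -!normrX !(ger0_norm (sqr_ge0 _)) -addrA lerD2l lerDr.
by rewrite mulrn_wge0// mulr_ge0.
Qed.

Lemma real_complexD x y : (x + y)%:C = x%:C + y%:C.
Proof. exact: rmorphD. Qed.

Lemma real_complexM x y : (x * y)%:C = x%:C * y%:C.
Proof. exact: rmorphM. Qed.

Lemma real_complexN x : (- x)%:C = - x%:C.
Proof. exact: rmorphN. Qed.

Lemma real_complexV x : (x^-1)%:C = x%:C^-1.
Proof. exact: fmorphV. Qed.

Lemma natr_complex n : (n%:R : R[i]) = (n%:R : R)%:C.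
Proof. by rewrite rmorph_nat. Qed.

Lemma cexpD z1 z2 : cexp (z1 + z2) = cexp z1 * cexp z2.
Proof.
case: z1 => a b; case: z2 => c d; rewrite /cexp /= expRD sinD cosD.
by apply/eqP; rewrite eq_complex /=; apply/andP; split; apply/eqP; ring.
Qed.

Lemma cexp0 : cexp (0 : R[i]) = 1.
Proof. by rewrite /cexp /= expR0 cos0 sin0 mulr1 mulr0. Qed.

Lemma cexpR x : cexp x%:C = (expR x)%:C.
Proof. by rewrite /cexp /= cos0 sin0 mulr1 mulr0. Qed.

Lemma normc_cexp z : normc (cexp z) = expR (Re z).
Proof.
rewrite /= !exprMn -mulrDr cos2Dsin2 mulr1 sqrtr_sqr ger0_norm// expR_ge0.
Qed.

Lemma cexp_neq0 z : cexp z != 0.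
Proof. by rewrite -normc_eq0 normc_cexp gt_eqF ?expR_gt0. Qed.

Lemma cexpN z : cexp (- z) = (cexp z)^-1.
Proof.
apply: (mulfI (cexp_neq0 z)).
by rewrite divff ?cexp_neq0// -cexpD subrr cexp0.
Qed.

End ComplexBasics.

Section ComplexMeasurable.
Variable R : realType.

Definition cmeas d (T : measurableType d) (f : T -> R[i]) :=
  measurable_fun setT (fun x => Re (f x)) /\
  measurable_fun setT (fun x => Im (f x)).

Section Generic.
Context d (T : measurableType d).
Implicit Types (f g : T -> R[i]) (u v : T -> R).

Lemma cmeas_cst (z : R[i]) : cmeas (fun _ : T => z).
Proof. by split; exact: measurable_cst. Qed.

Lemma cmeas_Complex u v : measurable_fun setT u -> measurable_fun setT v ->
  cmeas (fun x => Complex (u x) (v x)).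
Proof. by move=> mu1 mv1; split. Qed.

Lemma cmeas_real u : measurable_fun setT u -> cmeas (fun x => (u x)%:C).
Proof. by move=> mu1; apply: cmeas_Complex => //; exact: measurable_cst. Qed.

Lemma cmeasD f g : cmeas f -> cmeas g -> cmeas (fun x => f x + g x).
Proof.
move=> [f1 f2] [g1 g2]; split; under eq_fun do rewrite ?ReD ?ImD;
exact: measurable_funD.
Qed.

Lemma cmeasN f : cmeas f -> cmeas (fun x => - f x).
Proof.
move=> [f1 f2]; split; under eq_fun do rewrite ?ReN ?ImN;
exact: measurableT_comp.
Qed.

Lemma cmeasM f g : cmeas f -> cmeas g -> cmeas (fun x => f x * g x).
Proof.
move=> [f1 f2] [g1 g2]; split; under eq_fun do rewrite ?ReM ?ImM.
  by apply: measurable_funB; exact: measurable_funM.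
by apply: measurable_funD; exact: measurable_funM.
Qed.

Lemma cmeas_prod (I : Type) (r : seq I) (F : I -> T -> R[i]) :
  (forall i, cmeas (F i)) -> cmeas (fun x => \prod_(i <- r) F i x).
Proof.
move=> mF; elim: r => [|i r IH].
  by under eq_fun do rewrite big_nil; exact: cmeas_cst.
by under eq_fun do rewrite big_cons; exact: cmeasM.
Qed.

Lemma measurable_cosT u : measurable_fun setT u ->
  measurable_fun setT (fun x => cos (u x)).
Proof.
move=> mu1; apply: (@measurableT_comp _ _ _ _ _ _ cos) => //.
by apply: continuous_measurable_fun; exact: continuous_cos.
Qed.

Lemma measurable_sinT u : measurable_fun setT u ->
  measurable_fun setT (fun x => sin (u x)).
Proof.
move=> mu1; apply: (@measurableT_comp _ _ _ _ _ _ sin) => //.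
by apply: continuous_measurable_fun; exact: continuous_sin.
Qed.

Lemma measurable_expRT u : measurable_fun setT u ->
  measurable_fun setT (fun x => expR (u x)).
Proof. by move=> mu1; apply: (@measurableT_comp _ _ _ _ _ _ expR). Qed.

Lemma cmeas_cexp f : cmeas f -> cmeas (fun x => cexp (f x)).
Proof.
move=> [f1 f2]; apply: cmeas_Complex; apply: measurable_funM.
- exact: measurable_expRT.
- exact: measurable_cosT.
- exact: measurable_expRT.
- exact: measurable_sinT.
Qed.

Lemma measurable_normc f : cmeas f -> measurable_fun setT (fun x => normc (f x)).
Proof.
move=> [f1 f2]; under eq_fun do rewrite normcE.
apply: (@measurableT_comp _ _ _ _ _ _ (@Num.sqrt R)) => //.
  by apply: continuous_measurable_fun; exact: sqrt_continuous.
by apply: measurable_funD; exact: measurable_funX.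
Qed.

End Generic.

Lemma cmeas_comp d1 d2 (T1 : measurableType d1) (T2 : measurableType d2)
  (f : T2 -> R[i]) (h : T1 -> T2) : measurable_fun setT h ->
  cmeas f -> cmeas (fun x => f (h x)).
Proof.
by move=> mh [f1 f2]; split;
  [apply: (measurableT_comp f1 mh) | apply: (measurableT_comp f2 mh)].
Qed.

End ComplexMeasurable.

(** * Real integrals: dominated convergence, parameter integrals, Fubini *)

Section Integrals.
Variable R : realType.
Implicit Types (f g : R -> R).

Definition intg f := (@lebesgue_measure R).-integrable setT (EFin \o f).

Definition cintg (f : R -> R[i]) :=
  intg (fun x => Re (f x)) /\ intg (fun x => Im (f x)).

Lemma intg_meas f : intg f -> measurable_fun setT f.
Proof. by move=> /integrableP[/measurable_EFinP]. Qed.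

Lemma le_intg f g : measurable_fun setT f -> (forall x, `|f x| <= g x) ->
  intg g -> intg f.
Proof.
move=> mf fg; apply: le_integrable => //; first exact/measurable_EFinP.
by move=> x _; rewrite /= lee_fin (le_trans (fg x))// ler_norm.
Qed.

Lemma EFin_Rint f : intg f -> (Rint f)%:E = (\int[mu]_x (f x)%:E)%E.
Proof. by move=> fi; rewrite /Rint /Rintegral fineK//; exact: integrable_fin_num. Qed.

Lemma intgD f g : intg f -> intg g -> intg (fun x => f x + g x).
Proof.
move=> fi gi; rewrite /intg (_ : _ \o _ = (EFin \o f) \+ (EFin \o g))%E//.
exact: integrableD.
Qed.

Lemma intgZ k f : intg f -> intg (fun x => k * f x).
Proof.
move=> fi; rewrite /intg (_ : _ \o _ = fun x => k%:E * (EFin \o f) x)%E//.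
exact: integrableZl.
Qed.

Lemma intgN f : intg f -> intg (fun x => - f x).
Proof.
by move=> /(intgZ (-1)); under eq_fun do rewrite mulN1r.
Qed.

Lemma intgB f g : intg f -> intg g -> intg (fun x => f x - g x).
Proof. by move=> fi gi; apply: intgD => //; exact: intgN. Qed.

Lemma RintD f g : intg f -> intg g -> Rint (fun x => f x + g x) = Rint f + Rint g.
Proof. by move=> fi gi; exact: RintegralD. Qed.

Lemma RintB f g : intg f -> intg g -> Rint (fun x => f x - g x) = Rint f - Rint g.
Proof. by move=> fi gi; exact: RintegralB. Qed.

Lemma RintZ k f : intg f -> Rint (fun x => k * f x) = k * Rint f.
Proof. by move=> fi; exact: RintegralZl. Qed.

Lemma le_Rint f g : intg f -> intg g -> (forall x, f x <= g x) -> Rint f <= Rint g.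
Proof. by move=> fi gi fg; apply: le_Rintegral. Qed.

Lemma Rint_ge0 f : (forall x, 0 <= f x) -> 0 <= Rint f.
Proof. by move=> f0; apply: Rintegral_ge0. Qed.

Lemma normr_Rint_le f g : measurable_fun setT f -> (forall x, `|f x| <= g x) ->
  intg g -> `|Rint f| <= Rint g.
Proof.
move=> mf fg gi; have fi := le_intg mf fg gi.
apply: le_trans (le_normr_Rintegral _ fi) _ => //.
apply: le_Rintegral => //; apply: (@le_intg _ g) => //.
  exact: measurableT_comp.
by move=> x; rewrite normr_id.
Qed.

Lemma intg_dominated (f_ : nat -> R -> R) f g :
  (forall n, measurable_fun setT (f_ n)) ->
  (forall x, f_ n x @[n --> \oo] --> f x) ->
  (forall n x, `|f_ n x| <= g x) -> intg g ->
  intg f /\ Rint (f_ n) @[n --> \oo] --> Rint f.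
Proof.
move=> mf_ cf fg gi.
have mf : measurable_fun setT f.
  by apply: (measurable_realfun.measurable_fun_cvg mf_) => x _; exact: cf.
have fi : intg f.
  apply: (le_intg mf _ gi) => x.
  by apply: (cvgr_to_le (cvg_norm (cf x))); apply: nearW => n; exact: fg.
split => //; apply: fine_cvg; rewrite -/(Rint f) EFin_Rint//.
apply: (@dominated_cvg _ _ R (@lebesgue_measure R) setT measurableT
  (fun n x => (f_ n x)%:E) (EFin \o f) (EFin \o g)) => //.
- by move=> n; apply/measurable_EFinP; exact: mf_.
- by move=> x _; apply: cvg_EFin; [exact: nearW|exact: cf].
- by move=> n x _; rewrite /= lee_fin.
Qed.

(** Tonelli's measurability result concerns nonnegative functions, so the positive and negative
    parts are treated separately and recombined under [fine]. *)
Lemma measurable_Rint_param d (T : measurableType d) (f : T * measurableTypeR R -> R) :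
  measurable_fun setT f -> measurable_fun setT (fun x => Rint (fun y => f (x, y))).
Proof.
move=> mf; have mEf : measurable_fun setT (EFin \o f) by exact/measurable_EFinP.
apply: (@measurableT_comp _ _ _ _ _ _ (@fine R)) => //.
under eq_fun do rewrite integralE.
apply: emeasurable_funB.
- have H := @measurable_fun_fubini_tonelli_F _ _ T (measurableTypeR R) R
    lebesgue_measure ((EFin \o f)^\+%E) (measurable_funepos mEf) (fun _ => funepos_ge0 _ _).
  apply: eq_measurable_fun H => x _; apply: eq_integral => y _.
  by rewrite !funeposE.
- have H := @measurable_fun_fubini_tonelli_F _ _ T (measurableTypeR R) R
    lebesgue_measure ((EFin \o f)^\-%E) (measurable_funeneg mEf) (fun _ => funeneg_ge0 _ _).
  apply: eq_measurable_fun H => x _; apply: eq_integral => y _.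
  by rewrite !funenegE.
Qed.

(** An integrable function is finite almost everywhere. This is the bridge between Fubini's theorem,
    whose inner integrals are extended reals, and the real-valued [Rint]. *)
Lemma integral_fine (h : R -> \bar R) :
  (@lebesgue_measure R).-integrable setT h ->
  (\int[mu]_x (fine (h x))%:E = \int[mu]_x h x)%E.
Proof.
move=> hi; apply: ae_eq_integral => //.
- apply/measurable_EFinP; apply: (@measurableT_comp _ _ _ _ _ _ (@fine R)) => //.
  exact: (measurable_int _ hi).
- exact: (measurable_int _ hi).
- have := @integrable_ae _ _ R (@lebesgue_measure R) setT measurableT h hi.
  by apply: filterS => x /(_ I) hx _; rewrite fineK.
Qed.

Lemma intg_fine (h : R -> \bar R) :
  (@lebesgue_measure R).-integrable setT h -> intg (fine \o h).
Proof.
move=> hi; apply/integrableP; split.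
  apply/measurable_EFinP; apply: (@measurableT_comp _ _ _ _ _ _ (@fine R)) => //.
  exact: (measurable_int _ hi).
have /integrableP[_] := hi; apply: le_lt_trans.
apply: ge0_le_integral => //.
- apply: measurableT_comp => //; apply/measurable_EFinP.
  apply: (@measurableT_comp _ _ _ _ _ _ (@fine R)) => //.
  exact: (measurable_int _ hi).
- by apply: measurableT_comp => //; exact: (measurable_int _ hi).
- by move=> x _ /=; case: (h x) => [r||] //=; rewrite normr0 leey.
Qed.

Section RealFubini.
Variable f : measurableTypeR R * measurableTypeR R -> R.
Variable B : R -> R.
Hypothesis mf : measurable_fun setT f.
Hypothesis fB : forall x, (\int[mu]_y (`|f (x, y)|%:E) <= (B x)%:E)%E.
Hypothesis iB : intg B.

(** By Tonelli it is enough that the iterated integral of the absolute value is finite, and [B]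
    bounds its inner integral. *)
Let prod_intg : (lebesgue_measure \x lebesgue_measure)%E.-integrable setT (EFin \o f).
Proof.
have mEf : measurable_fun setT (EFin \o f) by exact/measurable_EFinP.
apply/(@integrable12ltyP _ _ _ _ _ lebesgue_measure lebesgue_measure) => //.
have /integrableP[_] := iB; apply: le_lt_trans.
apply: ge0_le_integral => //.
- by move=> x _; apply: integral_ge0.
- apply: (@measurable_fun_fubini_tonelli_F _ _ (measurableTypeR R)
    (measurableTypeR R) R lebesgue_measure (abse \o (EFin \o f))) => //.
  exact: measurableT_comp.
  by move=> x; exact: abse_ge0.
- by have /integrableP[mB _] := iB; exact: measurableT_comp.
- move=> x _; apply: le_trans (fB x) _.
  by rewrite lee_fin ler_norm.
Qed.

Let swap_intg : (lebesgue_measure \x lebesgue_measure)%E.-integrable setT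
  (fun z => (f (z.2, z.1))%:E).
Proof.
have mEf : measurable_fun setT (EFin \o f) by exact/measurable_EFinP.
apply/(@integrable12ltyP _ _ _ _ _ lebesgue_measure lebesgue_measure).
  apply/measurable_EFinP; apply: (measurableT_comp mf).
  by apply: measurable_fun_pair; [exact: measurable_snd|exact: measurable_fst].
exact: (@integrable21ltyP _ _ _ _ _ lebesgue_measure lebesgue_measure _ mEf).1
  prod_intg.
Qed.

Lemma intg_Rint_left : intg (fun x => Rint (fun y => f (x, y))).
Proof.
apply: (@intg_fine (fun x => (\int[mu]_y (f (x, y))%:E)%E)).
exact: (integrable_fubini_F prod_intg).
Qed.

Lemma intg_Rint_right : intg (fun y => Rint (fun x => f (x, y))).
Proof.
apply: (@intg_fine (fun y => (\int[mu]_x (f (x, y))%:E)%E)).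
exact: (integrable_fubini_F swap_intg).
Qed.

Lemma Rint_swap : Rint (fun x => Rint (fun y => f (x, y))) =
                  Rint (fun y => Rint (fun x => f (x, y))).
Proof.
rewrite /Rint {1}/Rintegral [in RHS]/Rintegral; congr fine.
rewrite (@integral_fine (fun x => (\int[mu]_y (f (x, y))%:E)%E)); last first.
  exact: (integrable_fubini_F prod_intg).
rewrite (@integral_fine (fun y => (\int[mu]_x (f (x, y))%:E)%E)); last first.
  exact: (integrable_fubini_F swap_intg).
exact: (Fubini prod_intg).
Qed.

End RealFubini.

End Integrals.

(** * Complex integrals, by components *)

Section ComplexIntegral.
Variable R : realType.
Implicit Types (f g : R -> R[i]) (h : R -> R).

Local Notation R2 := (measurableTypeR R * measurableTypeR R)%type.

Lemma cintg_meas f : cintg f -> cmeas f.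
Proof. by move=> [f1 f2]; split; exact: intg_meas. Qed.

Lemma cintg_dom f h : cmeas f -> (forall x, normc (f x) <= h x) -> intg h -> cintg f.
Proof.
move=> [f1 f2] fh hi; split; apply: (le_intg _ _ hi) => // x.
  exact: le_trans (Re_le_normc _) _.
exact: le_trans (Im_le_normc _) _.
Qed.

Lemma cintgD f g : cintg f -> cintg g -> cintg (fun x => f x + g x).
Proof.
move=> [f1 f2] [g1 g2]; split; under eq_fun do rewrite ?ReD ?ImD; exact: intgD.
Qed.

Lemma cintgZ k f : cintg f -> cintg (fun x => k * f x).
Proof.
move=> [f1 f2]; split; under eq_fun do rewrite ?ReM ?ImM.
  by apply: intgB; exact: intgZ.
by apply: intgD; exact: intgZ.
Qed.

Lemma cintD f g : cintg f -> cintg g -> cint (fun x => f x + g x) = cint f + cint g.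
Proof.
move=> [f1 f2] [g1 g2]; rewrite -[RHS]complex_eta ReD ImD /=; congr Complex.
  by under eq_fun do rewrite ReD; exact: RintD.
by under eq_fun do rewrite ImD; exact: RintD.
Qed.

Lemma cintZ k f : cintg f -> cint (fun x => k * f x) = k * cint f.
Proof.
move=> [f1 f2]; rewrite -[RHS]complex_eta ReM ImM /=; congr Complex.
  under eq_fun do rewrite ReM.
  by rewrite RintB; [rewrite !RintZ|exact: intgZ..].
under eq_fun do rewrite ImM.
by rewrite RintD; [rewrite !RintZ|exact: intgZ..].
Qed.

Lemma cintB f g : cintg f -> cintg g -> cint (fun x => f x - g x) = cint f - cint g.
Proof.
move=> fi gi; under eq_fun do rewrite -mulN1r.
by rewrite cintD// ?cintZ ?mulN1r//; exact: cintgZ.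
Qed.

Lemma cint0 : cint (fun _ : R => 0) = 0.
Proof. by rewrite /cint /Rint /Rintegral /= !integral0. Qed.

Lemma cint_sum (I : Type) (r : seq I) (F : I -> R -> R[i]) :
  (forall i, cintg (F i)) ->
  cintg (fun x => \sum_(i <- r) F i x) /\
  cint (fun x => \sum_(i <- r) F i x) = \sum_(i <- r) cint (F i).
Proof.
move=> Fi; elim: r => [|i r [IH1 IH2]].
  under eq_fun do rewrite big_nil; rewrite big_nil cint0; split => //.
  by split; exact: integrable0.
under eq_fun do rewrite big_cons; rewrite big_cons -IH2; split.
  exact: cintgD.
exact: cintD.
Qed.

(** The factor 2 comes from bounding the real and the imaginary part separately by the same [h]. *)
Lemma normc_cint_le f h : cmeas f -> (forall x, normc (f x) <= h x) -> intg h ->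
  normc (cint f) <= 2 * Rint h.
Proof.
move=> [f1 f2] fh hi; apply: le_trans (normc_le_ReIm _) _.
rewrite mulr_natl mulr2n; apply: lerD; apply: normr_Rint_le => // x.
  exact: le_trans (Re_le_normc _) _.
exact: le_trans (Im_le_normc _) _.
Qed.

(** Convergence is taken componentwise, so that the limit theorems for real sequences and real
    integrals apply directly. *)
Definition ccvg (u : nat -> R[i]) (l : R[i]) :=
  (Re (u n) @[n --> \oo] --> Re l) /\ (Im (u n) @[n --> \oo] --> Im l).

Lemma ccvg_cst l : ccvg (fun _ => l) l.
Proof. by split; exact: cvg_cst. Qed.

Lemma ccvgD u v l m : ccvg u l -> ccvg v m -> ccvg (fun n => u n + v n) (l + m).
Proof.
move=> [u1 u2] [v1 v2]; split; under eq_fun do rewrite ?ReD ?ImD;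
by rewrite ?ReD ?ImD; exact: cvgD.
Qed.

Lemma ccvgM u v l m : ccvg u l -> ccvg v m -> ccvg (fun n => u n * v n) (l * m).
Proof.
move=> [u1 u2] [v1 v2]; split; under eq_fun do rewrite ?ReM ?ImM;
rewrite ?ReM ?ImM.
  by apply: cvgB; exact: cvgM.
by apply: cvgD; exact: cvgM.
Qed.

Lemma ccvg_sum (I : Type) (r : seq I) (F : I -> nat -> R[i]) (l : I -> R[i]) :
  (forall i, ccvg (F i) (l i)) ->
  ccvg (fun n => \sum_(i <- r) F i n) (\sum_(i <- r) l i).
Proof.
move=> Fl; elim: r => [|i r IH].
  by under eq_fun do rewrite big_nil; rewrite big_nil; exact: ccvg_cst.
by under eq_fun do rewrite big_cons; rewrite big_cons; exact: ccvgD.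
Qed.

Lemma ccvg_unique u l m : ccvg u l -> ccvg u m -> l = m.
Proof.
move=> [u1 u2] [v1 v2]; rewrite -(complex_eta l) -(complex_eta m).
by rewrite (cvg_unique _ u1 v1) // (cvg_unique _ u2 v2).
Qed.

Lemma ccvg_normc u l : ccvg u l -> normc (u n) @[n --> \oo] --> normc l.
Proof.
move=> [u1 u2]; under eq_fun do rewrite normcE.
rewrite normcE; apply: (cvg_comp _ (@Num.sqrt R)); last exact: sqrt_continuous.
by apply: cvgD; rewrite expr2; under eq_fun do rewrite expr2; exact: cvgM.
Qed.

Lemma ccvg_squeeze (u : nat -> R[i]) (l : R[i]) (e : nat -> R) :
  (forall n, normc (u n - l) <= e n) -> e n @[n --> \oo] --> 0 -> ccvg u l.
Proof.
move=> ue e0; split; apply/subr_cvg0; apply: norm_cvg0;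
  apply: (squeeze_cvgr _ (cvg_cst 0) e0); apply: nearW => n; rewrite normr_ge0 /=;
  apply: le_trans (ue n).
- by rewrite -ReN -ReD; exact: Re_le_normc.
- by rewrite -ImN -ImD; exact: Im_le_normc.
Qed.

Lemma cint_dominated (f_ : nat -> R -> R[i]) f h :
  (forall n, cmeas (f_ n)) -> (forall x, ccvg (fun n => f_ n x) (f x)) ->
  (forall n x, normc (f_ n x) <= h x) -> intg h ->
  cintg f /\ ccvg (fun n => cint (f_ n)) (cint f).
Proof.
move=> mf cf fh hi.
have [] := @intg_dominated R (fun n x => Re (f_ n x)) (fun x => Re (f x)) h.
- by move=> n; have [] := mf n.
- by move=> x; have [] := cf x.
- by move=> n x; apply: le_trans (Re_le_normc _) _.
- by [].
move=> i1 c1.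
have [] := @intg_dominated R (fun n x => Im (f_ n x)) (fun x => Im (f x)) h.
- by move=> n; have [] := mf n.
- by move=> x; have [] := cf x.
- by move=> n x; apply: le_trans (Im_le_normc _) _.
- by [].
by move=> i2 c2; split; split.
Qed.

Lemma cmeas_cint_param d (T : measurableType d) (f : T * measurableTypeR R -> R[i]) :
  cmeas f -> cmeas (fun x => cint (fun y => f (x, y))).
Proof.
move=> [f1 f2]; split; rewrite /cint /=.
  exact: (measurable_Rint_param f1).
exact: (measurable_Rint_param f2).
Qed.

Section Fubini.
Variables (f : R2 -> R[i]) (h : R -> R -> R).
Hypothesis mf : cmeas f.
Hypothesis ih : forall x, intg (h x).
Hypothesis fh : forall x y, normc (f (x, y)) <= h x y.
Hypothesis ihh : intg (fun x => Rint (h x)).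

Let part (p : R[i] -> R) : measurable_fun setT (p \o f) ->
  (forall z, `|p z| <= normc z) ->
  forall x, (\int[mu]_y (`|(p \o f) (x, y)|%:E) <= (Rint (h x))%:E)%E.
Proof.
move=> mp pn x; rewrite EFin_Rint//; apply: ge0_le_integral => //.
- apply/measurable_EFinP.
  have my : measurable_fun setT (fun y : measurableTypeR R => (p \o f) (x, y)).
    apply: (measurableT_comp mp).
    by apply: measurable_fun_pair; [exact: measurable_cst|exact: measurable_id].
  exact: measurableT_comp.
- exact: (measurable_int _ (ih x)).
- by move=> y _; rewrite lee_fin; apply: le_trans (fh x y); exact: pn.
Qed.

Lemma cintg_cint_left : cintg (fun x => cint (fun y => f (x, y))).
Proof.
have [f1 f2] := mf; split.
  exact: (intg_Rint_left f1 (part f1 (@Re_le_normc R)) ihh).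
exact: (intg_Rint_left f2 (part f2 (@Im_le_normc R)) ihh).
Qed.

Lemma cintg_cint_right : cintg (fun y => cint (fun x => f (x, y))).
Proof.
have [f1 f2] := mf; split.
  exact: (intg_Rint_right f1 (part f1 (@Re_le_normc R)) ihh).
exact: (intg_Rint_right f2 (part f2 (@Im_le_normc R)) ihh).
Qed.

Lemma cint_swap : cint (fun x => cint (fun y => f (x, y))) =
                  cint (fun y => cint (fun x => f (x, y))).
Proof.
have [f1 f2] := mf; congr Complex.
  exact: (Rint_swap f1 (part f1 (@Re_le_normc R)) ihh).
exact: (Rint_swap f2 (part f2 (@Im_le_normc R)) ihh).
Qed.

End Fubini.

Lemma cint_swap_prod (f : R2 -> R[i]) (g h : R -> R) : cmeas f ->
  (forall x y, normc (f (x, y)) <= g x * h y) -> intg g -> intg h ->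
  cint (fun x => cint (fun y => f (x, y))) = cint (fun y => cint (fun x => f (x, y))).
Proof.
move=> mf fgh gi hi; apply: (@cint_swap f (fun x y => g x * h y)) => //.
  by move=> x; exact: intgZ.
rewrite (_ : (fun x => _) = (fun x => Rint h * g x)); first exact: intgZ.
by apply/funext => x; rewrite RintZ// mulrC.
Qed.

End ComplexIntegral.

(** * Affine changes of variable and reflection *)

Section RealLine.
Variable R : realType.
Implicit Types (f g : R -> R).

Section Affine.
Variables (k v : R).
Hypothesis k0 : 0 < k.

Let phi (x : measurableTypeR R) : measurableTypeR R := k * x + v.

Let mphi : measurable_fun setT phi.
Proof. by apply: measurable_funD => //; exact: measurable_funM. Qed.

Let m1 : {measure set (measurableTypeR R) -> \bar R} :=
  measure_function_pushforward__canonical__measure_function_Measure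
    (@lebesgue_measure R) mphi.

(** Uniqueness of Lebesgue measure reduces the claim to half-open intervals: the preimage of []a,
    b]] has length (b - a) / k, and the scaling by k compensates. *)
Let lebesgue_affine (A : set R) : measurable A ->
  mu A = mscale (NngNum (ltW k0)) m1 A.
Proof.
move=> mA; apply: (@lebesgue_measure_unique R (mscale (NngNum (ltW k0)) m1)) => //.
move=> _ [[a b]] _ <-.
rewrite -[RHS]/(k%:E * mu (phi @^-1` `]a, b]%classic))%E.
rewrite (_ : _ @^-1` _ = `](a - v) / k, (b - v) / k]%classic); last first.
  apply/seteqP; split => x /=; rewrite !in_itv /= ltr_pdivrMr// ler_pdivlMr//;
  by rewrite ltrBlDr lerBrDr mulrC.
rewrite !lebesgue_measure_itv /= !lte_fin ltr_pM2r ?invr_gt0// ltrD2r.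
case: ifPn => ab; last by rewrite mule0.
by rewrite -?EFinB -?EFinM; congr EFin; field; rewrite gt_eqF.
Qed.

Lemma ge0_integral_affine (f : R -> \bar R) :
  measurable_fun setT f -> (forall x, 0 <= f x)%E ->
  (\int[mu]_x f x = k%:E * \int[mu]_x f (k * x + v)%R)%E.
Proof.
move=> mf f0; transitivity (\int[mscale (NngNum (ltW k0)) m1]_x f x)%E.
  by apply: eq_measure_integral => A mA _; exact: lebesgue_affine.
rewrite ge0_integral_mscale//=; congr (_ * _)%E.
by rewrite ge0_integral_pushforward// preimage_setT.
Qed.

End Affine.

Section Substitution.
Variables (k : R) (phi : R -> R).
Hypothesis k0 : 0 < k.
Hypothesis mphi : measurable_fun setT phi.
Hypothesis subst_ge0 : forall f : R -> \bar R, measurable_fun setT f ->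
  (forall x, 0 <= f x)%E -> (\int[mu]_x f x = k%:E * \int[mu]_x f (phi x))%E.

Lemma intg_subst f : intg f -> intg (fun x => f (phi x)).
Proof.
move=> fi; have mf := intg_meas fi; apply/integrableP; split.
  by apply/measurable_EFinP; exact: (measurableT_comp mf mphi).
have /integrableP[_] := fi.
rewrite (subst_ge0 (f := fun x => (`|(EFin \o f) x|)%E)) //; last first.
  by apply/measurable_EFinP; exact: measurableT_comp.
set J := (\int[mu]_x `|(EFin \o (fun x => f (phi x))) x|)%E.
have J0 : (0 <= J)%E by exact: integral_ge0.
(* An infinite [J] would make [k * J] infinite, against the integrability of [f]. *)
case: J J0 => [r||] //= _; first by move=> _; rewrite ltry.
by rewrite gt0_muley ?lte_fin.
Qed.

Let Rint_subst_ge0 f : intg f -> (forall x, 0 <= f x) ->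
  Rint f = k * Rint (fun x => f (phi x)).
Proof.
move=> fi f0; apply: EFin_inj; rewrite EFinM !EFin_Rint//; last exact: intg_subst.
apply: (subst_ge0 (f := EFin \o f)) => //.
by apply/measurable_EFinP; exact: intg_meas.
Qed.

(** Extends the nonnegative case by writing [f] as the difference of (|f| + f) / 2 and (|f| - f) /
    2. *)
Lemma Rint_subst f : intg f -> Rint f = k * Rint (fun x => f (phi x)).
Proof.
move=> fi; have mf := intg_meas fi.
have ip : intg (fun x => (`|f x| + f x) / 2).
  apply: (@le_intg _ _ (fun x => `|f x|)); last exact: integrable_norm.
    apply: measurable_funM => //; apply: measurable_funD => //.
    exact: measurableT_comp.
  move=> x; rewrite ger0_norm; last by have := ler_norm (- f x); rewrite normrN; lra.
  by have := ler_norm (f x); lra.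
have im : intg (fun x => (`|f x| - f x) / 2).
  apply: (@le_intg _ _ (fun x => `|f x|)); last exact: integrable_norm.
    apply: measurable_funM => //; apply: measurable_funB => //.
    exact: measurableT_comp.
  move=> x; rewrite ger0_norm; last by have := ler_norm (f x); lra.
  by have := ler_norm (- f x); rewrite normrN; lra.
have fE x : f x = (`|f x| + f x) / 2 - (`|f x| - f x) / 2 by lra.
rewrite [in LHS](funext fE) RintB//.
rewrite (Rint_subst_ge0 ip); last first.
  by move=> x; have := ler_norm (- f x); rewrite normrN; lra.
rewrite (Rint_subst_ge0 im); last by move=> x; have := ler_norm (f x); lra.
rewrite -mulrBr -RintB; first by under eq_fun do rewrite -fE.
- exact: (intg_subst ip).
- exact: (intg_subst im).
Qed.

End Substitution.

Let measurable_affine (k v : R) : measurable_fun setT (fun x : R => k * x + v).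
Proof. by apply: measurable_funD => //; exact: measurable_funM. Qed.

Lemma intg_affine k v f : 0 < k -> intg f -> intg (fun x => f (k * x + v)).
Proof.
move=> k0; apply: (intg_subst k0 (measurable_affine k v)) => g mg g0.
exact: ge0_integral_affine.
Qed.

Lemma Rint_affine k v f : 0 < k -> intg f -> Rint f = k * Rint (fun x => f (k * x + v)).
Proof.
move=> k0; apply: (Rint_subst k0 (measurable_affine k v)) => g mg g0.
exact: ge0_integral_affine.
Qed.

Let ge0_integralN (f : R -> \bar R) : measurable_fun setT f ->
  (forall x, 0 <= f x)%E -> (\int[mu]_x f x = 1%:E * \int[mu]_x f (- x)%R)%E.
Proof.
move=> mf f0; rewrite mul1e.
transitivity (\int[pushforward mu (-%R : R -> measurableTypeR R)]_x f x)%E.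
  by apply: eq_measure_integral => A mA _; exact/esym/lebesgue_measureN.
by rewrite ge0_integral_pushforward// preimage_setT.
Qed.

Lemma intg_opp f : intg f -> intg (fun x => f (- x)).
Proof. exact: (intg_subst ltr01 (@oppr_measurable R setT) ge0_integralN). Qed.

Lemma Rint_opp f : intg f -> Rint f = Rint (fun x => f (- x)).
Proof.
by move=> fi; rewrite (Rint_subst ltr01 (@oppr_measurable R setT) ge0_integralN fi) mul1r.
Qed.

Lemma cintg_affine k v (f : R -> R[i]) : 0 < k -> cintg f ->
  cintg (fun x => f (k * x + v)).
Proof. by move=> k0 [/(intg_affine v k0) f1 /(intg_affine v k0) f2]. Qed.

Lemma cint_affine k v (f : R -> R[i]) : 0 < k -> cintg f ->
  cint f = k%:C * cint (fun x => f (k * x + v)).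
Proof.
move=> k0 [f1 f2]; rewrite -[RHS]complex_eta ReM ImM /= !mul0r subr0 addr0.
by rewrite /cint (Rint_affine v k0 f1) (Rint_affine v k0 f2).
Qed.

Lemma cintg_opp (f : R -> R[i]) : cintg f -> cintg (fun x => f (- x)).
Proof. by move=> [/intg_opp f1 /intg_opp f2]. Qed.

Lemma cint_opp (f : R -> R[i]) : cintg f -> cint f = cint (fun x => f (- x)).
Proof. by move=> [f1 f2]; rewrite /cint (Rint_opp f1) (Rint_opp f2). Qed.

Lemma cintg_shift v (f : R -> R[i]) : cintg f -> cintg (fun x => f (x + v)).
Proof.
by move=> /(cintg_affine v ltr01); under eq_fun do rewrite mul1r.
Qed.

Lemma cint_shift v (f : R -> R[i]) : cintg f -> cint f = cint (fun x => f (x + v)).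
Proof.
move=> fi; rewrite (cint_affine v ltr01 fi) mul1r.
by under eq_fun do rewrite mul1r.
Qed.

End RealLine.

Section DeriveRules.
Variable R : realType.
Implicit Types (f g : R -> R) (x a b : R).

Lemma is_derive_funM f g x a b : is_derive x 1 f a -> is_derive x 1 g b ->
  is_derive x 1 (fun t => f t * g t) (a * g x + f x * b).
Proof.
move=> df dg; apply: (is_derive_eq (is_deriveM df dg)).
by rewrite /GRing.scale /=; ring.
Qed.

Lemma is_derive_funD f g x a b : is_derive x 1 f a -> is_derive x 1 g b ->
  is_derive x 1 (fun t => f t + g t) (a + b).
Proof. by move=> df dg; exact: is_deriveD. Qed.

Lemma is_derive_funN f x a : is_derive x 1 f a -> is_derive x 1 (fun t => - f t) (- a).
Proof. by move=> df; exact: is_deriveN. Qed.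

Lemma is_derive_fun_cst b x : is_derive x 1 (fun=> b) 0.
Proof. exact: is_derive_cst. Qed.

Lemma is_derive_fun_id x : is_derive x 1 (fun t => t) 1.
Proof. exact: is_derive_id. Qed.

Lemma is_derive_funZ b f x a : is_derive x 1 f a -> is_derive x 1 (fun t => b * f t) (b * a).
Proof.
move=> df; apply: (is_derive_eq (is_derive_funM (is_derive_fun_cst b x) df)).
by rewrite mul0r add0r.
Qed.

Lemma is_derive_funX n f x a : is_derive x 1 f a ->
  is_derive x 1 (fun t => f t ^+ n) (n%:R * f x ^+ n.-1 * a).
Proof.
move=> df; elim: n => [|n IH].
  by rewrite mul0r mul0r; exact: is_derive_fun_cst.
rewrite (_ : (fun t => _) = fun t => f t * f t ^+ n); last first.
  by apply/funext => t; rewrite exprS.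
apply: (is_derive_eq (is_derive_funM df IH)).
case: n {IH} => [|n] /=; first by rewrite !expr0; ring.
by rewrite -(natr1 n.+1) exprS; ring.
Qed.

Lemma is_derive_expR_comp f x a : is_derive x 1 f a ->
  is_derive x 1 (fun t => expR (f t)) (expR (f x) * a).
Proof. by move=> df; exact: (is_derive1_comp (is_derive_expR _) df). Qed.

Lemma is_derive_cos_comp f x a : is_derive x 1 f a ->
  is_derive x 1 (fun t => cos (f t)) (- sin (f x) * a).
Proof. by move=> df; exact: (is_derive1_comp (is_derive_cos _) df). Qed.

Lemma is_derive_sin_comp f x a : is_derive x 1 f a ->
  is_derive x 1 (fun t => sin (f t)) (cos (f x) * a).
Proof. by move=> df; exact: (is_derive1_comp (is_derive_sin _) df). Qed.

Lemma is_derive_atan_comp f x a : is_derive x 1 f a ->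
  is_derive x 1 (fun t => atan (f t)) ((1 + f x ^+ 2)^-1 * a).
Proof. by move=> df; exact: (is_derive1_comp (is_derive1_atan _) df). Qed.

Lemma is_derive_ln_comp f x a : 0 < f x -> is_derive x 1 f a ->
  is_derive x 1 (fun t => ln (f t)) ((f x)^-1 * a).
Proof. by move=> f0 df; exact: (is_derive1_comp (is_derive1_ln f0) df). Qed.

End DeriveRules.

(** * The fundamental theorem on the line, exponential domination, and the substitution by the
    logarithm *)

Section Calculus.
Variable R : realType.
Implicit Types (f g F : R -> R).

Lemma is_derive_continuous F f : (forall x, is_derive x (1 : R) F (f x)) -> continuous F.
Proof.
move=> dF x; apply/differentiable_continuous/derivable1_diffP.
by have [] := dF x.
Qed.

Lemma Rint_derive_eq0 F f : (forall x, is_derive x (1 : R) F (f x)) ->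
  continuous f -> intg f ->
  F n%:R @[n --> \oo] --> 0 -> F (- n%:R) @[n --> \oo] --> 0 -> Rint f = 0.
Proof.
move=> dF cf fi Fp Fm.
have cF := is_derive_continuous dF.
have mf := intg_meas fi.
(* The successor keeps the interval nondegenerate, as the fundamental theorem requires. *)
pose D n : set R := `[- n.+1%:R, n.+1%:R]%classic.
have [] := @intg_dominated R (fun n => f \_ (D n)) f (fun x => `|f x|).
- move=> n; apply/(measurable_restrictT f); first exact: measurable_itv.
  exact: (measurable_funS measurableT (@subsetT _ (D n)) mf).
- move=> x; apply/cvgrPdist_lt => e e0; near=> n.
  rewrite patchE ifT ?subrr ?normr0// inE /D /= in_itv /= -ler_norml.
  rewrite (@le_trans _ _ n%:R) ?ler_nat//.
  by near: n; exact: nbhs_infty_ger.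
- by move=> n x; rewrite patchE; case: ifP => // _; rewrite normr0.
- exact: integrable_norm.
move=> _ lim1.
have E n : Rint (f \_ (D n)) = F n.+1%:R - F (- n.+1%:R).
  rewrite /Rint -Rintegral_mkcond /Rintegral (@continuous_FTC2 R f F)//.
  - by rewrite gtrN.
  - exact: continuous_subspaceT.
  - split=> [x _||].
    + by have [] := dF x.
    + by apply: cvg_at_right_filter; exact: cF.
    + by apply: cvg_at_left_filter; exact: cF.
  - by move=> x _; rewrite derive1E; apply: derive_val.
have lim2 : Rint (f \_ (D n)) @[n --> \oo] --> 0.
  under eq_fun do rewrite E.
  have -> : (0 : R) = 0 - 0 by rewrite subr0.
  apply: cvgB.
    by have := Fp; rewrite -(cvg_shiftS (fun n => F n%:R)).
  by have := Fm; rewrite -(cvg_shiftS (fun n => F (- n%:R))).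
exact: cvg_unique lim1 lim2.
Unshelve. all: by end_near. Qed.

Let intg_expR_abs1 : intg (fun w : R => expR (- `|w|)).
Proof.
have c1 : continuous (fun w : R => expR (- `|w|)).
  move=> x; apply: (cvg_comp _ expR); last exact: continuous_expR.
  by apply: cvgN; exact: norm_continuous.
apply/integrableP; split.
  by apply/measurable_EFinP; exact: continuous_measurable_fun.
under eq_integral => x _ do rewrite /= ger0_norm ?expR_ge0//.
rewrite ge0_symfun_integralT//; last by move=> x /=; rewrite normrN.
rewrite (_ : [set x : R | 0 <= x] = `[0, +oo[%classic); last first.
  by rewrite set_itvE.
rewrite (_ : (\int[_]_(_ in _) _ = \int[mu]_(x in `[0%R, +oo[) (expR (- x))%:E)%E); last first.
  by apply: eq_integral => x; rewrite inE /= in_itv /= andbT => x0; rewrite ger0_norm.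
rewrite (@ge0_continuous_FTC2y R (fun x => expR (- x)) (fun x => - expR (- x)) 0 0).
- by rewrite -EFinB -EFinM ltry.
- by move=> x _; exact: expR_ge0.
- apply: continuous_subspaceT => x.
  apply: (cvg_comp _ expR); last exact: continuous_expR.
  by apply: cvgN; exact: cvg_id.
- by rewrite -oppr0; apply: cvgN; exact: cvgr_expR.
- by move=> x _; exact: ex_derive.
- apply: cvg_at_right_filter; apply: cvgN.
  apply: (cvg_comp _ expR); last exact: continuous_expR.
  by apply: cvgN; exact: cvg_id.
- move=> x _; rewrite derive1E derive_val.
  by rewrite /GRing.scale /=; ring.
Qed.

Lemma intg_expR_abs (d : R) : 0 < d -> intg (fun w => expR (- (d * `|w|))).
Proof.
move=> d0; have := intg_affine 0 d0 intg_expR_abs1.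
by under eq_fun do rewrite addr0 normrM gtr0_norm//.
Qed.

(** The first bound is effective at minus infinity, the second at plus infinity. Together they give
    domination by (A + B) * exp (- min p q * |w|). *)
Lemma intg_expR_two_sided f (p q A B : R) : 0 < p -> 0 < q ->
  measurable_fun setT f ->
  (forall w, `|f w| <= A * expR (p * w)) ->
  (forall w, `|f w| <= B * expR (- (q * w))) -> intg f.
Proof.
move=> p0 q0 mf fA fB.
have A0 : 0 <= A.
  by have := le_trans (normr_ge0 _) (fA 0); rewrite mulr0 expR0 mulr1.
have B0 : 0 <= B.
  by have := le_trans (normr_ge0 _) (fB 0); rewrite mulr0 oppr0 expR0 mulr1.
pose m := Num.min p q; have m0 : 0 < m by rewrite lt_min p0.
apply: (@le_intg _ _ (fun w => (A + B) * expR (- (m * `|w|)))) => //; last first.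
  by apply: intgZ; exact: intg_expR_abs.
move=> w; have [w0|w0] := leP 0 w.
- rewrite (ger0_norm w0); apply: le_trans (fB w) _.
  apply: ler_pM => //; rewrite ?expR_ge0 ?lerDr//.
  by rewrite ler_expR lerN2 ler_wpM2r// ge_min lexx orbT.
- rewrite (ltr0_norm w0); apply: le_trans (fA w) _.
  apply: ler_pM => //; rewrite ?expR_ge0 ?lerDl//.
  rewrite ler_expR mulrN opprK; apply: ler_wnM2r; first exact: ltW.
  by rewrite ge_min lexx.
Qed.


Lemma nbhs_expR_ninfty_bigcup :
  `]0, +oo[%classic = \bigcup_n `[expR (- n%:R), +oo[%classic :> set R.
Proof.
apply/seteqP; split => [x|x [n _]] /=; rewrite !in_itv /= !andbT.
- move=> x0; exists (Num.bound `|ln x|) => //=; rewrite in_itv /= andbT.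
  rewrite -[leRHS]lnK ?posrE// ler_expR lerNl.
  by rewrite (le_trans (ler_norm _))// normrN ltW// archi_boundP.
- by apply: lt_le_trans; exact: expR_gt0.
Qed.

Lemma setT_bigcup_ninfty : [set: R] = \bigcup_n `[- n%:R, +oo[%classic.
Proof.
apply/seteqP; split => [x _|x _] //=.
exists (Num.bound `|x|) => //=; rewrite in_itv /= andbT lerNl.
by rewrite (le_trans (ler_norm _))// normrN ltW// archi_boundP.
Qed.

(** The substitution w = ln u is made on half-lines away from 0, where the derivative of [ln] stays
    continuous up to the endpoint. The factor [expR (- ln u)] is the Jacobian 1 / u. *)
Let ln_subst_n (G : R -> R) n : continuous G -> (forall w, 0 <= G w) ->
  (\int[mu]_(w in `[(- n%:R)%R, +oo[) (G w)%:E =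
   \int[mu]_(u in `[expR (- n%:R), +oo[) (G (ln u) * expR (- ln u))%:E)%E.
Proof.
move=> cG G0; set a := expR (- n%:R); have a0 : 0 < a := expR_gt0 _.
have lna : ln a = - n%:R by rewrite /a expRK.
have dln x : 0 < x -> (@ln R)^`()%classic x = x^-1.
  by move=> x0; rewrite derive1E; have [_ ->] := is_derive1_ln x0.
have gta x : x \in `]a, +oo[ -> 0 < x.
  by rewrite in_itv /= andbT => /(lt_trans a0).
have near_dln (x : R) : 0 < x -> \forall y \near nbhs x, (@ln R)^`()%classic y = y^-1.
  move=> x0; have cx : y @[y --> x] --> x by exact: cvg_id.
  by apply: filterS (cvgr_gt _ cx _ x0) => y; exact: dln.
rewrite -lna (@increasing_ge0_integration_by_substitutiony R (@ln R) G a).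
- apply: eq_integral => u; rewrite inE /= in_itv /= andbT => au.
  have u0 := lt_le_trans a0 au.
  by rewrite fctE dln// expRN lnK.
- move=> x y; rewrite !in_itv /= !andbT => ax ay xy.
  by rewrite ltr_ln ?posrE// (lt_le_trans a0).
- move=> x /gta x0; rewrite /continuous_at (dln _ x0).
  apply: (@cvg_trans _ ((fun y => y^-1) @ x)); last exact: (inv_continuous (lt0r_neq0 x0)).
  apply: near_eq_cvg; near=> y; symmetry; near: y; exact: near_dln.
- apply/cvg_ex; exists a^-1.
  apply: (@cvg_trans _ ((fun y => y^-1) @ a^'+)); last first.
    apply: cvg_at_right_filter; exact: (inv_continuous (lt0r_neq0 a0)).
  apply: near_eq_cvg; near=> y; rewrite dln//; near: y.
  by apply: filterS (nbhs_right_gt a) => y; exact: lt_trans.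
- apply/cvg_ex; exists 0.
  apply: (@cvg_trans _ ((fun y : R => y^-1) @ +oo)); last first.
    apply/gtr0_cvgV0; [exact: nbhs_pinfty_gt|exact: cvg_id].
  by apply: near_eq_cvg; near=> y; rewrite dln.
- split=> [x /gta x0|]; first by have [] := is_derive1_ln x0.
  by apply: cvg_at_right_filter; exact: continuous_ln.
- apply/cvgryPge => A; near=> y.
  by rewrite -[A]expRK ler_ln ?posrE ?expR_gt0.
- exact: continuous_subspaceT.
- by [].
Unshelve. all: by end_near. Qed.

(** Monotone convergence along matching exhaustions of the half-line and of the line. *)
Let ln_subst_ge0 (G : R -> R) : continuous G -> (forall w, 0 <= G w) ->
  (\int[mu]_(u in `]0%R, +oo[) (G (ln u) * expR (- ln u))%:E = \int[mu]_w (G w)%:E)%E.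
Proof.
move=> cG G0.
have mG : measurable_fun setT G by exact: continuous_measurable_fun.
have mGl (A : set R) : measurable A ->
    measurable_fun A (fun u => (G (ln u) * expR (- ln u))%:E).
  move=> mA; apply: measurable_funTS; apply/measurable_EFinP.
  apply: measurable_funM; first exact: (measurableT_comp mG (@measurable_ln R)).
  by apply: measurable_expRT; exact: measurableT_comp.
rewrite setT_bigcup_ninfty nbhs_expR_ninfty_bigcup.
have c1 := @ge0_nondecreasing_set_cvg_integral _ _ R
  (fun n => `[- n%:R, +oo[%classic : set (measurableTypeR R)) (EFin \o G) (@lebesgue_measure R).
have c2 := @ge0_nondecreasing_set_cvg_integral _ _ R
  (fun n => `[expR (- n%:R), +oo[%classic : set (measurableTypeR R)) (fun u => (G (ln u) * expR (- ln u))%:E)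
  (@lebesgue_measure R).
have {}c2 := c2 _ _ _ _; have {}c1 := c1 _ _ _ _.
apply: (cvg_unique _ (c2 _ _ _ _)) => //.
- move=> m n mn; rewrite subsetEset; apply: subset_itvr.
  by rewrite bnd_simp ler_expR lerN2 ler_nat.
- by move=> i; exact: mGl.
- by move=> i x _; rewrite lee_fin mulr_ge0// expR_ge0.
rewrite /=; under eq_fun do rewrite -ln_subst_n//.
apply: c1 => //.
- move=> m n mn; rewrite subsetEset; apply: subset_itvr.
  by rewrite bnd_simp lerN2 ler_nat.
- by move=> i; apply: measurable_funTS; exact/measurable_EFinP.
- by move=> i x _; rewrite lee_fin.
Qed.

(** Turns Euler's integral into an integral over the line. Positive and negative parts are
    transported separately, which settles the non-integrable case as well. *)
Lemma Rint_pos_ln f (G : R -> R) : continuous G ->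
  (forall u, 0 < u -> f u = G (ln u) * expR (- ln u)) -> Rint_pos f = Rint G.
Proof.
move=> cG fG.
rewrite (_ : Rint_pos f = Rint_pos (fun u => G (ln u) * expR (- ln u))); last first.
  by apply: eq_Rintegral => u; rewrite inE /= in_itv /= andbT => /fG.
rewrite /Rint_pos /Rint /Rintegral; congr fine.
rewrite integralE [in RHS]integralE.
have cmax (h : R -> R) : continuous h -> continuous (fun w => Num.max (h w) 0).
  by move=> ch x; apply: continuous_max => //; [exact: ch|exact: cvg_cst].
have cp := cmax _ cG.
have cN : continuous (fun w => - G w) by move=> x; apply: cvgN; exact: cG.
have cm := cmax _ cN.
congr (_ - _)%E.
- rewrite (_ : (\int[mu]_x _)%E = (\int[mu]_w (Num.max (G w) 0)%:E)%E); last first.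
    by apply: eq_integral => x _; rewrite funeposE -EFin_max.
  rewrite -ln_subst_ge0//; last by move=> w; rewrite le_max lexx orbT.
  apply: eq_integral => u; rewrite inE /= in_itv /= andbT => u0.
  rewrite funeposE -EFin_max; congr EFin.
  by rewrite maxr_pMl ?mul0r// expR_ge0.
- rewrite (_ : (\int[mu]_x _)%E = (\int[mu]_w (Num.max (- G w) 0)%:E)%E); last first.
    by apply: eq_integral => x _; rewrite funenegE -EFinN -EFin_max.
  rewrite -ln_subst_ge0//; last by move=> w; rewrite le_max lexx orbT.
  apply: eq_integral => u; rewrite inE /= in_itv /= andbT => u0.
  rewrite funenegE -EFinN -EFin_max; congr EFin.
  by rewrite -mulNr maxr_pMl ?mul0r// expR_ge0.
Qed.

End Calculus.

(** * Gaussian integrals and Fourier inversion *)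

Section Gaussian.
Variable R : realType.
Implicit Types (k x v : R).

Let gk k x := expR (- (x ^+ 2)) * cos (k * x).

Let measurable_sqr : measurable_fun setT (fun x : R => - (x ^+ 2)).
Proof. by apply: measurableT_comp => //; exact: measurable_funX. Qed.

Lemma intg_gauss : intg (fun x : R => expR (- (x ^+ 2))).
Proof. exact: integrableT_gauss. Qed.

Lemma Rint_gauss : Rint (fun x : R => expR (- (x ^+ 2))) = Num.sqrt pi.
Proof. by rewrite /Rint /Rintegral -[LHS]/(fine (\int[mu]_x (gauss_fun x)%:E)%E) integralT_gauss. Qed.

(** Uses |x| <= exp |x| and (|x| - 1)^2 >= 0. The right-hand side dominates the derivative in [k] of
    the Gaussian cosine integral. *)
Let gauss_moment_le x : `|x| * expR (- (x ^+ 2)) <= expR 1 * expR (- (1 * `|x|)).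
Proof.
apply: (@le_trans _ _ (expR `|x| * expR (- (x ^+ 2)))).
  by rewrite ler_wpM2r ?expR_ge0// (le_trans _ (expR_ge1Dx _))// lerDr.
rewrite -!expRD ler_expR -real_normK ?num_real// mul1r.
by have := sqr_ge0 (`|x| - 1); lra.
Qed.

Let measurable_gk k : measurable_fun setT (gk k).
Proof.
apply: measurable_funM; first exact: measurable_expRT.
by apply: measurable_cosT; exact: measurable_funM.
Qed.

Let intg_gk k : intg (gk k).
Proof.
apply: (@le_intg _ _ (fun x : R => expR (- (x ^+ 2)))) => //; last exact: intg_gauss.
move=> x; rewrite normrM ger0_norm ?expR_ge0// ler_piMr ?expR_ge0//.
by rewrite ler_norml cos_geN1 cos_le1.
Qed.

Let is_derive_gauss x : is_derive x 1 (fun t : R => expR (- (t ^+ 2)))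
  (- (2 * x) * expR (- (x ^+ 2))).
Proof.
apply: (is_derive_eq (is_derive_expR_comp (is_derive_funN
  (is_derive_funM (is_derive_fun_id x) (is_derive_fun_id x))))).
by ring.
Qed.

Let intg_moment k : intg (fun x => x * expR (- (x ^+ 2)) * sin (k * x)).
Proof.
apply: (@le_intg _ _ (fun x : R => expR 1 * expR (- (1 * `|x|)))); last 2 first.
- move=> x; apply: le_trans (gauss_moment_le x).
  rewrite !normrM (@ger0_norm _ (expR _)) ?expR_ge0//.
  rewrite ler_piMr ?mulr_ge0 ?expR_ge0//.
  by rewrite ler_norml sin_geN1 sin_le1.
- by apply: intgZ; exact: intg_expR_abs.
apply: measurable_funM; last by apply: measurable_sinT; exact: measurable_funM.
by apply: measurable_funM => //; exact: measurable_expRT.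
Qed.

(** The derivative of exp (- x^2) * sin (k x) integrates to 0. *)
Let gauss_ibp k : Rint (fun x => x * expR (- (x ^+ 2)) * sin (k * x)) =
  k / 2 * Rint (gk k).
Proof.
have cvg0 : (fun n => expR (- (n%:R ^+ 2 : R))) n @[n --> \oo] --> 0.
  apply: (@squeeze_cvgr _ _ _ _ (fun=> 0) (fun n => expR (- n%:R))).
  - apply: nearW => n; rewrite expR_ge0 /= ler_expR lerN2.
    by rewrite -natrX ler_nat; case: n => // n; rewrite leq_pmulr.
  - exact: cvg_cst.
  - exact: (cvg_comp _ _ (@cvgr_idn R) (@cvgr_expR R)).
pose F x : R := expR (- (x ^+ 2)) * sin (k * x).
pose f x := - (2 * (x * expR (- (x ^+ 2)) * sin (k * x))) + k * gk k x.
have dF x : is_derive x (1 : R) F (f x).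
  apply: (is_derive_eq (is_derive_funM (is_derive_gauss x)
    (is_derive_sin_comp (is_derive_funZ k (is_derive_fun_id x))))).
  by rewrite /f /gk; ring.
have cvgF (s : R) : `|s| = 1 -> F (s * n%:R) @[n --> \oo] --> 0.
  move=> s1; apply: norm_cvg0; apply: (@squeeze_cvgr _ _ _ _ (fun=> 0) _ _ _ _ _ cvg0).
    apply: nearW => n; rewrite normr_ge0 /= /F normrM ger0_norm ?expR_ge0//.
    rewrite exprMn -real_normK ?num_real// s1 expr1n mul1r ler_piMr ?expR_ge0//.
    by rewrite ler_norml sin_geN1 sin_le1.
  exact: cvg_cst.
have : Rint f = 0.
  apply: (Rint_derive_eq0 dF).
  (* The derivative of [f] is computed only to obtain its continuity. *)
  - have d2 x : is_derive x (1 : R) f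
      (- (2 * ((1 * expR (- (x ^+ 2)) + x * (- (2 * x) * expR (- (x ^+ 2)))) * sin (k * x)
        + x * expR (- (x ^+ 2)) * (cos (k * x) * (k * 1))))
       + k * (- (2 * x) * expR (- (x ^+ 2)) * cos (k * x)
        + expR (- (x ^+ 2)) * (- sin (k * x) * (k * 1)))).
      exact: (is_derive_funD (is_derive_funN (is_derive_funZ 2
        (is_derive_funM (is_derive_funM (is_derive_fun_id x) (is_derive_gauss x))
          (is_derive_sin_comp (is_derive_funZ k (is_derive_fun_id x))))))
        (is_derive_funZ k (is_derive_funM (is_derive_gauss x)
          (is_derive_cos_comp (is_derive_funZ k (is_derive_fun_id x)))))).
    exact: (is_derive_continuous d2).
  - by apply: intgD; [apply: intgN|]; apply: intgZ => //.
  - by have := cvgF 1 (normr1 _); under eq_fun do rewrite mul1r.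
  - have := cvgF (-1); rewrite normrN normr1 => /(_ erefl).
    by under eq_fun do rewrite mulN1r.
rewrite /f RintD; [|by apply: intgN; apply: intgZ|by apply: intgZ].
rewrite (_ : (fun x => - (2 * _)) = (fun x => (- 2) * (x * expR (- (x ^+ 2)) * sin (k * x)))); last first.
  by apply/funext => x; ring.
by rewrite !RintZ//; lra.
Qed.

Let is_derive_gauss_ft k : is_derive k (1 : R) (fun t => Rint (gk t)) (- (k / 2) * Rint (gk k)).
Proof.
have dgk (t x : R) : is_derive t (1 : R) (gk ^~ x) (- (x * expR (- (x ^+ 2)) * sin (t * x))).
  apply: (is_derive_eq (is_derive_funZ (expR (- (x ^+ 2)))
    (is_derive_cos_comp (is_derive_funM (is_derive_fun_id t) (is_derive_fun_cst x t))))).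
  by ring.
have pE (t x : R) : partial1of2 gk t x = - (x * expR (- (x ^+ 2)) * sin (t * x)).
  by rewrite partial1of2E; have [_ ->] := dgk t x.
have ik : `]k - 1, k + 1[%classic k by rewrite /= in_itv /= ltrBlDr ltrDl ltr01.
have i1 t : `]k - 1, k + 1[%classic t -> (@lebesgue_measure R).-integrable setT (EFin \o gk t).
  by move=> _; exact: intg_gk.
have d1 (t : R) (x : measurableTypeR R) : `]k - 1, k + 1[%classic t -> setT x -> derivable (gk ^~ x) t 1.
  by move=> _ _; have [] := dgk t x.
have g0 (x : measurableTypeR R) : 0 <= expR 1 * expR (- (1 * `|x : R|)).
  by rewrite mulr_ge0 ?expR_ge0.
have ig : (@lebesgue_measure R).-integrable setT
    (EFin \o (fun x : measurableTypeR R => expR 1 * expR (- (1 * `|x : R|)))).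
  by apply: (@intgZ R); exact: intg_expR_abs.
have ub (t : R) (x : measurableTypeR R) : `]k - 1, k + 1[%classic t -> setT x ->
    `|partial1of2 gk t x| <= expR 1 * expR (- (1 * `|x : R|)).
  move=> _ _; rewrite pE normrN; apply: le_trans (gauss_moment_le x).
  rewrite !normrM (@ger0_norm _ (expR _)) ?expR_ge0//.
  rewrite ler_piMr ?mulr_ge0 ?expR_ge0//.
  by rewrite ler_norml sin_geN1 sin_le1.
have D := derivable_under_integral measurableT ik i1 d1 g0 ig ub.
have E := differentiation_under_integral measurableT ik i1 d1 g0 ig ub.
apply: DeriveDef; first exact: D.
rewrite -derive1E E mulNr -gauss_ibp.
rewrite -mulN1r -RintZ//; apply: eq_Rintegral => x _.
by rewrite pE mulN1r.
Qed.

(** The integral solves I' = - (k / 2) I, so that I * exp (k^2 / 4) is constant and equals its value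
    at 0. *)
Lemma Rint_gauss_cos k : Rint (gk k) = Num.sqrt pi * expR (- (k ^+ 2 / 4)).
Proof.
pose h (t : R) := Rint (gk t) * expR (t ^+ 2 / 4).
have dh (t : R) : is_derive t (1 : R) h 0.
  apply: (is_derive_eq (is_derive_funM (is_derive_gauss_ft t)
    (is_derive_expR_comp (is_derive_funM (is_derive_funM (is_derive_fun_id t)
      (is_derive_fun_id t)) (is_derive_fun_cst 4^-1 t))))).
  by field.
have := is_derive_0_is_cst k 0 dh; rewrite /h expr0n /= mul0r expR0 mulr1.
rewrite {2}/gk; under [X in _ = Rint X]eq_fun do rewrite mul0r cos0 mulr1.
rewrite Rint_gauss => <-; rewrite expRN mulfK//.
by rewrite gt_eqF ?expR_gt0.
Qed.

Lemma Rint_odd (f : R -> R) : intg f -> (forall x, f (- x) = - f x) -> Rint f = 0.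
Proof.
move=> fi fo; have := Rint_opp fi; under [X in _ = Rint X]eq_fun do rewrite fo -mulN1r.
by rewrite RintZ//; lra.
Qed.

Let cmeas_gauss (t x : R) : cmeas (fun u : R => cexp (Complex (- (t * u ^+ 2)) (x * u))).
Proof.
apply: cmeas_cexp; apply: cmeas_Complex; last exact: measurable_funM.
by apply: measurableT_comp => //; apply: measurable_funM => //; exact: measurable_funX.
Qed.

Lemma intg_gauss_scaled (t : R) : 0 < t -> intg (fun u : R => expR (- (t * u ^+ 2))).
Proof.
move=> t0; have s0 : 0 < Num.sqrt t by rewrite sqrtr_gt0.
have := intg_affine 0 s0 intg_gauss.
by under eq_fun do rewrite addr0 exprMn sqr_sqrtr ?ltW//.
Qed.

Lemma cintg_gauss (t x : R) : 0 < t ->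
  cintg (fun u : R => cexp (Complex (- (t * u ^+ 2)) (x * u))).
Proof.
move=> t0; apply: (cintg_dom (cmeas_gauss t x) _ (intg_gauss_scaled t0)) => u.
by rewrite normc_cexp.
Qed.

Lemma Rint_gauss_scaled (t : R) : 0 < t ->
  Rint (fun u : R => expR (- (t * u ^+ 2))) = Num.sqrt (pi / t).
Proof.
move=> t0; have s0 : 0 < Num.sqrt t by rewrite sqrtr_gt0.
have := Rint_affine 0 s0 intg_gauss; rewrite Rint_gauss.
under [X in _ = _ * Rint X]eq_fun do rewrite addr0 exprMn sqr_sqrtr ?ltW//.
move=> E; rewrite sqrtrM ?pi_ge0// E sqrtrV ?ltW// mulrAC divff ?mul1r//.
by rewrite gt_eqF.
Qed.

(** Rescaling by sqrt t reduces to t = 1. There the real part is [Rint_gauss_cos] and the imaginary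
    part is odd. *)
Lemma cint_gauss (t x : R) : 0 < t ->
  cint (fun u : R => cexp (Complex (- (t * u ^+ 2)) (x * u))) =
  (Num.sqrt (pi / t) * expR (- (x ^+ 2 / (4 * t))))%:C.
Proof.
move=> t0; have s0 : 0 < Num.sqrt t by rewrite sqrtr_gt0.
pose b (u : R) := cexp (Complex (- (1 * u ^+ 2)) (x / Num.sqrt t * u)).
have bi : cintg b by exact: cintg_gauss.
have Eb : cint b = (Num.sqrt pi * expR (- (x ^+ 2 / (4 * t))))%:C.
  rewrite /cint /b /=; congr Complex.
    under eq_fun do rewrite mul1r.
    rewrite -[LHS]/(Rint (gk _)) Rint_gauss_cos expr_div_n sqr_sqrtr ?ltW//.
    by congr (_ * expR _); field; rewrite gt_eqF.
  apply: Rint_odd; first by have [] := bi.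
  by move=> u; rewrite sqrrN mulrN sinN mulrN.
have := cint_affine 0 s0 bi; rewrite Eb.
rewrite (_ : (fun u => b _) = (fun u : R => cexp (Complex (- (t * u ^+ 2)) (x * u)))); last first.
  apply/funext => u; rewrite /b addr0 exprMn sqr_sqrtr ?ltW// mul1r.
  by congr (cexp (Complex _ _)); field; rewrite gt_eqF.
set I := cint _ => E.
have sC : (Num.sqrt t)%:C != 0 :> R[i] by rewrite (inj_eq (@complexI _)) gt_eqF.
apply: (mulfI sC); rewrite -E -rmorphM; congr (_%:C).
rewrite mulrA sqrtrM ?pi_ge0// sqrtrV ?ltW// mulrCA divff ?mulr1//.
by rewrite gt_eqF.
Qed.

End Gaussian.

(** * Fourier inversion by Gaussian regularisation *)

Section FourierInversion.
Variable R : realType.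
Variables (g : R -> R) (M v : R).
Hypothesis cg : continuous g.
Hypothesis gM : forall w, `|g w| <= M.
Hypothesis ig : intg g.

Let gh (y : R) : R[i] := cint (fun w => (g w)%:C * cexp (Complex 0 (y * w))).
Hypothesis igh : cintg gh.

(** The regularisation parameter is chosen so that 1 / (4 * tn n) = (n + 1)^2: integrating out the
    frequency leaves a Gaussian of width of order 1 / (n + 1) around [v]. *)
Let tn n : R := n.+1%:R ^- 2 / 4.

Let tn_gt0 n : 0 < tn n.
Proof. by rewrite divr_gt0// invr_gt0 exprn_gt0. Qed.

Let A n (y : R) : R[i] :=
  gh y * cexp (Complex 0 (- (y * v))) * (expR (- (tn n * y ^+ 2)))%:C.

Let mg : measurable_fun setT g.
Proof. exact: intg_meas. Qed.

Let cvg_harm : n.+1%:R^-1 @[n --> \oo] --> (0 : R).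
Proof. exact: cvg_harmonic. Qed.

Let A_cvg : ccvg (fun n => cint (A n))
  (cint (fun y => gh y * cexp (Complex 0 (- (y * v))))).
Proof.
have [mgh1 mgh2] := cintg_meas igh.
pose h y := `|Re (gh y)| + `|Im (gh y)|.
have hi : intg h by have [i1 i2] := igh; apply: intgD; exact: integrable_norm.
have mE : cmeas (fun y : R => cexp (Complex 0 (- (y * v)))).
  apply: cmeas_cexp; apply: cmeas_Complex => //.
  by apply: measurableT_comp => //; exact: measurable_funM.
have [] // := @cint_dominated R A
  (fun y => gh y * cexp (Complex 0 (- (y * v)))) h.
- move=> n; apply: cmeasM; first by apply: cmeasM.
  apply: cmeas_real; apply: measurable_expRT; apply: measurableT_comp => //.
  by apply: measurable_funM => //; exact: measurable_funX.
- move=> y; rewrite -[X in ccvg _ X]mulr1; apply: ccvgM; first exact: ccvg_cst.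
  split => /=; last exact: cvg_cst.
  rewrite -[X in _ --> X]expR0.
  apply: (cvg_comp _ expR); last exact: continuous_expR.
  have -> : (0 : R) = - (0 * 0 / 4 * y ^+ 2) by ring.
  apply: cvgN; apply: cvgM; last exact: cvg_cst.
  rewrite /tn; under eq_fun do rewrite expr2 invfM.
  by apply: cvgM; [exact: cvgM|exact: cvg_cst].
- move=> n y; rewrite /A !Normc.normcM normc_cexp normcR [Re _]/= expR0 mulr1.
  rewrite ger0_norm ?expR_ge0//.
  apply: le_trans (normc_le_ReIm (gh y)).
  rewrite ler_piMr ?normc_ge0// -expR0 ler_expR oppr_le0.
  by rewrite mulr_ge0 ?sqr_ge0// ltW.
Qed.

Let F t (z : measurableTypeR R * measurableTypeR R) : R[i] :=
  (g z.2)%:C * cexp (Complex (- (t * z.1 ^+ 2)) ((z.2 - v) * z.1)).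

Let cmeas_F t : cmeas (F t).
Proof.
apply: cmeasM.
  by apply: cmeas_real; exact: (measurableT_comp mg (@measurable_snd _ _ _ _)).
have m1 : measurable_fun setT (fun z : measurableTypeR R * measurableTypeR R => z.1 : R).
  exact: measurable_fst.
have m2 : measurable_fun setT (fun z : measurableTypeR R * measurableTypeR R => z.2 : R).
  exact: measurable_snd.
apply: cmeas_cexp; apply: cmeas_Complex.
  apply: measurableT_comp => //; apply: measurable_funM => //.
  exact: measurable_funX.
by apply: measurable_funM => //; exact: measurable_funB.
Qed.

Let cintg_gexp (y : R) : cintg (fun w => (g w)%:C * cexp (Complex 0 (y * w))).
Proof.
apply: (@cintg_dom _ _ (fun w => `|g w|)); last exact: integrable_norm.
  apply: cmeasM; first exact: cmeas_real.
  by apply: cmeas_cexp; apply: cmeas_Complex => //; exact: measurable_funM.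
by move=> w; rewrite Normc.normcM normcR normc_cexp /= expR0 mulr1.
Qed.

Let A_cint n y : A n y = cint (fun w => F (tn n) (y, w)).
Proof.
rewrite /A -mulrA mulrC /gh -cintZ; last exact: cintg_gexp.
congr cint; apply/funext => w; rewrite /F /= mulrCA; congr (_ * _).
rewrite -cexpR -!cexpD; congr cexp.
by apply/eqP; rewrite eq_complex /=; apply/andP; split; apply/eqP; ring.
Qed.

Let inner t w : 0 < t -> cint (fun y => F t (y, w)) =
  (g w * (Num.sqrt (pi / t) * expR (- ((w - v) ^+ 2 / (4 * t)))))%:C.
Proof.
move=> t0; rewrite /F /= cintZ; last exact: cintg_gauss.
by rewrite cint_gauss// -real_complexM.
Qed.

(** Fubini and the Gaussian integral in the frequency produce an approximate identity. The
    substitution w = q / (n + 1) + v then moves all dependence on [n] into the argument of [g]. *)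
Let cint_A n : cint (A n) = (2 * Num.sqrt pi)%:C *
  cint (fun q => (g (n.+1%:R^-1 * q + v) * expR (- (q ^+ 2)))%:C).
Proof.
rewrite (_ : A n = fun y => cint (fun w => F (tn n) (y, w))); last first.
  by apply/funext => y; exact: A_cint.
rewrite (@cint_swap_prod _ (F (tn n)) (fun y => expR (- (tn n * y ^+ 2))) (fun w => `|g w|)).
- pose m : R := n.+1%:R; have m0 : 0 < m by [].
  pose f w : R := g w * (2 * Num.sqrt pi * m * expR (- (m * (w - v)) ^+ 2)).
  rewrite (_ : (fun y => _) = fun w => (f w)%:C); last first.
    apply/funext => w; rewrite inner//; congr (_%:C); rewrite /f; congr (_ * _).
    have -> : pi / tn n = (2 * m) ^+ 2 * pi by rewrite /tn; field; rewrite gt_eqF.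
    rewrite sqrtrM ?sqr_ge0// sqrtr_sqr gtr0_norm ?mulr_gt0//.
    congr (_ * expR _); first by ring.
    by rewrite /tn; field; rewrite gt_eqF.
  have fi : cintg (fun w => (f w)%:C).
    split; last exact: integrable0.
    rewrite /=; apply: (@le_intg _ _ (fun w => (2 * Num.sqrt pi * m) * `|g w|)).
    - apply: measurable_funM => //; apply: measurable_funM => //.
      apply: measurable_expRT; apply: measurableT_comp => //.
      apply: measurable_funX; apply: measurable_funM => //.
      exact: measurable_funB.
    - move=> w; rewrite /f normrM mulrC ler_wpM2r// ger0_norm; last first.
        by rewrite !mulr_ge0 ?expR_ge0 ?sqrtr_ge0// ltW.
      rewrite ler_piMr ?mulr_ge0 ?sqrtr_ge0 ?(ltW m0)//.
      by rewrite -expR0 ler_expR oppr_le0 sqr_ge0.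
    - by apply: intgZ; exact: integrable_norm.
  have mi0 : 0 < m^-1 by rewrite invr_gt0.
  have ci : cintg (fun q => (g (m^-1 * q + v) * expR (- (q ^+ 2)))%:C).
    split; last exact: integrable0.
    rewrite /=; apply: (@le_intg _ _ (fun w => M * expR (- (w ^+ 2)))); last 2 first.
    - move=> w; rewrite normrM (@ger0_norm _ (expR _)) ?expR_ge0//.
      by rewrite ler_wpM2r ?expR_ge0.
    - by apply: intgZ; exact: intg_gauss.
    apply: measurable_funM.
      by apply: (measurableT_comp mg); apply: measurable_funD.
    by apply: measurable_expRT; exact: measurableT_comp.
  rewrite (cint_affine v mi0 fi) -cintZ; last first.
    exact: (cintg_affine v mi0 fi).
  rewrite -cintZ//; congr cint; apply/funext => q.
  rewrite -!real_complexM; congr (_%:C); rewrite /f addrK mulrA.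
  have -> : m * (m^-1 * q) = q by rewrite mulrA divff ?mul1r// gt_eqF.
  by rewrite -/m; field; rewrite gt_eqF.
- exact: cmeas_F.
- by move=> y w; rewrite /F Normc.normcM normcR normc_cexp mulrC /= lexx.
- exact: intg_gauss_scaled.
- exact: integrable_norm.
Qed.

(** Two limits of the same sequence are compared: removing the regulariser gives the left side,
    while concentration at [v] gives 2 sqrt pi * g v * sqrt pi. *)
Lemma fourier_inversion :
  cint (fun y => gh y * cexp (Complex 0 (- (y * v)))) = (2 * pi * g v)%:C.
Proof.
apply: (ccvg_unique A_cvg); rewrite (funext cint_A).
have -> : (2 * pi * g v)%:C = (2 * Num.sqrt pi)%:C * (g v * Num.sqrt pi)%:C :> R[i].
  rewrite -real_complexM; congr (_%:C).
  have E : Num.sqrt pi ^+ 2 = pi :> R by rewrite sqr_sqrtr// pi_ge0.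
  by rewrite -[in LHS]E; ring.
apply: ccvgM; first exact: ccvg_cst.
have [] // := @cint_dominated R
  (fun n q => (g (n.+1%:R^-1 * q + v) * expR (- (q ^+ 2)))%:C)
  (fun q => (g v * expR (- (q ^+ 2)))%:C) (fun q => M * expR (- (q ^+ 2))).
- move=> n; apply: cmeas_real; apply: measurable_funM.
    by apply: (measurableT_comp mg); apply: measurable_funD.
  by apply: measurable_expRT; exact: measurableT_comp.
- move=> q; split => /=; last exact: cvg_cst.
  apply: cvgM; last exact: cvg_cst.
  apply: (cvg_comp _ g); last exact: cg.
  have : n.+1%:R^-1 * q + v @[n --> \oo] --> 0 * q + v.
    by apply: cvgD; [apply: cvgM => //; exact: cvg_cst|exact: cvg_cst].
  by rewrite mul0r add0r.
- move=> n q; rewrite normcR normrM (@ger0_norm _ (expR _)) ?expR_ge0//.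
  by rewrite ler_wpM2r ?expR_ge0.
- by apply: intgZ; exact: intg_gauss.
move=> _; congr ccvg; rewrite /cint /=; congr Complex; last by rewrite /Rint Rintegral_cst// mul0r.
by rewrite RintZ ?Rint_gauss//; exact: intg_gauss.
Qed.

End FourierInversion.

(** * Gamma on vertical strips as a Mellin transform *)

Section TaylorRemainder.
Variable R : realType.
Implicit Types (b w : R) (N : nat).

(** Remainder of exp (- b) after its first [N] Taylor terms. Its Mellin transform on -N < Re s < -N
    + 1 is again Gamma (the Cauchy-Saalschutz formula). *)
Definition tay N b : R := expR (- b) - \sum_(n < N) (- b) ^+ n / n`!%:R.

Lemma tay0 b : tay 0 b = expR (- b).
Proof. by rewrite /tay big_ord0 subr0. Qed.

Lemma tayS N b : tay N.+1 b = tay N b - (- b) ^+ N / N`!%:R.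
Proof. by rewrite /tay big_ord_recr /= opprD addrA. Qed.

(** For [N = 0] the truncated predecessor is what is wanted, since exp (- b) is the negative of its
    own derivative. *)
Lemma is_derive_tay N b : is_derive b (1 : R) (tay N) (- tay N.-1 b).
Proof.
elim: N => [|N IH].
  rewrite (_ : tay 0 = fun t => expR (- t)); last by apply/funext => t; rewrite tay0.
  apply: (is_derive_eq (is_derive_expR_comp (is_derive_funN (is_derive_fun_id b)))).
  by rewrite mulrN1.
rewrite (_ : tay N.+1 = fun t => tay N t + (- (-1) ^+ N / N`!%:R) * t ^+ N); last first.
  by apply/funext => t; rewrite tayS (exprNn t); ring.
have dX : is_derive b (1 : R) (fun t : R => t ^+ N) (N%:R * b ^+ N.-1).
  by apply: (is_derive_eq (is_derive_funX N (is_derive_fun_id b))); rewrite mulr1.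
apply: (is_derive_eq (is_derive_funD IH (is_derive_funZ _ dX))).
case: N {IH dX} => [|N] /=; first by rewrite mul0r mulr0 addr0.
rewrite tayS (exprNn b) factS natrM exprS; field.
by rewrite pnatr_eq0 -lt0n fact_gt0 /= nat1r pnatr_eq0.
Qed.

Lemma continuous_tay N : continuous (tay N).
Proof. by apply: is_derive_continuous => b; exact: is_derive_tay. Qed.

(** Induction: both b^(N+1) / (N+1)! + tay and b^(N+1) / (N+1)! - tay vanish at 0, and their
    derivatives are nonnegative by the bound for [N]. *)
Lemma normr_tay_le N b : 0 <= b -> `|tay N b| <= b ^+ N / N`!%:R.
Proof.
elim: N b => [|N IH] b b0.
  rewrite tay0 expr0 fact0 divr1 ger0_norm ?expR_ge0//.
  by rewrite -expR0 ler_expR oppr_le0.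
have f0 : N`!%:R != 0 :> R by rewrite pnatr_eq0 -lt0n fact_gt0.
have dX (c t : R) : is_derive t (1 : R) (fun t : R => t ^+ N.+1 / N.+1`!%:R + c * tay N.+1 t)
   (t ^+ N / N`!%:R - c * tay N t).
  apply: (is_derive_eq (is_derive_funD (is_derive_funM
    (is_derive_funX N.+1 (is_derive_fun_id t)) (is_derive_fun_cst _ t))
    (is_derive_funZ c (is_derive_tay N.+1 t)))).
  by rewrite /= factS natrM; field; rewrite f0 /= nat1r pnatr_eq0.
have T0 : tay N.+1 0 = 0.
  rewrite /tay oppr0 expR0 big_ord_recl /= expr0 fact0 divr1 big1 ?addr0 ?subrr//.
  by move=> i _; rewrite expr0n /= mul0r.
have main (c : R) : `|c| = 1 -> 0 <= b ^+ N.+1 / N.+1`!%:R + c * tay N.+1 b.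
  move=> c1; have [->|bn0] := eqVneq b 0.
    by rewrite T0 expr0n /= mul0r mulr0 addr0.
  have bp : 0 < b by rewrite lt_neqAle eq_sym bn0.
  have [] := @MVT R (fun t : R => t ^+ N.+1 / N.+1`!%:R + c * tay N.+1 t)
    (fun t => t ^+ N / N`!%:R - c * tay N t) 0 b bp.
  - by apply: continuous_subspaceT; exact: (is_derive_continuous (dX c)).
  move=> x; rewrite in_itv /= => /andP[x0 _].
  rewrite T0 expr0n /= mul0r mulr0 addr0 !subr0 => ->.
  rewrite mulr_ge0// subr_ge0; apply: le_trans (IH x (ltW x0)).
  by apply: le_trans (ler_norm _) _; rewrite normrM c1 mul1r.
rewrite ler_norml; apply/andP; split.
- by have := main 1 (normr1 _); rewrite mul1r; lra.
- by have := main (-1); rewrite normrN normr1 => /(_ erefl); lra.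
Qed.

(** One power of [b] less than [normr_tay_le], hence the useful bound for large [b]. The two
    exponents are the edges of the strip. *)
Lemma normr_tayS_le N b : 0 <= b -> `|tay N.+1 b| <= 2 * (b ^+ N / N`!%:R).
Proof.
move=> b0; rewrite tayS; apply: le_trans (ler_normB _ _) _.
rewrite mulr_natl mulr2n; apply: lerD; first exact: normr_tay_le.
rewrite normrM normrX normrN (ger0_norm b0) ger0_norm//.
Qed.

(** The exponential lies above its tangent at ln q. *)
Lemma expR_expR_le (q w : R) : 0 < q ->
  expR (- expR w) <= expR (q * (ln q - 1)) * expR (- (q * w)).
Proof.
move=> q0; rewrite -expRD ler_expR.
have : expR (ln q) * (1 + (w - ln q)) <= expR (ln q) * expR (w - ln q).
  by rewrite ler_wpM2l ?expR_ge0// expR_ge1Dx.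
rewrite -expRD [ln q + _]addrC subrK lnK ?posrE//.
by lra.
Qed.

(* The open strip on which the Mellin transform of [tay N] converges. *)
Definition strip N (s : R) :=
  if N is n.+1 then (- (n.+1%:R) < s) && (s < - n%:R) else 0 < s.

(** The rates [p] and [q] are the distances from [s] to the left and right edges of the strip. For
    [N = 0] there is no right edge, and [q = 1] is an arbitrary choice paid for by
    [expR_expR_le]. *)
Lemma stripP N s : strip N s -> exists p q A B, [/\ 0 < p, 0 < q,
  (forall w, `|tay N (expR w) * expR (s * w)| <= A * expR (p * w)) &
  (forall w, `|tay N (expR w) * expR (s * w)| <= B * expR (- (q * w)))].
Proof.
case: N => [s0|N /andP[s1 s2]].
  exists s, 1, 1, (expR ((s + 1) * (ln (s + 1) - 1))); split => // w.
    rewrite tay0 mul1r ger0_norm ?mulr_ge0 ?expR_ge0// ler_piMl ?expR_ge0//.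
  rewrite tay0 ger0_norm ?mulr_ge0 ?expR_ge0//.
  have s10 : 0 < s + 1 by rewrite addr_gt0.
  apply: le_trans (ler_wpM2r (expR_ge0 _) (expR_expR_le w s10)) _.
  by rewrite -mulrA ler_wpM2l ?expR_ge0// -expRD ler_expR; lra.
exists (s + N.+1%:R), (- (s + N%:R)), (N.+1`!%:R^-1), (2 / N`!%:R); split.
- by rewrite -ltrBlDr sub0r.
- by rewrite oppr_gt0 -ltrBrDr sub0r.
- move=> w; rewrite normrM (@ger0_norm _ (expR (s * w))) ?expR_ge0//.
  apply: le_trans (ler_wpM2r (expR_ge0 _) (normr_tay_le N.+1 (expR_ge0 w))) _.
  by rewrite -expRM_natl mulrAC -expRD mulrC ler_wpM2l ?invr_ge0 ?ler0n// ler_expR; lra.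
- move=> w; rewrite normrM (@ger0_norm _ (expR (s * w))) ?expR_ge0//.
  apply: le_trans (ler_wpM2r (expR_ge0 _) (normr_tayS_le N (expR_ge0 w))) _.
  rewrite (_ : _ * _ * _ = 2 / N`!%:R * (expR w ^+ N * expR (s * w))); last by ring.
  by rewrite -expRM_natl -expRD ler_wpM2l ?divr_ge0 ?ler0n// ler_expR; lra.
Qed.

Lemma stripS N s : strip N s -> strip N.-1 (s + 1).
Proof.
case: N => [|[|N]] /=; first by move=> /addr_gt0; apply.
  by rewrite -natr1 => /andP[]; lra.
by rewrite -!natr1 => /andP[s1 s2]; apply/andP; split; lra.
Qed.

End TaylorRemainder.

(** * Gamma as the Mellin transform of Taylor remainders, and its functional equation *)

Section Mellin.
Variable R : realType.
Implicit Types (z : R[i]) (w : R) (N : nat).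

Lemma cexp_scale z w : cexp (z * w%:C) =
  Complex (expR (Re z * w) * cos (Im z * w)) (expR (Re z * w) * sin (Im z * w)).
Proof. by rewrite /cexp ReM ImM /= !mulr0 subr0 add0r. Qed.

(** Integrand of b^(z-1) * tay N b over b > 0 after b = exp w, the Jacobian included. *)
Definition mellin_kernel N z w : R[i] := (tay N (expR w))%:C * cexp (z * w%:C).

Lemma mellin_kernelE N z w : mellin_kernel N z w = Complex
  (tay N (expR w) * expR (Re z * w) * cos (Im z * w))
  (tay N (expR w) * expR (Re z * w) * sin (Im z * w)).
Proof.
rewrite /mellin_kernel cexp_scale; apply/eqP; rewrite eq_complex /=.
by apply/andP; split; apply/eqP; ring.
Qed.

Lemma normc_mellin_kernel N z w :
  normc (mellin_kernel N z w) = `|tay N (expR w) * expR (Re z * w)|.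
Proof.
rewrite /mellin_kernel Normc.normcM normcR normc_cexp ReM /= mulr0 subr0.
by rewrite normrM (@ger0_norm _ (expR _)) ?expR_ge0.
Qed.

Let is_derive_tay_expR N w : is_derive w (1 : R) (fun t => tay N (expR t))
  (- tay N.-1 (expR w) * expR w).
Proof. exact: (is_derive1_comp (is_derive_tay N (expR w)) (is_derive_expR w)). Qed.

Let continuous_tay_expR N : continuous (fun w => tay N (expR w)).
Proof. exact: (is_derive_continuous (is_derive_tay_expR N)). Qed.

Lemma continuous_mul (f g : R -> R) : continuous f -> continuous g ->
  continuous (fun x => f x * g x).
Proof. by move=> cf cg x; apply: cvgM; [exact: cf|exact: cg]. Qed.

Lemma continuous_sub (f g : R -> R) : continuous f -> continuous g ->
  continuous (fun x => f x - g x).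
Proof. by move=> cf cg x; apply: cvgB; [exact: cf|exact: cg]. Qed.

Lemma continuous_add (f g : R -> R) : continuous f -> continuous g ->
  continuous (fun x => f x + g x).
Proof. by move=> cf cg x; apply: cvgD; [exact: cf|exact: cg]. Qed.

Lemma continuous_scale (k : R) (f : R -> R) : continuous f ->
  continuous (fun x => k * f x).
Proof. by move=> cf x; apply: cvgM; [exact: cvg_cst|exact: cf]. Qed.

Lemma continuous_expR_lin (s : R) : continuous (fun w => expR (s * w)).
Proof.
by apply: is_derive_continuous => w.
Qed.

Lemma continuous_cos_lin (s : R) : continuous (fun w => cos (s * w)).
Proof.
by apply: is_derive_continuous => w.
Qed.

Lemma continuous_sin_lin (s : R) : continuous (fun w => sin (s * w)).
Proof.
by apply: is_derive_continuous => w.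
Qed.

Lemma continuous_Re_mellin_kernel N z : continuous (fun w => Re (mellin_kernel N z w)).
Proof.
under eq_fun do rewrite mellin_kernelE /=.
apply: continuous_mul; last exact: continuous_cos_lin.
by apply: continuous_mul; [exact: continuous_tay_expR|exact: continuous_expR_lin].
Qed.

Lemma continuous_Im_mellin_kernel N z : continuous (fun w => Im (mellin_kernel N z w)).
Proof.
under eq_fun do rewrite mellin_kernelE /=.
apply: continuous_mul; last exact: continuous_sin_lin.
by apply: continuous_mul; [exact: continuous_tay_expR|exact: continuous_expR_lin].
Qed.

Lemma cmeas_mellin_kernel N z : cmeas (mellin_kernel N z).
Proof.
split; apply: continuous_measurable_fun.
  exact: continuous_Re_mellin_kernel.
exact: continuous_Im_mellin_kernel.
Qed.

Lemma intg_tay_expR N (s : R) : strip N s ->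
  intg (fun w => tay N (expR w) * expR (s * w)).
Proof.
move=> /stripP[p [q [A [B [p0 q0 fA fB]]]]].
apply: (intg_expR_two_sided p0 q0 _ fA fB); apply: continuous_measurable_fun.
by apply: continuous_mul; [exact: continuous_tay_expR|exact: continuous_expR_lin].
Qed.

Lemma cintg_mellin_kernel N z : strip N (Re z) -> cintg (mellin_kernel N z).
Proof.
move=> sN; apply: (cintg_dom (cmeas_mellin_kernel N z) _
  (integrable_norm (intg_tay_expR sN))) => w.
by rewrite normc_mellin_kernel.
Qed.

Lemma cvg_expR_lin (q : R) : 0 < q -> expR (- (q * n%:R)) @[n --> \oo] --> 0.
Proof.
move=> q0; under eq_fun do rewrite mulrC -mulrN expRM_natl.
apply: cvg_expr; rewrite ger0_norm ?expR_ge0// -expR0 ltr_expR.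
by rewrite oppr_lt0.
Qed.

Definition mellin N z : R[i] := cint (mellin_kernel N z).

Let Rint_mellin_part N z (f F : R -> R) : strip N (Re z) ->
  (forall w, is_derive w (1 : R) F (f w)) -> continuous f -> intg f ->
  (forall w, `|F w| <= normc (mellin_kernel N z w)) -> Rint f = 0.
Proof.
move=> sN dF cf fi FN; have [p [q [A [B [p0 q0 fA fB]]]]] := stripP sN.
have lim (u : R -> R) (C r : R) : 0 < r -> (forall n, `|u n%:R| <= C * expR (- (r * n%:R))) ->
    u n%:R @[n --> \oo] --> 0.
  move=> r0 uC; apply: norm_cvg0.
  apply: (@squeeze_cvgr _ _ _ _ (fun=> 0) (fun n => C * expR (- (r * n%:R)))).
  - by apply: nearW => n; rewrite normr_ge0 /= uC.
  - exact: cvg_cst.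
  - rewrite -[X in _ --> X](mulr0 C).
    by apply: cvgM; [exact: cvg_cst|exact: cvg_expR_lin].
apply: (Rint_derive_eq0 dF cf fi).
- apply: (lim _ B q q0) => n; apply: le_trans (FN _) _.
  by rewrite normc_mellin_kernel fB.
- apply: (lim (fun t => F (- t)) A p p0) => n; apply: le_trans (FN _) _.
  by rewrite normc_mellin_kernel (le_trans (fA _))// mulrN.
Qed.

(** Integration by parts: the derivative in [w] of [mellin_kernel N z] is z times itself minus
    [mellin_kernel N.-1 (z + 1)], and the boundary terms decay exponentially inside the strip. *)
Lemma mellin_rec N z : strip N (Re z) -> z * mellin N z = mellin N.-1 (z + 1).
Proof.
move=> sN; have s1 : strip N.-1 (Re (z + 1)) by rewrite ReD; exact: stripS.
have i1 := cintg_mellin_kernel sN; have i2 := cintg_mellin_kernel s1.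
have i3 : cintg (fun w => z * mellin_kernel N z w - mellin_kernel N.-1 (z + 1) w).
  rewrite (_ : (fun w => _) = (fun w => z * mellin_kernel N z w + (-1) * mellin_kernel N.-1 (z + 1) w)).
    by apply: cintgD; exact: cintgZ.
  by apply/funext => w; rewrite mulN1r.
apply/eqP; rewrite -subr_eq0 /mellin -cintZ// -cintB//; last exact: cintgZ.
have [j1 j2] := i3.
have E1 w : Re (z * mellin_kernel N z w - mellin_kernel N.-1 (z + 1) w) =
  Re z * Re (mellin_kernel N z w) - Im z * Im (mellin_kernel N z w)
   - Re (mellin_kernel N.-1 (z + 1) w) by rewrite ReD ReN ReM.
have E2 w : Im (z * mellin_kernel N z w - mellin_kernel N.-1 (z + 1) w) =
  Re z * Im (mellin_kernel N z w) + Im z * Re (mellin_kernel N z w)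
   - Im (mellin_kernel N.-1 (z + 1) w) by rewrite ImD ImN ImM.
have cR := continuous_Re_mellin_kernel; have cI := continuous_Im_mellin_kernel.
apply/eqP; rewrite /cint -[RHS]/(Complex 0 0); congr Complex.
- have dF w : is_derive w (1 : R) (fun w => Re (mellin_kernel N z w))
      (Re (z * mellin_kernel N z w - mellin_kernel N.-1 (z + 1) w)).
    rewrite E1 (_ : (fun t => Re _) = fun t =>
      tay N (expR t) * expR (Re z * t) * cos (Im z * t)); last first.
      by apply/funext => t; rewrite mellin_kernelE.
    apply: (is_derive_eq (is_derive_funM (is_derive_funM (is_derive_tay_expR N w)
      (is_derive_expR_comp (is_derive_funZ (Re z) (is_derive_fun_id w))))
      (is_derive_cos_comp (is_derive_funZ (Im z) (is_derive_fun_id w))))).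
    by rewrite !mellin_kernelE ReD ImD /= [(_ + 1) * w]mulrDl expRD mul1r addr0; ring.
  apply: (Rint_mellin_part sN dF _ j1); last by move=> w; exact: Re_le_normc.
  rewrite (funext E1); apply: continuous_sub => //; apply: continuous_sub;
    exact: continuous_scale.
- have dF w : is_derive w (1 : R) (fun w => Im (mellin_kernel N z w))
      (Im (z * mellin_kernel N z w - mellin_kernel N.-1 (z + 1) w)).
    rewrite E2 (_ : (fun t => Im _) = fun t =>
      tay N (expR t) * expR (Re z * t) * sin (Im z * t)); last first.
      by apply/funext => t; rewrite mellin_kernelE.
    apply: (is_derive_eq (is_derive_funM (is_derive_funM (is_derive_tay_expR N w)
      (is_derive_expR_comp (is_derive_funZ (Re z) (is_derive_fun_id w))))
      (is_derive_sin_comp (is_derive_funZ (Im z) (is_derive_fun_id w))))).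
    by rewrite !mellin_kernelE ReD ImD /= [(_ + 1) * w]mulrDl expRD mul1r addr0; ring.
  apply: (Rint_mellin_part sN dF _ j2); last by move=> w; exact: Im_le_normc.
  rewrite (funext E2); apply: continuous_sub => //; apply: continuous_add;
    exact: continuous_scale.
Qed.

Lemma GammaPosE z : GammaPos z = mellin 0 z.
Proof.
have pE (u : R) : 0 < u -> powR u (Re z - 1) = expR (Re z * ln u) * expR (- ln u).
  by move=> u0; rewrite /powR gt_eqF// -expRD; congr expR; ring.
rewrite /mellin /cint /GammaPos; congr Complex; apply: Rint_pos_ln.
- exact: continuous_Re_mellin_kernel.
- by move=> u u0; rewrite pE// mellin_kernelE /= tay0 lnK//; ring.
- exact: continuous_Im_mellin_kernel.
- by move=> u u0; rewrite pE// mellin_kernelE /= tay0 lnK//; ring.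
Qed.

Lemma GammaPosS z : 0 < Re z -> GammaPos (z + 1) = z * GammaPos z.
Proof. by move=> z0; rewrite !GammaPosE (@mellin_rec 0). Qed.

Let ReDn z n : Re (z + n%:R) = Re z + n%:R.
Proof. by rewrite ReD natr_complex. Qed.

Lemma Re_gt0_neq0 z : 0 < Re z -> z != 0.
Proof. by apply: contraTneq => ->; rewrite ltxx. Qed.

Lemma gshift_gt0 z : 0 < Re z + (gshift z)%:R.
Proof.
rewrite -ltrBlDl sub0r /gshift; apply: lt_le_trans (lt_succ_floor _) _.
by rewrite -natr1 intrD lerD2r natr_absz ler_int ler_norm.
Qed.

Section Shift.
Variable z : R[i].

Let g n := GammaPos (z + n%:R) / \prod_(k < n) (z + k%:R).
Let r n := \prod_(k < n) (z + k%:R) / GammaPos (z + n%:R).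

(** Once the shifted argument is in the right half-plane, one more shift multiplies numerator and
    denominator by the same nonzero factor. Hence [gshift] may be replaced by any sufficient number
    of shifts. *)
Let step n : 0 < Re z + n%:R -> g n.+1 = g n /\ r n.+1 = r n.
Proof.
move=> zn; have zn' : 0 < Re (z + n%:R) by rewrite ReDn.
have nz := Re_gt0_neq0 zn'.
rewrite /g /r big_ord_recr /= -natr1 addrA GammaPosS//; split.
  by rewrite [\prod_(_ < n) _ * _]mulrC -mulf_div divff// mul1r.
by rewrite [\prod_(_ < n) _ * _]mulrC -mulf_div divff// mul1r.
Qed.

Let stable n m : 0 < Re z + n%:R -> g (m + n) = g n /\ r (m + n) = r n.
Proof.
move=> zn; elim: m => [//|m [<- <-]]; rewrite addSn.
by apply: step; apply: lt_le_trans zn _; rewrite lerD2l ler_nat leq_addl.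
Qed.

Lemma GammaE n : 0 < Re z + n%:R ->
  Gamma z = GammaPos (z + n%:R) / \prod_(k < n) (z + k%:R).
Proof.
move=> zn; rewrite /Gamma -/(g n) -/(g (gshift z)).
have [<- _] := stable (gshift z) zn; have [<- _] := stable n (gshift_gt0 z).
by rewrite addnC.
Qed.

Lemma rGammaE n : 0 < Re z + n%:R ->
  rGamma z = \prod_(k < n) (z + k%:R) / GammaPos (z + n%:R).
Proof.
move=> zn; rewrite /rGamma -/(r n) -/(r (gshift z)).
have [_ <-] := stable (gshift z) zn; have [_ <-] := stable n (gshift_gt0 z).
by rewrite addnC.
Qed.

End Shift.

Lemma Gamma_pos z : 0 < Re z -> Gamma z = GammaPos z.
Proof. by move=> z0; rewrite (@GammaE z 0) ?addr0// big_ord0 divr1. Qed.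

Lemma rGamma_pos z : 0 < Re z -> rGamma z = (GammaPos z)^-1.
Proof. by move=> z0; rewrite (@rGammaE z 0) ?addr0// big_ord0 mul1r. Qed.

(** Under the convention x / 0 = 0, [Gamma] is 0 at its poles, so the equation also holds at the
    negative integers. *)
Lemma GammaS z : z != 0 -> Gamma (z + 1) = z * Gamma z.
Proof.
move=> z0; have h := gshift_gt0 (z + 1); set n := gshift (z + 1) in h.
rewrite (@GammaE (z + 1) n)// (@GammaE z n.+1); last first.
  by move: h; rewrite ReD /= -natr1 -addrA [1 + _]addrC.
rewrite big_ord_recl /= addr0 -natr1 [n%:R + 1]addrC addrA.
rewrite invfM mulrCA !mulrA mulfK//; congr (_ / _).
by apply: eq_bigr => k _; rewrite -addrA nat1r.
Qed.

(** Both sides obey the same recurrence, which links strip [N.+1] to strip [N]. Division by z is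
    allowed because 0 lies in none of the strips [N.+1]. *)
Lemma mellin_Gamma N z : strip N (Re z) -> mellin N z = Gamma z.
Proof.
elim: N z => [|N IH] z zN; first by rewrite Gamma_pos// GammaPosE.
have z0 : z != 0.
  apply: contraTneq zN => ->; rewrite /= negb_and -!leNgt oppr_le0 ler0n.
  by rewrite orbT.
apply: (mulfI z0); rewrite mellin_rec//= IH ?GammaS//.
by rewrite ReD; exact: (stripS zN).
Qed.

Lemma rGamma0 n : rGamma (- n%:R : R[i]) = 0.
Proof.
rewrite (@rGammaE _ n.+1); last first.
  by rewrite natr_complex -real_complexN /= -natr1 addrA addNr add0r ltr01.
by rewrite big_ord_recr /= addNr mulr0 mul0r.
Qed.

End Mellin.

(** * Euler's limit and exponential bounds on vertical lines *)

Section Elementary.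
Variable R : realType.
Implicit Types (x y v : R).

Lemma MVT_derive (f df : R -> R) (a b : R) : a < b ->
  (forall x, a <= x <= b -> is_derive x (1 : R) f (df x)) ->
  exists2 c, a < c < b & f b - f a = df c * (b - a).
Proof.
move=> ab dF; have h x : x \in `]a, b[ -> is_derive x (1 : R) f (df x).
  by rewrite in_itv /= => /andP[ax xb]; apply: dF; rewrite !ltW.
have cf : {within `[a, b], continuous f}.
  apply: derivable_within_continuous => x; rewrite in_itv /= => xab.
  by have [] := dF x xab.
by have [c] := MVT ab h cf; rewrite in_itv /= => cab E; exists c.
Qed.

Lemma normr_sin_le x : `|sin x| <= `|x|.
Proof.
wlog x0 : x / 0 < x.
  move=> H; have [/H//|x0|<-] := ltgtP 0 x; last by rewrite sin0.
  by rewrite -normrN -sinN -(normrN x); apply: H; rewrite oppr_gt0.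
have [c _] := MVT_derive x0 (fun t _ => is_derive_sin t).
rewrite sin0 !subr0 => ->; rewrite normrM ler_piMl//.
by rewrite ler_norml cos_geN1 cos_le1.
Qed.

Lemma cos_ge x : 1 - x ^+ 2 / 2 <= cos x.
Proof.
have -> : cos x = 1 - 2 * sin (x / 2) ^+ 2.
  have := cosD (x / 2) (x / 2); rewrite -splitr => ->.
  by rewrite -!expr2 cos2sin2; ring.
have : sin (x / 2) ^+ 2 <= (x / 2) ^+ 2.
  by rewrite -ler_sqrt ?sqr_ge0// !sqrtr_sqr normr_sin_le.
by lra.
Qed.

Lemma expR_sub_expRN_ge x : 0 <= x -> 2 * x <= expR x - expR (- x).
Proof.
rewrite le_eqVlt => /predU1P[<-|x0]; first by rewrite oppr0 subrr mulr0.
have [c _] := MVT_derive x0 (fun t _ => is_derive_funD (is_derive_expR t)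
  (is_derive_funN (is_derive_expR_comp (is_derive_funN (is_derive_fun_id t))))).
rewrite subr0 oppr0 expR0 subrr subr0 => E; rewrite E; apply: ler_wpM2r; first exact: ltW.
by have := expR_ge1Dx c; have := expR_ge1Dx (- c); lra.
Qed.

(** Equivalent to |x| <= 2 |sinh (x / 2)|. *)
Lemma sqr_mul_expR_le x : x ^+ 2 * expR x <= (expR x - 1) ^+ 2.
Proof.
have -> : (expR x - 1) ^+ 2 = expR x * (expR (x / 2) - expR (- (x / 2))) ^+ 2.
  have -> : expR x = expR (x / 2) ^+ 2 by rewrite expr2 -expRD -splitr.
  have E : expR (x / 2) * expR (- (x / 2)) = 1 by rewrite -expRD subrr expR0.
  by rewrite -exprMn; congr (_ ^+ 2); rewrite mulrBr E expr2.
rewrite mulrC ler_wpM2l ?expR_ge0//.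
wlog x0 : x / 0 <= x.
  move=> H; have [/H//|x0] := leP 0 x.
  have := H (- x); rewrite oppr_ge0 (ltW x0) => /(_ isT).
  rewrite mulNr opprK sqrrN => h; apply: le_trans h _.
  by rewrite -[leRHS]sqrrN opprB.
have x20 : 0 <= x / 2 by rewrite divr_ge0.
have := expR_sub_expRN_ge x20; rewrite mulrC divfK// => h.
by rewrite -ler_sqrt ?sqr_ge0// !sqrtr_sqr !ger0_norm// (le_trans x0).
Qed.

(** Compares u^z - 1 with u - 1 for u = exp v. The squared norm is (e^(sv) - 1)^2 + 2 e^(sv) (1 -
    cos (yv)); the cosine term is absorbed by [cos_ge] and [sqr_mul_expR_le], and exponents s <= 1
    bring e^(sv) closer to 1 than e^v. *)
Lemma normc_cexp_sub1 (z : R[i]) v : 0 < Re z <= 1 ->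
  normc (cexp (z * v%:C) - 1) ^+ 2 <= (1 + Im z ^+ 2 / Re z ^+ 2) * (expR v - 1) ^+ 2.
Proof.
move=> /andP[s0 s1]; rewrite sqr_normc cexp_scale.
set s := Re z; set y := Im z; rewrite !ReD !ImD !ReN !ImN /= subr0.
have -> : (expR (s * v) * cos (y * v) - 1) ^+ 2 + (expR (s * v) * sin (y * v)) ^+ 2 =
    (expR (s * v) - 1) ^+ 2 + 2 * expR (s * v) * (1 - cos (y * v)).
  by rewrite (exprMn 2 _ (sin _)) sin2cos2; ring.
apply: (@le_trans _ _ ((1 + y ^+ 2 / s ^+ 2) * (expR (s * v) - 1) ^+ 2)).
  rewrite [leRHS]mulrDl mul1r lerD2l.
  apply: (@le_trans _ _ (y ^+ 2 / s ^+ 2 * ((s * v) ^+ 2 * expR (s * v)))); last first.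
    by rewrite ler_wpM2l ?divr_ge0 ?sqr_ge0// sqr_mul_expR_le.
  have -> : y ^+ 2 / s ^+ 2 * ((s * v) ^+ 2 * expR (s * v)) =
      2 * expR (s * v) * ((y * v) ^+ 2 / 2) by field; rewrite gt_eqF.
  by rewrite ler_wpM2l ?mulr_ge0 ?expR_ge0//; have := cos_ge (y * v); lra.
rewrite ler_wpM2l ?addr_ge0 ?divr_ge0 ?sqr_ge0//.
rewrite -ler_sqrt ?sqr_ge0// !sqrtr_sqr.
have [v0|v0] := leP 0 v.
  rewrite !ger0_norm ?subr_ge0 -?expR0 ?ler_expR ?lerD2r ?mulr_ge0 ?(ltW s0)//.
  by rewrite ler_expR ler_piMl.
rewrite !ler0_norm ?subr_le0 -?expR0 ?ler_expR ?(ltW v0)//; last first.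
  by rewrite mulr_ge0_le0 ?ltW.
by rewrite lerN2 lerD2r ler_expR ler_niMl// ltW.
Qed.

(** The complement t = pi / 2 - atan x has tangent 1 / x and satisfies t * cos t <= sin t. *)
Lemma atan_ge (x : R) : 0 < x -> pi / 2 - x^-1 <= atan x.
Proof.
move=> x0; pose t := pi / 2 - atan x.
have t0 : 0 < t by rewrite subr_gt0 atan_ltpi2.
have a0 : 0 < atan x by rewrite -[X in X < _]atan0 lt_atan.
have t1 : t < pi / 2 by rewrite /t gtrDl oppr_lt0.
have ct : cos t = sin (atan x) by rewrite /t -cosBpihalf -cosN opprB.
have st : sin t = cos (atan x) by rewrite /t -[in RHS](opprK (atan x)) cosN -sinDpihalf addrC.
have cx : 0 < cos (atan x) by rewrite cos_gt0_pihalf// atan_gtNpi2 atan_ltpi2.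
have sx : sin (atan x) = x * cos (atan x).
  by rewrite -{2}(atanK x) /tan divfK// gt_eqF.
have [c /andP[c0 c1]] := MVT_derive t0 (fun u _ => is_derive_sin u).
rewrite sin0 !subr0 => E.
have : cos t * t <= sin t.
  rewrite E ler_wpM2r ?(ltW t0)// ltW// ltr_cos// in_itv /=; apply/andP; split.
  - exact: ltW.
  - by apply: le_trans (ltW c1) _; have := pi_gt0 R; lra.
  - exact: ltW.
  - by have := pi_gt0 R; lra.
rewrite ct st sx mulrAC -[leRHS]mul1r ler_pM2r// => h.
have : t <= x^-1 by rewrite -[leRHS]mul1r ler_pdivlMr// mulrC.
by rewrite /t; lra.
Qed.

Lemma ln1Dsqr_le x : 0 <= x -> ln (1 + x ^+ 2) <= 2 * x * atan x.
Proof.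
rewrite le_eqVlt => /predU1P[<-|x0]; first by rewrite expr0n /= addr0 ln1 mulr0 mul0r.
have p t : 0 < 1 + t ^+ 2 :> R by rewrite ltr_pwDl ?sqr_ge0.
have d (t : R) : is_derive t (1 : R) (fun t : R => 2 * t * atan t - ln (1 + t ^+ 2)) (2 * atan t).
  apply: (is_derive_eq (is_derive_funD (is_derive_funM (is_derive_funZ 2
    (is_derive_fun_id t)) (is_derive_atan_comp (is_derive_fun_id t)))
    (is_derive_funN (@is_derive_ln_comp R (fun t => 1 + t ^+ 2) t _ (p t) (is_derive_funD (is_derive_fun_cst 1 t)
      (is_derive_funX 2 (is_derive_fun_id t))))))).
  by rewrite /=; field; rewrite gt_eqF.
have [c /andP[c0 _]] := MVT_derive x0 (fun t _ => d t).
rewrite mulr0 mul0r expr0n /= addr0 ln1 !subr0 => E; rewrite -subr_ge0 E.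
have a0 : 0 <= atan c by rewrite -[X in X <= _]atan0 le_atan// ltW.
by rewrite !mulr_ge0// ltW.
Qed.

Lemma atan_le x : 0 <= x -> atan x <= x.
Proof.
rewrite le_eqVlt => /predU1P[<-|x0]; first by rewrite atan0.
have [c _] := MVT_derive x0 (fun t _ => is_derive1_atan t).
rewrite atan0 !subr0 => ->; rewrite ler_piMl ?(ltW x0)// invf_le1 ?lerDl ?sqr_ge0//.
by rewrite ltr_pwDl ?sqr_ge0.
Qed.

(** Trades a quadratic factor for an exponential of arbitrarily small rate [d], by d (1 + u) <= 1 +
    d u <= exp (d u). *)
Lemma ler1Dsqr_expR (d u : R) : 0 < d <= 1 -> 0 <= u ->
  1 + u ^+ 2 <= (d^-1 * expR (d * u)) ^+ 2.
Proof.
move=> /andP[d0 d1] u0; apply: (@le_trans _ _ ((1 + u) ^+ 2)).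
  by rewrite sqrrD expr1n mul1r -addrA lerD2l lerDr mulrn_wge0.
rewrite ler_pXn2r// ?nnegrE ?addr_ge0 ?mulr_ge0 ?invr_ge0 ?expR_ge0 ?(ltW d0)//.
rewrite mulrC ler_pdivlMr//; apply: le_trans (expR_ge1Dx _).
by rewrite mulrC mulrDr mulr1 lerD2r.
Qed.

End Elementary.

(** * Euler's product, through concentration of the Gamma distribution *)

Section EulerLimit.
Variable R : realType.
Implicit Types (z : R[i]) (x w : R).

Let kr x w : R := tay 0 (expR w) * expR (x * w).

Let intg_kr x : 0 < x -> intg (kr x).
Proof. by move=> x0; exact: (@intg_tay_expR R 0). Qed.

Let kr_ge0 x w : 0 <= kr x w.
Proof. by rewrite /kr tay0 mulr_ge0 ?expR_ge0. Qed.

Definition rgam x : R := Rint (kr x).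

Lemma GammaPos_real x : GammaPos x%:C = (rgam x)%:C.
Proof.
rewrite GammaPosE /mellin /cint; congr Complex.
  by congr Rint; apply/funext => w; rewrite mellin_kernelE /= mul0r cos0 mulr1.
rewrite (_ : (fun w => _) = fun=> 0); first by rewrite /Rint Rintegral_cst// mul0r.
by apply/funext => w; rewrite mellin_kernelE /= mul0r sin0 mulr0.
Qed.

Lemma rgamS x : 0 < x -> rgam (x + 1) = x * rgam x.
Proof.
move=> x0; have := @GammaPosS R x%:C x0.
have -> : x%:C + 1 = (x + 1)%:C by rewrite real_complexD.
by rewrite !GammaPos_real -real_complexM => -[].
Qed.

Lemma rgam_gt0 x : 0 < x -> 0 < rgam x.
Proof.
(* [m] bounds the integrand from below on [0, 1]. *)
move=> x0; pose m : R := expR (- expR 1).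
have m0 : 0 < m := expR_gt0 _.
apply: (lt_le_trans m0); have -> : m = Rint (fun w => m * \1_(`[0, 1]%classic) w).
  rewrite RintZ; last exact: integrable_indic_itv.
  rewrite /Rint /Rintegral integral_indic//= setIT lebesgue_measure_itv /= lte01.
  by rewrite oppr0 adde0 mulr1.
apply: le_Rint; [apply: intgZ; exact: integrable_indic_itv|exact: intg_kr|].
move=> w; rewrite indicE.
have [|_] := boolP (w \in `[0, 1]%classic); last by rewrite mulr0 kr_ge0.
rewrite inE /= in_itv /= => /andP[w0 w1]; rewrite mulr1 /kr tay0 -[m]mulr1.
apply: ler_pM => //; first exact: ltW.
  by rewrite ler_expR lerN2 ler_expR.
rewrite -[X in X <= _]expR0 ler_expR; apply: mulr_ge0 => //; exact: ltW.
Qed.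

(** Cauchy-Schwarz for the weight [K]: the integral of (h - m)^2 K is nonnegative, where [m] is the
    weighted mean of [h]. *)
Lemma sqr_Rint_le (h K : R -> R) : (forall w, 0 <= K w) -> intg K -> 0 < Rint K ->
  intg (fun w => h w * K w) -> intg (fun w => h w ^+ 2 * K w) ->
  Rint (fun w => h w * K w) ^+ 2 <= Rint K * Rint (fun w => h w ^+ 2 * K w).
Proof.
move=> K0 iK c0 i1 i2; set c := Rint K; set I := Rint _; pose m := I / c.
have : 0 <= Rint (fun w => (h w ^+ 2 * K w - 2 * m * (h w * K w)) + m ^+ 2 * K w).
  apply: Rint_ge0 => w.
  have -> : h w ^+ 2 * K w - 2 * m * (h w * K w) + m ^+ 2 * K w = (h w - m) ^+ 2 * K w by ring.
  by rewrite mulr_ge0 ?sqr_ge0.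
rewrite RintD; [|by apply: intgB => //; exact: intgZ|exact: intgZ].
rewrite RintB; [|by []|exact: intgZ]; rewrite !RintZ// -/I -/c => h0.
rewrite -subr_ge0.
have -> : c * Rint (fun w => h w ^+ 2 * K w) - I ^+ 2 =
   c * (Rint (fun w => h w ^+ 2 * K w) - 2 * m * I + m ^+ 2 * c).
  by rewrite /m; field; rewrite gt_eqF.
by rewrite mulr_ge0// ltW.
Qed.

(** Euler's product z (z+1) ... (z+n-1) / (n^z (n-1)!), with (n-1)! written as [rgam n%:R]. It is
    taken at indices [n.+1] whenever limits are considered. *)
Definition eulerG n z : R[i] :=
  \prod_(k < n) (z + k%:R) * cexp (- (z * (ln n%:R)%:C)) / (rgam n%:R)%:C.

Lemma GammaPosDn z n : 0 < Re z ->
  GammaPos (z + n%:R) = \prod_(k < n) (z + k%:R) * GammaPos z.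
Proof.
move=> z0; elim: n => [|n IH]; first by rewrite addr0 big_ord0 mul1r.
rewrite -natr1 addrA GammaPosS ?IH.
  by rewrite big_ord_recr /= mulrA [_ * (z + _)]mulrC.
by rewrite ReD natr_complex /= ltr_pwDl.
Qed.

Lemma eulerG_Gamma n z : 0 < Re z -> eulerG n z * GammaPos z =
  cexp (- (z * (ln n%:R)%:C)) * GammaPos (z + n%:R) / (rgam n%:R)%:C.
Proof. by move=> z0; rewrite GammaPosDn// /eulerG; ring. Qed.

(** If X has the Gamma distribution of parameter [n], then X / n has mean 1 and variance 1 / n. Here
    X = exp w and the weight is not normalised. *)
Let variance n : (0 < n)%N ->
  let q w := (expR (w - ln n%:R) - 1) ^+ 2 * kr n%:R w in
  intg q /\ Rint q = rgam n%:R / n%:R.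
Proof.
move=> n0 q; have nR : 0 < n%:R :> R by rewrite ltr0n.
have qE w : q w = (n%:R ^- 2 * kr (n%:R + 1 + 1) w - 2 / n%:R * kr (n%:R + 1) w) + kr n%:R w.
  rewrite /q /kr !mulrDl !expRD expRN lnK ?posrE// mul1r; field.
  by rewrite gt_eqF.
have i1 : intg (kr (n%:R + 1)) by apply: intg_kr; rewrite addr_gt0.
have i2 : intg (kr (n%:R + 1 + 1)) by apply: intg_kr; rewrite !addr_gt0.
have i0 : intg (kr n%:R) by exact: intg_kr.
rewrite (funext qE); split.
  by apply: intgD => //; apply: intgB; exact: intgZ.
rewrite RintD//; last by apply: intgB; exact: intgZ.
rewrite RintB; [|exact: intgZ..]; rewrite !RintZ// -!/(rgam _).
rewrite !rgamS ?addr_gt0//; field.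
by rewrite gt_eqF.
Qed.

(** The product [eulerG n z * GammaPos z] is the expectation of (X / n)^z for X of Gamma law [n].
    Its distance to 1 is controlled by Cauchy-Schwarz, [normc_cexp_sub1] and the variance 1 / n. *)
Lemma eulerG_near1 n z : (0 < n)%N -> 0 < Re z <= 1 ->
  normc (eulerG n z * GammaPos z - 1) ^+ 2 <= (1 + Im z ^+ 2 / Re z ^+ 2) / n%:R.
Proof.
move=> n0 z01; have /andP[z0 _] := z01.
have nR : 0 < n%:R :> R by rewrite ltr0n.
set C := 1 + _; have C0 : 0 <= C by rewrite addr_ge0// divr_ge0 ?sqr_ge0.
set c := rgam n%:R; have c0 : 0 < c := rgam_gt0 nR.
pose f (w : R) : R[i] := cexp (z * (w - ln n%:R)%:C) - 1.
have iK := intg_kr nR.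
have fKE w : f w * (kr n%:R w)%:C =
    cexp (- (z * (ln n%:R)%:C)) * mellin_kernel 0 (z + n%:R) w - (kr n%:R w)%:C.
  rewrite /f mulrBl mul1r; congr (_ - _).
  rewrite /mellin_kernel /kr real_complexM real_complexD real_complexN -cexpR.
  rewrite mulrBr mulrDl !cexpD natr_complex -real_complexM; ring.
have iz : cintg (mellin_kernel 0 (z + n%:R)).
  by apply: cintg_mellin_kernel; rewrite /= ReD natr_complex addr_gt0.
have iKC : cintg (fun w => (kr n%:R w)%:C) by split => //; exact: integrable0.
have ifK : cintg (fun w => f w * (kr n%:R w)%:C).
  rewrite (funext fKE) (_ : (fun w => _ - _) = fun w =>
    cexp (- (z * (ln n%:R)%:C)) * mellin_kernel 0 (z + n%:R) w + (-1) * (kr n%:R w)%:C).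
    by apply: cintgD; exact: cintgZ.
  by apply/funext => w; rewrite mulN1r.
have EfK : cint (fun w => f w * (kr n%:R w)%:C) =
    cexp (- (z * (ln n%:R)%:C)) * GammaPos (z + n%:R) - c%:C.
  rewrite (funext fKE) cintB//; last exact: cintgZ.
  rewrite cintZ// GammaPosE; congr (_ - _); rewrite /cint; congr Complex.
  by rewrite /Rint Rintegral_cst// mul0r.
have mfw : cmeas f.
  apply: cmeasD; last exact: cmeas_cst.
  apply: cmeas_cexp; apply: cmeasM; first exact: cmeas_cst.
  by apply: cmeas_real; exact: measurable_funB.
have [m1 m2] := mfw.
have [iq Eq] := variance n0.
have fq w : normc (f w) ^+ 2 * kr n%:R w <= C * ((expR (w - ln n%:R) - 1) ^+ 2 * kr n%:R w).
  by rewrite mulrA; apply: (ler_wpM2r (kr_ge0 _ _)); exact: normc_cexp_sub1.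
have iCq := intgZ C iq.
have mK := intg_meas iK.
have i1 : intg (fun w => Re (f w) ^+ 2 * kr n%:R w).
  apply: (le_intg _ _ iCq).
    by apply: measurable_funM => //; exact: measurable_funX.
  move=> w; rewrite (ger0_norm (mulr_ge0 (sqr_ge0 _) (kr_ge0 _ _))).
  apply: le_trans (fq w); apply: (ler_wpM2r (kr_ge0 _ _)).
  by rewrite sqr_normc lerDl sqr_ge0.
have i2 : intg (fun w => Im (f w) ^+ 2 * kr n%:R w).
  apply: (le_intg _ _ iCq).
    by apply: measurable_funM => //; exact: measurable_funX.
  move=> w; rewrite (ger0_norm (mulr_ge0 (sqr_ge0 _) (kr_ge0 _ _))).
  apply: le_trans (fq w); apply: (ler_wpM2r (kr_ge0 _ _)).
  by rewrite sqr_normc lerDr sqr_ge0.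
have [j1 j2] := ifK.
have R1 w : Re (f w * (kr n%:R w)%:C) = Re (f w) * kr n%:R w by rewrite ReM /= mulr0 subr0.
have R2 w : Im (f w * (kr n%:R w)%:C) = Im (f w) * kr n%:R w by rewrite ImM /= mulr0 add0r.
rewrite (funext R1) in j1; rewrite (funext R2) in j2.
have -> : eulerG n z * GammaPos z - 1 = cint (fun w => f w * (kr n%:R w)%:C) / c%:C.
  rewrite eulerG_Gamma// EfK mulrBl divff//.
  by rewrite (inj_eq (@complexI _)) gt_eqF.
rewrite Normc.normcM Normc.normcV normcR gtr0_norm// exprMn exprVn.
rewrite ler_pdivrMr ?exprn_gt0// sqr_normc /cint /= (funext R1) (funext R2).
apply: le_trans (lerD (sqr_Rint_le (kr_ge0 _) iK c0 j1 i1)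
  (sqr_Rint_le (kr_ge0 _) iK c0 j2 i2)) _.
rewrite -mulrDr -RintD// -/(rgam n%:R) -/c.
have -> : C / n%:R * c ^+ 2 = c * (C * (c / n%:R)) by field; rewrite gt_eqF.
rewrite ler_wpM2l ?(ltW c0)// -Eq -RintZ//; apply: le_Rint => //; first exact: intgD.
by move=> w; rewrite -mulrDl -sqr_normc fq.
Qed.

Let cvg_harm : n.+1%:R^-1 @[n --> \oo] --> (0 : R).
Proof. exact: cvg_harmonic. Qed.

(** On 0 < Re z <= 1 this is [eulerG_near1]; larger real parts are reached by unit steps. *)
Lemma eulerG_cvg z : 0 < Re z -> ccvg (fun n => eulerG n.+1 z * GammaPos z) 1.
Proof.
have H (m : nat) z' : m%:R < Re z' <= m.+1%:R ->
    ccvg (fun n => eulerG n.+1 z' * GammaPos z') 1.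
  elim: m z' => [|m IH] z' zm.
    set C := 1 + Im z' ^+ 2 / Re z' ^+ 2.
    have C0 : 0 <= C by rewrite addr_ge0// divr_ge0 ?sqr_ge0.
    apply: (@ccvg_squeeze _ _ _ (fun n => Num.sqrt (C * n.+1%:R^-1))).
      move=> n; rewrite -[leLHS]ger0_norm ?normc_ge0// -sqrtr_sqr ler_sqrt; last first.
        by rewrite mulr_ge0// invr_ge0.
      exact: eulerG_near1.
    rewrite -[X in _ --> X]sqrtr0 -[X in _ --> _ X](mulr0 C).
    apply: (cvg_comp _ (@Num.sqrt R)); last exact: sqrt_continuous.
    by apply: cvgM => //; exact: cvg_cst.
  have := zm; rewrite -(natr1 m.+1) -(natr1 m) => /andP[za zb].
  pose y := z' - 1; have yE : z' = y + 1 by rewrite subrK.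
  have Ry : Re y = Re z' - 1 by rewrite /y ReD ReN.
  have y0 : 0 < Re y by rewrite Ry subr_gt0; apply: le_lt_trans za; rewrite lerDr.
  have ynz := Re_gt0_neq0 y0.
  (* Raising the argument by one costs only the factor (y + n + 1) / (n + 1), which tends to 1. *)
  have step n : eulerG n.+1 z' * GammaPos z' =
      (eulerG n.+1 y * GammaPos y) * (1 + y * (n.+1%:R^-1)%:C).
    rewrite yE GammaPosS// /eulerG.
    have P : \prod_(k < n.+1) (y + 1 + k%:R) * y = \prod_(k < n.+1) (y + k%:R) * (y + n.+1%:R).
      rewrite [in LHS]big_ord_recr /= [in RHS]big_ord_recl /= addr0.
      rewrite (eq_bigr (fun i : 'I_n => y + i.+1%:R)); last first.
        by move=> i _; rewrite -addrA nat1r.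
      by rewrite -[y + 1 + n%:R]addrA nat1r; ring.
    have E : cexp (- ((y + 1) * (ln n.+1%:R)%:C)) =
        cexp (- (y * (ln n.+1%:R)%:C)) * (n.+1%:R^-1)%:C.
      by rewrite mulrDl opprD cexpD mul1r -real_complexN cexpR expRN lnK// posrE.
    have N0 : (n.+1%:R : R[i]) != 0 by rewrite pnatr_eq0.
    have c0C : (rgam n.+1%:R)%:C != 0 :> R[i].
      by rewrite (inj_eq (@complexI _)) gt_eqF// rgam_gt0.
    transitivity ((\prod_(k < n.+1) (y + 1 + k%:R) * y) * cexp (- (y * (ln n.+1%:R)%:C)) *
       (n.+1%:R^-1)%:C / (rgam n.+1%:R)%:C * GammaPos y); first by rewrite E; ring.
    rewrite P real_complexV -natr_complex; field.
    by rewrite nat1r N0 c0C.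
  rewrite (funext step) -[X in ccvg _ X]mulr1; apply: ccvgM.
    by apply: IH; rewrite Ry -(natr1 m); apply/andP; split; lra.
  rewrite -[X in ccvg _ X]addr0; apply: ccvgD; first exact: ccvg_cst.
  rewrite -[X in ccvg _ X](mulr0 y); apply: ccvgM; first exact: ccvg_cst.
  by split => /=; [exact: cvg_harm|exact: cvg_cst].
move=> z0; apply: (H `|Num.ceil (Re z)|.-1%N).
have c1 : (1 <= Num.ceil (Re z))%R by rewrite -gtz0_ge1 -(ltr_int R) (lt_le_trans z0)// ceil_ge.
have cE : (`|Num.ceil (Re z)|.-1.+1%:R : R) = (Num.ceil (Re z))%:~R.
  have c0 : 0 < Num.ceil (Re z) by exact: lt_le_trans c1.
  by rewrite prednK ?absz_gt0 ?(gt_eqF c0)// natr_absz (gtr0_norm c0).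
rewrite cE ceil_ge andbT -(ltrD2r 1) natr1 cE.
by rewrite -ltrBlDr; have := ceil_itv (Re z); rewrite intrB => /andP[].
Qed.

(** A zero of Gamma would make the products in [eulerG_cvg] vanish, although they tend to 1. *)
Lemma GammaPos_neq0 z : 0 < Re z -> GammaPos z != 0.
Proof.
move=> z0; apply/negP => /eqP G0; have := eulerG_cvg z0.
rewrite G0; under eq_fun do rewrite mulr0.
by move=> /(ccvg_unique (ccvg_cst 0)) /eqP; rewrite eq_sym oner_eq0.
Qed.

Lemma eulerG_cvg_rGamma z : 0 < Re z -> ccvg (fun n => eulerG n.+1 z) (rGamma z).
Proof.
move=> z0; rewrite rGamma_pos//.
have := ccvgM (eulerG_cvg z0) (ccvg_cst (GammaPos z)^-1); rewrite mul1r.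
by congr ccvg; apply/funext => n; rewrite mulfK// GammaPos_neq0.
Qed.

End EulerLimit.

(** * Growth of Euler's products and decay of Gamma on vertical lines *)

Section GammaBounds.
Variable R : realType.
Implicit Types (c y u d : R) (z : R[i]).

Let Psi y u : R := u * ln (1 + (y / u) ^+ 2) - 2 * y * atan (y / u).

Let onesqr_gt0 u : 0 < 1 + u ^+ 2.
Proof. by rewrite ltr_pwDl ?sqr_ge0. Qed.

Let is_derive_Psi y u : 0 < u -> is_derive u (1 : R) (Psi y) (ln (1 + (y / u) ^+ 2)).
Proof.
move=> u0.
have dV : is_derive u (1 : R) (fun t : R => y * t^-1) (y * - (u ^- 2)).
  apply: is_derive_funZ; apply: (is_derive_eq (is_deriveV (lt0r_neq0 u0) (is_derive_fun_id u))).
  by rewrite /GRing.scale /= mulr1.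
have dL : is_derive u (1 : R) (fun t => ln (1 + (y / t) ^+ 2))
    ((1 + (y / u) ^+ 2)^-1 * (0 + 2%:R * (y / u) ^+ 1 * (y * - (u ^- 2)))).
  exact: (@is_derive_ln_comp R (fun t => 1 + (y / t) ^+ 2) u _ (onesqr_gt0 _)
    (is_derive_funD (is_derive_fun_cst 1 u) (is_derive_funX 2 dV))).
apply: (is_derive_eq (is_derive_funD (is_derive_funM (is_derive_fun_id u) dL)
  (is_derive_funN (is_derive_funZ (2 * y) (is_derive_atan_comp dV))))).
rewrite mul1r add0r expr1 -[RHS]addr0 -addrA; congr (_ + _).
have h : 1 + (y / u) ^+ 2 != 0 by rewrite gt_eqF ?onesqr_gt0.
have u1 : u != 0 by rewrite gt_eqF.
have h2 : u ^+ 2 + y ^+ 2 != 0.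
  by rewrite gt_eqF// ltr_pwDl ?sqr_ge0// exprn_gt0.
by field; rewrite u1 h2.
Qed.

(** For c > 0, the square of |eulerG n (c + iy)| / |eulerG n c|, see [normc_eulerG]. It tends to
    |Gamma c / Gamma (c + iy)|^2. *)
Definition gprod c y n : R := \prod_(k < n) (1 + (y / (c + k%:R)) ^+ 2).

Let gprod_ge0 c y n : 0 <= gprod c y n.
Proof. by apply: prodr_ge0 => k _; rewrite ltW ?onesqr_gt0. Qed.

Let cDn_gt0 c n : 0 < c -> 0 < c + n%:R.
Proof. by move=> c0; rewrite ltr_pwDl. Qed.

(* [Psi y] is an antiderivative of the decreasing function
   [u |-> ln (1 + (y / u) ^+ 2)], so it compares the logarithm of [gprod]
   with an integral. *)
Let Psi_step c y n : 0 < c -> 0 <= y ->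
  1 + (y / (c + n.+1%:R)) ^+ 2 <= expR (Psi y (c + n.+1%:R) - Psi y (c + n%:R)) <=
  1 + (y / (c + n%:R)) ^+ 2.
Proof.
move=> c0 y0; have lt : c + n%:R < c + n.+1%:R by rewrite ltrD2l ltr_nat.
have cn := cDn_gt0 n c0.
have [t /andP[t1 t2] ->] := MVT_derive lt
  (fun x h => is_derive_Psi y (lt_le_trans cn (proj1 (andP h)))).
have -> : c + n.+1%:R - (c + n%:R) = 1 by rewrite -natr1; ring.
have t0 : 0 < t := lt_trans cn t1.
rewrite mulr1 lnK ?posrE ?onesqr_gt0// !lerD2l.
have yt v : 0 < v -> 0 <= y / v by move=> v0; rewrite divr_ge0// ltW.
rewrite !ler_pXn2r ?nnegrE ?yt ?(cDn_gt0 _ c0)//.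
by rewrite !ler_wpM2l// lef_pV2 ?posrE ?cDn_gt0// ltW.
Qed.

(** The factor of index 0 is kept apart: the integral bound of [Psi_step] covers the factor of index
    n + 1 by the interval from c + n to c + n + 1. *)
Let gprod_ub c y n : 0 < c -> 0 <= y ->
  gprod c y n.+1 <= (1 + (y / c) ^+ 2) * expR (Psi y (c + n%:R) - Psi y c).
Proof.
move=> c0 y0; elim: n => [|n IH].
  by rewrite /gprod big_ord1 addr0 subrr expR0 mulr1.
rewrite /gprod big_ord_recr /= -/(gprod c y n.+1).
have /andP[h _] := Psi_step n c0 y0.
apply: le_trans (ler_pM (gprod_ge0 _ _ _) (ltW (onesqr_gt0 _)) IH h) _.
rewrite -mulrA -expRD; apply: ler_wpM2l; first exact: ltW (onesqr_gt0 _).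
by rewrite ler_expR; lra.
Qed.

Let gprod_lb c y n : 0 < c -> 0 <= y ->
  expR (Psi y (c + n%:R) - Psi y c) <= gprod c y n.
Proof.
move=> c0 y0; elim: n => [|n IH].
  by rewrite /gprod big_ord0 addr0 subrr expR0.
rewrite /gprod big_ord_recr /= -/(gprod c y n).
have /andP[_ h] := Psi_step n c0 y0.
apply: le_trans (ler_pM (expR_ge0 _) (expR_ge0 _) IH h).
by rewrite -expRD ler_expR; lra.
Qed.

Let Psi_le0 y u : 0 <= y -> 0 < u -> Psi y u <= 0.
Proof.
move=> y0 u0; have r0 : 0 <= y / u by rewrite divr_ge0// ltW.
rewrite /Psi subr_le0.
have -> : 2 * y * atan (y / u) = u * (2 * (y / u) * atan (y / u)).
  by field; rewrite gt_eqF.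
by rewrite ler_wpM2l ?(ltW u0)// ln1Dsqr_le.
Qed.

Let Psi_ge y u : 0 <= y -> 0 < u -> - (2 * y * atan (y / u)) <= Psi y u.
Proof.
move=> y0 u0; rewrite /Psi lerDr mulr_ge0 ?(ltW u0)// ln_ge0//.
by rewrite lerDl sqr_ge0.
Qed.

(** In the telescoped exponent, the upper end contributes at most 0 and the lower end at most 2 y
    atan (y / c) <= pi y. *)
Lemma gprod_le c y n : 0 < c -> gprod c y n.+1 <= (1 + (y / c) ^+ 2) * expR (pi * `|y|).
Proof.
move=> c0; wlog y0 : y / 0 <= y.
  move=> H; have [/H//|y0] := leP 0 y; have := H (- y).
  rewrite oppr_ge0 (ltW y0) => /(_ isT); rewrite normrN mulNr sqrrN.
  congr (_ <= _); apply: eq_bigr => k _; by rewrite mulNr sqrrN.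
rewrite ger0_norm//; apply: le_trans (gprod_ub n c0 y0) _.
apply: ler_wpM2l; first exact: ltW (onesqr_gt0 _).
rewrite ler_expR.
have h1 := Psi_le0 y0 (cDn_gt0 n c0); have h2 := Psi_ge y0 c0.
have : 2 * y * atan (y / c) <= 2 * y * (pi / 2).
  by rewrite ler_wpM2l ?mulr_ge0// ltW// atan_ltpi2.
by lra.
Qed.

(** The losses against pi |y| are 2c from [atan_ge], the logarithm from Psi at [c], and a term from
    the upper end that vanishes as [n] grows. *)
Lemma gprod_ge c y n : 0 < c -> expR (pi * `|y| - 2 * c - c * ln (1 + (y / c) ^+ 2)
   - 2 * y ^+ 2 / (c + n%:R)) <= gprod c y n.
Proof.
move=> c0; wlog y0 : y / 0 <= y.
  move=> H; have [/H//|y0] := leP 0 y; have := H (- y).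
  rewrite oppr_ge0 (ltW y0) => /(_ isT); rewrite normrN mulNr !sqrrN.
  congr (_ <= _); apply: eq_bigr => k _; by rewrite mulNr sqrrN.
rewrite ger0_norm//; apply: le_trans (gprod_lb n c0 y0); rewrite ler_expR.
have cn := cDn_gt0 n c0.
have h1 := Psi_ge y0 cn.
have h2 : 2 * y * atan (y / (c + n%:R)) <= 2 * y ^+ 2 / (c + n%:R).
  have -> : 2 * y ^+ 2 / (c + n%:R) = 2 * y * (y / (c + n%:R)) by ring.
  by rewrite ler_wpM2l ?mulr_ge0// atan_le// divr_ge0// ltW.
have h3 : pi * y - 2 * c <= 2 * y * atan (y / c).
  move: y0; rewrite le_eqVlt => /predU1P[<-|y0].
    by rewrite !mulr0 !mul0r sub0r oppr_le0 mulr_ge0// ltW.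
  have yc : 0 < y / c by rewrite divr_gt0.
  have -> : pi * y - 2 * c = 2 * y * (pi / 2 - (y / c)^-1).
    by field; rewrite !gt_eqF.
  by rewrite ler_wpM2l ?mulr_ge0 ?(ltW y0)// atan_ge.
have E : Psi y c = c * ln (1 + (y / c) ^+ 2) - 2 * y * atan (y / c) by [].
by rewrite E; lra.
Qed.

Lemma normc_eulerG n z : 0 < Re z ->
  normc (eulerG n z) = normc (eulerG n (Re z)%:C) * Num.sqrt (gprod (Re z) (Im z) n).
Proof.
move=> c0; rewrite /eulerG !Normc.normcM !normc_cexp.
have -> : Re (- (z * (ln n%:R)%:C)) = Re (- ((Re z)%:C * (ln n%:R)%:C)).
  by rewrite !ReN !ReM /= !mulr0.
suff -> : normc (\prod_(k < n) (z + k%:R)) =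
    normc (\prod_(k < n) ((Re z)%:C + k%:R)) * Num.sqrt (gprod (Re z) (Im z) n) by ring.
rewrite !normc_prod /gprod.
have -> : Num.sqrt (\prod_(k < n) (1 + (Im z / (Re z + k%:R)) ^+ 2)) =
    \prod_(k < n) Num.sqrt (1 + (Im z / (Re z + k%:R)) ^+ 2).
  elim: n => [|n IH]; first by rewrite !big_ord0 sqrtr1.
  by rewrite !big_ord_recr /= sqrtrM ?IH// -/(gprod _ _ n) gprod_ge0.
rewrite -big_split /=; apply: eq_bigr => k _.
rewrite natr_complex -real_complexD normcR normcE !ReD !ImD /= addr0.
have ck := cDn_gt0 k c0.
rewrite -[`|_|]sqrtr_sqr -sqrtrM ?sqr_ge0//; apply: (f_equal (@Num.sqrt R)).
by field; rewrite gt_eqF.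
Qed.

Let ccvg_bounded (u : nat -> R[i]) (l : R[i]) : ccvg u l ->
  exists2 M, 0 <= M & forall n, normc (u n) <= M.
Proof.
move=> /ccvg_normc cu.
have [M [_ HM]] := cvg_seq_bounded (cvgP _ cu).
exists (`|M| + 1); first by rewrite addr_ge0.
move=> n; have := HM (`|M| + 1); rewrite (le_lt_trans (ler_norm M)) ?ltrDl//.
by move=> /(_ isT n I) /=; rewrite ger0_norm ?normc_ge0.
Qed.

(** Uniform in [n]: at the real point [c] the products converge, hence are bounded, and the ratio is
    the square root of [gprod], whose main rate is pi. *)
Lemma eulerG_bound c d : 0 < c -> 0 < d -> exists2 M, 0 <= M & forall n y,
  normc (eulerG n.+1 (Complex c y)) <= M * expR ((pi / 2 + d) * `|y|).
Proof.
move=> c0 d0; have [M M0 HM] := ccvg_bounded (eulerG_cvg_rGamma (z := c%:C) c0).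
(* With u = |y| / c, the choice e <= d c makes e u <= d |y|; e <= 1 is required by
   [ler1Dsqr_expR]. *)
pose e := Num.min 1 (d * c).
have e0 : 0 < e by rewrite lt_min ltr01 mulr_gt0.
have e1 : e <= 1 by rewrite ge_min lexx.
have ed : e <= d * c by rewrite ge_min lexx orbT.
exists (M * e^-1); first by rewrite mulr_ge0// invr_ge0 ltW.
move=> n y; rewrite (@normc_eulerG _ (Complex c y))// -mulrA [Re _]/= [Im _]/=.
apply: (ler_pM (normc_ge0 _) (sqrtr_ge0 _) (HM n)).
have yc : 0 <= `|y| / c by rewrite divr_ge0// ltW.
have e01 : 0 < e <= 1 by rewrite e0.
have := ler1Dsqr_expR e01 yc.
rewrite exprMn real_normK ?num_real// -exprMn => hs.
have -> : e^-1 * expR ((pi / 2 + d) * `|y|) =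
    Num.sqrt ((e^-1 * expR (d * `|y|)) ^+ 2 * expR (pi * `|y|)).
  have -> : expR (pi * `|y|) = expR (pi / 2 * `|y|) ^+ 2.
    by rewrite expr2 -expRD; congr expR; lra.
  rewrite -exprMn sqrtr_sqr [RHS]ger0_norm ?mulr_ge0 ?expR_ge0 ?invr_ge0 ?(ltW e0)//.
  by rewrite -[RHS]mulrA -expRD; congr (_ * expR _); lra.
rewrite ler_sqrt; last by rewrite mulr_ge0 ?sqr_ge0 ?expR_ge0.
apply: le_trans (gprod_le y n c0) _; apply: ler_wpM2r; first exact: expR_ge0.
apply: (le_trans hs); rewrite ler_pXn2r ?nnegrE ?mulr_ge0 ?expR_ge0 ?invr_ge0 ?(ltW e0)//.
apply: ler_wpM2l; first by rewrite invr_ge0 ltW.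
rewrite ler_expR mulrA mulrAC; apply: ler_wpM2r => //.
by rewrite ler_pdivrMr.
Qed.

(** A lower bound for 1 / Gamma on the line, obtained as the limit of the lower bound [gprod_ge] for
    Euler's products. *)
Lemma GammaPos_bound c d : 0 < c -> 0 < d -> exists2 M, 0 <= M & forall y,
  normc (GammaPos (Complex c y)) <= M * expR (- ((pi / 2 - d) * `|y|)).
Proof.
move=> c0 d0.
pose e := Num.min 1 d.
have e0 : 0 < e by rewrite lt_min ltr01.
have e1 : e <= 1 by rewrite ge_min lexx.
have ed : e <= d by rewrite ge_min lexx orbT.
(* The exponent c is half of the loss 2c in [gprod_ge]; - c ln e is the price of replacing (c / 2)
   ln (1 + (y / c)^2) by e |y|. *)
exists (normc (GammaPos c%:C) * expR (c - c * ln e)).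
  by rewrite mulr_ge0 ?normc_ge0 ?expR_ge0.
move=> y; set z := Complex c y.
have Gz : normc (GammaPos z) != 0 by rewrite normc_eq0 GammaPos_neq0.
have Gc : normc (GammaPos c%:C) != 0 by rewrite normc_eq0 GammaPos_neq0.
pose q n : R := (pi * `|y| - 2 * c - c * ln (1 + (y / c) ^+ 2) - 2 * y ^+ 2 / (c + n.+1%:R)) / 2.
pose q' : R := (pi * `|y| - 2 * c - c * ln (1 + (y / c) ^+ 2)) / 2.
have qn n : normc (eulerG n.+1 c%:C) * expR (q n) <= normc (eulerG n.+1 z).
  rewrite (@normc_eulerG _ z)//; apply: ler_wpM2l; first exact: normc_ge0.
  rewrite -[expR (q n)]ger0_norm ?expR_ge0// -sqrtr_sqr ler_sqrt ?gprod_ge0//.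
  apply: le_trans (gprod_ge y n.+1 c0).
  by rewrite expr2 -expRD ler_expR /q; lra.
have lim1 := ccvg_normc (eulerG_cvg_rGamma (z := c%:C) c0).
have lim2 := ccvg_normc (eulerG_cvg_rGamma (z := z) c0).
have limq : expR (q n) @[n --> \oo] --> expR q'.
  apply: (cvg_comp _ expR); last exact: continuous_expR.
  apply: cvgM; last exact: cvg_cst.
  set A := _ - _ - _.
  suff : A - 2 * y ^+ 2 / (c + n.+1%:R) @[n --> \oo] --> A - 2 * y ^+ 2 * 0.
    by rewrite mulr0 subr0.
  apply: cvgB; first exact: cvg_cst.
  apply: cvgM; first exact: cvg_cst.
  apply/gtr0_cvgV0; first by apply: nearW => n; exact: cDn_gt0.
  apply/cvgryPge => B; near=> n.
  apply: (@le_trans _ _ n%:R); last by rewrite ler_wpDl ?(ltW c0)// ler_nat.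
  by near: n; exact: nbhs_infty_ger.
have : normc (rGamma c%:C) * expR q' <= normc (rGamma z).
  apply: ler_cvg_to (cvgM lim1 limq) lim2 _.
  by apply: nearW => n; exact: qn.
rewrite !rGamma_pos// !Normc.normcV => hq.
have {}hq : normc (GammaPos z) * expR q' <= normc (GammaPos c%:C).
  have p1 : 0 < normc (GammaPos z) by rewrite lt_neqAle eq_sym Gz normc_ge0.
  have p2 : 0 < normc (GammaPos c%:C) by rewrite lt_neqAle eq_sym Gc normc_ge0.
  have := ler_wpM2l (ltW (mulr_gt0 p1 p2)) hq.
  by rewrite [leLHS](_ : _ = normc (GammaPos z) * expR q') ?[leRHS](_ : _ = normc (GammaPos c%:C));
    first by []; field.
apply: (@le_trans _ _ (normc (GammaPos c%:C) * expR (- q'))).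
  have := ler_wpM2r (expR_ge0 (- q')) hq.
  by rewrite -mulrA -expRD subrr expR0 mulr1.
rewrite -mulrA; apply: ler_wpM2l; first exact: normc_ge0.
rewrite -expRD ler_expR.
have yc : 0 <= `|y| / c by rewrite divr_ge0// ltW.
have e01 : 0 < e <= 1 by rewrite e0.
have := ler1Dsqr_expR e01 yc.
rewrite exprMn real_normK ?num_real// -exprMn => hs.
have : ln (1 + (y / c) ^+ 2) <= 2 * (e * (`|y| / c) - ln e).
  rewrite -(expRK (2 * _)) ler_ln ?posrE ?expR_gt0 ?onesqr_gt0//.
  apply: (le_trans hs); rewrite expRM_natl expRD expRN lnK ?posrE//.
  by rewrite [e^-1 * _]mulrC.
move=> /(ler_wpM2l (ltW c0)) hl.
have E : c * (2 * (e * (`|y| / c) - ln e)) = 2 * e * `|y| - 2 * (c * ln e).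
  by field; rewrite gt_eqF.
have : e * `|y| <= d * `|y| by exact: ler_wpM2r.
by rewrite /q'; rewrite E in hl; lra.
Unshelve. all: by end_near. Qed.

End GammaBounds.

(** * Mellin inversion and residues of Gamma *)

Section Residues.
Variable R : realType.
Implicit Types (s y v w : R) (z : R[i]).

Lemma cmeas_cvg d (T : measurableType d) (f_ : nat -> T -> R[i]) (f : T -> R[i]) :
  (forall n, cmeas (f_ n)) -> (forall x, ccvg (fun n => f_ n x) (f x)) -> cmeas f.
Proof.
move=> mf cf; split.
  apply: (@measurable_realfun.measurable_fun_cvg _ _ _ _ (fun n x => Re (f_ n x))).
    by move=> n; have [] := mf n.
  by move=> x _; have [] := cf x.
apply: (@measurable_realfun.measurable_fun_cvg _ _ _ _ (fun n x => Im (f_ n x))).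
  by move=> n; have [] := mf n.
by move=> x _; have [] := cf x.
Qed.

Lemma cmeas_line s : cmeas (fun y : R => Complex s y).
Proof. by apply: cmeas_Complex. Qed.

(** Measurability is read off the Mellin representation, an integral of a jointly measurable kernel,
    rather than off the definition by shifts. *)
Lemma cmeas_Gamma_line N s : strip N s -> cmeas (fun y => Gamma (Complex s y)).
Proof.
move=> sN; rewrite (_ : (fun y => _) = fun y => mellin N (Complex s y)); last first.
  by apply/funext => y; rewrite mellin_Gamma.
apply: (@cmeas_cint_param R _ (measurableTypeR R)
  (fun z : measurableTypeR R * measurableTypeR R => mellin_kernel N (Complex s z.1) z.2)).
have m1 : measurable_fun setT (fun z : measurableTypeR R * measurableTypeR R => z.1 : R).
  exact: measurable_fst.
have m2 : measurable_fun setT (fun z : measurableTypeR R * measurableTypeR R => z.2 : R).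
  exact: measurable_snd.
apply: cmeasM.
  apply: cmeas_real; apply: (@measurableT_comp _ _ _ _ _ _ (@tay R N)).
    by apply: continuous_measurable_fun; exact: continuous_tay.
  exact: measurable_expRT.
apply: cmeas_cexp; apply: cmeasM; first exact: cmeas_Complex.
exact: cmeas_real.
Qed.

Lemma strip_gt N s : strip N s -> 0 < s + N%:R.
Proof.
by case: N => [|N /andP[+ _]] /=; [rewrite addr0|rewrite -ltrBlDr sub0r].
Qed.

Lemma strip_neq0 N s k : strip N s -> s + k%:R != 0.
Proof.
case: N => [s0|N /andP[s1 s2]]; first by rewrite gt_eqF// ltr_pwDl.
have [kN|Nk] := leqP k N.
  by rewrite lt_eqF// -ltrBrDr sub0r (lt_le_trans s2)// lerN2 ler_nat.
by rewrite gt_eqF// -ltrBlDr sub0r (le_lt_trans _ s1)// lerN2 ler_nat.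
Qed.

(** [N] shifts reach the right half-plane, and each factor dividing there has norm at least |s + k|
    > 0. *)
Lemma Gamma_line_bound N s (d : R) : strip N s -> 0 < d -> exists2 M, 0 <= M & forall y,
  normc (Gamma (Complex s y)) <= M * expR (- ((pi / 2 - d) * `|y|)).
Proof.
move=> sN d0; have c0 := strip_gt sN.
have [M M0 HM] := GammaPos_bound c0 d0.
pose P : R := \prod_(k < N) `|s + k%:R|.
have P0 : 0 < P by apply: prodr_gt0 => k _; rewrite normr_gt0 (strip_neq0 k sN).
exists (M / P); first by rewrite divr_ge0// ltW.
move=> y; rewrite (GammaE (n := N))//.
have -> : Complex s y + N%:R = Complex (s + N%:R) y.
  by apply/eqP; rewrite eq_complex natr_complex /= addr0 !eqxx.
rewrite Normc.normcM Normc.normcV mulrAC ler_pM ?normc_ge0 ?invr_ge0 ?normc_ge0//.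
rewrite normc_prod lef_pV2 ?posrE//; last first.
  apply: prodr_gt0 => k _; rewrite lt_neqAle eq_sym normc_ge0 andbT normc_eq0.
  apply/eqP => /(congr1 (@complex.Re R)); rewrite ReD natr_complex /= => /eqP.
  by rewrite (negbTE (strip_neq0 k sN)).
apply: ler_prod => k _; rewrite normr_ge0 /=.
apply: le_trans (Re_le_normc _).
by rewrite ReD natr_complex.
Qed.

Lemma intg_expR_abs_le (f : R -> R[i]) (M d : R) : 0 < d -> cmeas f ->
  (forall y, normc (f y) <= M * expR (- (d * `|y|))) -> cintg f.
Proof.
move=> d0 mf fM; apply: (cintg_dom mf fM); apply: intgZ.
exact: intg_expR_abs.
Qed.

Let cexp_sv s y v : cexp (- (Complex s y * v%:C)) =
  (expR (- (s * v)))%:C * cexp (Complex 0 (- (y * v))).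
Proof.
rewrite -cexpR -cexpD; congr cexp; apply/eqP; rewrite eq_complex /=.
by apply/andP; split; apply/eqP; ring.
Qed.

Let pi4 : 0 < pi / 4 :> R.
Proof. by rewrite divr_gt0// pi_gt0. Qed.

Lemma cintg_Gamma_line N s : strip N s -> cintg (fun y => Gamma (Complex s y)).
Proof.
move=> sN; have [M M0 HM] := Gamma_line_bound sN pi4.
apply: (@intg_expR_abs_le _ M (pi / 4)) => //; first exact: cmeas_Gamma_line sN.
by move=> y; apply: le_trans (HM y) _; rewrite ler_wpM2l// ler_expR; lra.
Qed.

Lemma cintg_Gamma_cexp N s v : strip N s ->
  cintg (fun y => Gamma (Complex s y) * cexp (- (Complex s y * v%:C))).
Proof.
move=> sN; have [M M0 HM] := Gamma_line_bound sN pi4.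
apply: (@intg_expR_abs_le _ (M * expR (- (s * v))) (pi / 4)) => //.
  apply: cmeasM; first exact: cmeas_Gamma_line sN.
  apply: cmeas_cexp; apply: cmeasN; apply: cmeasM; first exact: cmeas_line.
  exact: cmeas_cst.
move=> y; rewrite Normc.normcM normc_cexp ReN ReM /= mulr0 subr0 mulrAC.
rewrite ler_wpM2r ?expR_ge0//; apply: le_trans (HM y) _.
by rewrite ler_wpM2l// ler_expR; lra.
Qed.

(** On the line, Gamma is the Fourier transform of tay N (e^w) e^(sw), and its own integrability
    makes inversion available. *)
Lemma mellin_inversion N s v : strip N s ->
  cint (fun y => Gamma (Complex s y) * cexp (- (Complex s y * v%:C))) =
  (2 * pi * tay N (expR v))%:C.
Proof.
move=> sN; pose g w := tay N (expR w) * expR (s * w).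
have cg : continuous g.
  move=> w; apply: cvgM; last exact: continuous_expR_lin.
  apply: (cvg_comp _ (@tay R N)); last exact: continuous_tay.
  exact: continuous_expR.
have ig : intg g := intg_tay_expR sN.
have ghE y : cint (fun w => (g w)%:C * cexp (Complex 0 (y * w))) = Gamma (Complex s y).
  rewrite -(mellin_Gamma (N := N))// /mellin; congr cint; apply/funext => w.
  rewrite mellin_kernelE /g /= /cexp /= expR0 !mul1r.
  by apply/eqP; rewrite eq_complex /=; apply/andP; split; apply/eqP; ring.
have [p [q [A [B [p0 q0 fA fB]]]]] := stripP sN.
have A0 : 0 <= A.
  by have := le_trans (normr_ge0 _) (fA 0); rewrite mulr0 expR0 mulr1.
have B0 : 0 <= B.
  by have := le_trans (normr_ge0 _) (fB 0); rewrite mulr0 oppr0 expR0 mulr1.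
have gM w : `|g w| <= A + B.
  have [w0|w0] := leP 0 w.
    apply: le_trans (fB w) _; apply: (@le_trans _ _ B); last by rewrite lerDr.
    by rewrite ler_piMr// -expR0 ler_expR oppr_le0 mulr_ge0// ltW.
  apply: le_trans (fA w) _; apply: (@le_trans _ _ A); last by rewrite lerDl.
  by rewrite ler_piMr// -expR0 ler_expR mulr_ge0_le0// ltW.
have igh : cintg (fun y => cint (fun w => (g w)%:C * cexp (Complex 0 (y * w)))).
  by rewrite (funext ghE); exact: cintg_Gamma_line sN.
have := fourier_inversion v cg gM ig igh.
rewrite (_ : (fun y => _) = fun y => Gamma (Complex s y) * cexp (Complex 0 (- (y * v)))); last first.
  by apply/funext => y; rewrite ghE.
move=> E; rewrite (_ : (fun y => _) = fun y =>
  (expR (- (s * v)))%:C * (Gamma (Complex s y) * cexp (Complex 0 (- (y * v))))); last first.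
  by apply/funext => y; rewrite cexp_sv mulrCA.
rewrite cintZ.
  rewrite E -real_complexM /g; congr (_%:C).
  have h : expR (- (s * v)) * expR (s * v) = 1 by rewrite -expRD addNr expR0.
  rewrite [LHS](_ : _ = 2 * pi * tay N (expR v) * (expR (- (s * v)) * expR (s * v))); last by ring.
  by rewrite h mulr1.
have := cintgZ (expR (s * v))%:C (cintg_Gamma_cexp v sN); congr cintg.
apply/funext => y; rewrite cexp_sv mulrCA; congr (_ * _).
by rewrite mulrA -real_complexM -expRD subrr expR0 mul1r.
Qed.

(** The existential constant [V] does not depend on the strip or the line. Passing from strip 0 to
    strip [N] therefore subtracts exactly the residues of Gamma * E at 0, ..., -(N - 1), since Gamma
    has residue (-1)^n / n! at -n. *)
Definition residual (E : R[i] -> R[i]) := exists V : R[i], forall N s, strip N s ->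
  cintg (fun y => Gamma (Complex s y) * E (Complex s y)) /\
  cint (fun y => Gamma (Complex s y) * E (Complex s y)) =
  (2 * pi)%:C * (V - \sum_(n < N) ((-1) ^+ n / n`!%:R)%:C * E (- n%:R)).

(** Base case: by [mellin_inversion] the subtracted Taylor polynomial in [tay] is the sum of
    residues. *)
Lemma residual_cexp v : residual (fun z => cexp (- (z * v%:C))).
Proof.
exists (expR (- expR v))%:C => N s sN; split; first exact: cintg_Gamma_cexp sN.
rewrite (mellin_inversion v sN) real_complexM; congr (_ * _).
rewrite /tay real_complexD real_complexN rmorph_sum; congr (_ - _).
apply: eq_bigr => n _.
rewrite mulNr opprK natr_complex -real_complexM cexpR -real_complexM; congr (_%:C).
by rewrite expRM_natl [in LHS]exprNn mulrAC.
Qed.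

Lemma residualZ (k : R[i]) E : residual E -> residual (fun z => k * E z).
Proof.
move=> [V HV]; exists (k * V) => N s sN; have [i1 E1] := HV N s sN.
have h y : Gamma (Complex s y) * (k * E (Complex s y)) =
  k * (Gamma (Complex s y) * E (Complex s y)) by rewrite mulrCA.
rewrite (funext h); split; first exact: cintgZ.
rewrite cintZ// E1 mulrCA; congr (_ * _); rewrite mulrBr; congr (_ - _).
by rewrite mulr_sumr; apply: eq_bigr => n _; rewrite mulrCA.
Qed.

Lemma residualD E F : residual E -> residual F -> residual (fun z => E z + F z).
Proof.
move=> [V HV] [W HW]; exists (V + W) => N s sN.
have [i1 E1] := HV N s sN; have [i2 E2] := HW N s sN.
under eq_fun do rewrite mulrDr; split; first exact: cintgD.
rewrite cintD// E1 E2 -mulrDr; congr (_ * _).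
rewrite addrACA -opprD -big_split /=; congr (_ - _).
by apply: eq_bigr => n _; rewrite mulrDr.
Qed.

Lemma Gamma_line_shift N s y : strip N s ->
  Gamma (Complex s y) * Complex s y = Gamma (Complex (s + 1) y).
Proof.
move=> sN; have -> : Complex (s + 1) y = Complex s y + 1.
  by apply/eqP; rewrite eq_complex /= addr0 !eqxx.
rewrite GammaS 1?mulrC//; apply/eqP => -[s0 _].
by have := strip_neq0 0 sN; rewrite addr0 s0 eqxx.
Qed.

(** Since Gamma z * z = Gamma (z + 1), the integral in strip [N] is the one for [E] in strip [N.-1].
    The factor z removes the term at 0 and reindexes the others. *)
Lemma residualS E : residual E -> residual (fun z => z * E (z + 1)).
Proof.
move=> [V HV]; exists V => N s sN; have [i1 E1] := HV _ _ (stripS sN).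
have h y : Gamma (Complex s y) * (Complex s y * E (Complex s y + 1)) =
    Gamma (Complex (s + 1) y) * E (Complex (s + 1) y).
  rewrite mulrA (Gamma_line_shift y sN); congr (_ * E _).
  by apply/eqP; rewrite eq_complex /= addr0 !eqxx.
rewrite (funext h); split => //; rewrite E1; congr (_ * (_ - _)).
case: N sN {i1 E1 h} => [|N] sN /=; first by rewrite !big_ord0.
rewrite [RHS]big_ord_recl /= oppr0 mul0r mulr0 add0r; apply: eq_bigr => n _.
rewrite /bump /= add1n; have -> : - n.+1%:R + 1 = - n%:R :> R[i].
  by rewrite -natr1 opprD addrNK.
rewrite mulrA; congr (_ * _); rewrite natr_complex -real_complexN -real_complexM.
congr (_%:C); rewrite exprS factS natrM; field.
by rewrite pnatr_eq0 -lt0n fact_gt0 /= nat1r pnatr_eq0.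
Qed.

Lemma residual_rising j v :
  residual (fun z => \prod_(k < j) (z + k%:R) * cexp (- (z * v%:C))).
Proof.
elim: j => [|j IH].
  have := residual_cexp v; congr residual; apply/funext => z.
  by rewrite big_ord0 mul1r.
(* The constant [cexp v%:C] undoes the shift of z inside the exponential. *)
have := residualZ (cexp v%:C) (residualS IH); congr residual; apply/funext => z.
rewrite big_ord_recl /= addr0 mulrDl mul1r opprD cexpD cexpN -cexpN.
have h : cexp v%:C * cexp (- v%:C) = 1 :> R[i] by rewrite -cexpD subrr cexp0.
rewrite (eq_bigr (fun i : 'I_j => z + (bump 0 i)%:R)); last first.
  by move=> i _; rewrite /bump /= add1n -addrA nat1r.
rewrite [LHS](_ : _ = z * \prod_(i < j) (z + (bump 0 i)%:R) * cexp (- (z * v%:C)) *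
  (cexp v%:C * cexp (- v%:C))); last by ring.
by rewrite h mulr1.
Qed.

(** Rewrites z + b as (z + j) + (b - j), so arbitrary linear factors reduce to rising factorials.
    The induction carries a rising factorial of any length [j]. *)
Lemma residual_prod (l : seq R[i]) v :
  residual (fun z => \prod_(b <- l) (z + b) * cexp (- (z * v%:C))).
Proof.
suff H j : residual (fun z => \prod_(b <- l) (z + b) *
    (\prod_(k < j) (z + k%:R) * cexp (- (z * v%:C)))).
  have := H 0; congr residual; apply/funext => z.
  by rewrite big_ord0 mul1r.
elim: l j => [|b l IH] j.
  have := residual_rising j v; congr residual; apply/funext => z.
  by rewrite big_nil mul1r.
have := residualD (IH j.+1) (residualZ (b - j%:R) (IH j)).
congr residual; apply/funext => z.
by rewrite big_cons big_ord_recr /=; ring.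
Qed.

End Residues.

(** * Residues of Gamma s / Gamma (a s) against exponentials *)

Section ReciprocalGamma.
Variables (R : realType) (a : R).
Hypothesis a01 : 0 < a < 1.
Implicit Types (s y v w : R) (z : R[i]).

Let a0 : 0 < a. Proof. by case/andP: a01. Qed.
Let a1 : a < 1. Proof. by case/andP: a01. Qed.

Lemma scale_line s y : a%:C * Complex s y = Complex (a * s) (a * y).
Proof. by apply/eqP; rewrite eq_complex /= !mul0r subr0 addr0 !eqxx. Qed.

Lemma ComplexDn s y n : Complex s y + n%:R = Complex (s + n%:R) y.
Proof. by apply/eqP; rewrite eq_complex natr_complex /= addr0 !eqxx. Qed.

(* Polynomials times exponentials that converge to [1 / Gamma (a z)]; shifting by [M]
   moves the argument of [eulerG] into the right half-plane, where the bounds hold. *)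
Definition rGamma_approx M n z : R[i] :=
  \prod_(k < M) (a%:C * z + k%:R) * eulerG n.+1 (a%:C * z + M%:R).

(** After extracting powers of [a], the approximant is a polynomial with known roots times an
    exponential; the power of [n.+1] in [eulerG] only shifts [v] by a * ln (n + 1). *)
Lemma residual_rGamma_approx M n v :
  residual (fun z => rGamma_approx M n z * cexp (- (z * v%:C))).
Proof.
pose L : R := ln n.+1%:R.
pose l := [seq k%:R / a%:C : R[i] | k <- index_iota 0 (M + n.+1)].
have aC0 : a%:C != 0 :> R[i] by rewrite (inj_eq (@complexI R)) gt_eqF.
have := residualZ (a%:C ^+ (M + n.+1) * cexp (- (M%:R * L%:C)) / (rgam n.+1%:R)%:C)
  (residual_prod l (v + a * L)).
congr residual; apply/funext => z.
have pE : \prod_(k < M + n.+1) (a%:C * z + k%:R) = a%:C ^+ (M + n.+1) * \prod_(b <- l) (z + b).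
  rewrite big_map big_mkord -[X in _ ^+ X]card_ord -prodr_const -big_split /=.
  by apply: eq_bigr => k _; rewrite mulrDr mulrCA divff// mulr1.
rewrite /rGamma_approx /eulerG -/L.
have -> : \prod_(k < M) (a%:C * z + k%:R) * (\prod_(k < n.+1) (a%:C * z + M%:R + k%:R) *
   cexp (- ((a%:C * z + M%:R) * L%:C)) / (rgam n.+1%:R)%:C) * cexp (- (z * v%:C)) =
   \prod_(k < M + n.+1) (a%:C * z + k%:R) * (cexp (- ((a%:C * z + M%:R) * L%:C)) *
   cexp (- (z * v%:C))) / (rgam n.+1%:R)%:C.
  have -> : \prod_(k < M + n.+1) (a%:C * z + k%:R) =
      \prod_(k < M) (a%:C * z + k%:R) * \prod_(k < n.+1) (a%:C * z + M%:R + k%:R).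
    rewrite big_split_ord; congr (_ * _).
    by apply: eq_bigr => k _; rewrite /= natrD addrA.
  by ring.
have -> : cexp (- ((a%:C * z + M%:R) * L%:C)) * cexp (- (z * v%:C)) =
    cexp (- (M%:R * L%:C)) * cexp (- (z * (v + a * L)%:C)).
  by rewrite -!cexpD real_complexD real_complexM; congr cexp; ring.
by rewrite pE; ring.
Qed.

Lemma rGamma_shift M z : 0 < Re z + M%:R ->
  rGamma z = \prod_(k < M) (z + k%:R) * rGamma (z + M%:R).
Proof.
by move=> zM; rewrite (rGammaE zM) rGamma_pos// ReD natr_complex.
Qed.

Lemma ccvg_rGamma_approx M z : 0 < a * Re z + M%:R ->
  ccvg (fun n => rGamma_approx M n z) (rGamma (a%:C * z)).
Proof.
have ReE : Re (a%:C * z) = a * Re z by rewrite ReM /= mul0r subr0.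
move=> zM; rewrite (@rGamma_shift M); last by rewrite ReE.
apply: ccvgM; first exact: ccvg_cst.
by apply: eulerG_cvg_rGamma; rewrite ReD natr_complex ReE.
Qed.

Lemma cmeas_rGamma_approx M n d (T : measurableType d) (f : T -> R[i]) :
  cmeas f -> cmeas (fun x => rGamma_approx M n (f x)).
Proof.
move=> mf; have maf : cmeas (fun x => a%:C * f x) by apply: cmeasM => //; exact: cmeas_cst.
apply: cmeasM.
  by apply: cmeas_prod => k; apply: cmeasD => //; exact: cmeas_cst.
have mafM : cmeas (fun x => a%:C * f x + M%:R) by apply: cmeasD => //; exact: cmeas_cst.
apply: cmeasM; last exact: cmeas_cst.
apply: cmeasM; first by apply: cmeas_prod => k; apply: cmeasD => //; exact: cmeas_cst.
by apply: cmeas_cexp; apply: cmeasN; apply: cmeasM => //; exact: cmeas_cst.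
Qed.

Lemma rising_bound M s (d : R) : 0 < d -> exists2 C, 0 <= C & forall y,
  normc (\prod_(k < M) (a%:C * Complex s y + k%:R)) <= C * expR (d * `|y|).
Proof.
elim: M d => [|M IH] d d0.
  exists 1 => // y; rewrite big_ord0 mul1r.
  have -> : normc (1 : R[i]) = 1 by rewrite (normcR (1 : R)) normr1.
  by rewrite -[leLHS]expR0 ler_expR mulr_ge0// ltW.
(* Half of the rate serves the earlier factors, half the new linear one. *)
have d2 : 0 < d / 2 by rewrite divr_gt0.
have [C C0 HC] := IH _ d2; exists (C * (`|a * s + M%:R| + a / (d / 2))).
  by rewrite mulr_ge0// addr_ge0// divr_ge0// ltW.
move=> y; rewrite big_ord_recr /= Normc.normcM.
have -> : C * (`|a * s + M%:R| + a / (d / 2)) * expR (d * `|y|) =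
    C * expR (d / 2 * `|y|) * ((`|a * s + M%:R| + a / (d / 2)) * expR (d / 2 * `|y|)).
  have -> : d * `|y| = d / 2 * `|y| + d / 2 * `|y| by field.
  by rewrite expRD; ring.
apply: ler_pM; rewrite ?normc_ge0//.
rewrite scale_line ComplexDn; apply: le_trans (normc_le_ReIm _) _.
rewrite [Re _]/= [Im _]/= mulrDl; apply: lerD.
  by rewrite ler_peMr// -[leLHS]expR0 ler_expR mulr_ge0// ltW.
rewrite normrM (gtr0_norm a0) -[leRHS]mulrA ler_pM2l// [leRHS]mulrC ler_pdivlMr// mulrC.
by apply: le_trans (expR_ge1Dx _); rewrite lerDr.
Qed.

(** A quarter of the gap between the decay pi / 2 of Gamma and the growth a pi / 2 of its
    reciprocal. The losses are e for Gamma, e for the polynomial and a e for [eulerG], so at least a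
    rate e remains. *)
Let e := pi / 2 * (1 - a) / 4.
Let e0 : 0 < e.
Proof. by rewrite /e divr_gt0// mulr_gt0 ?subr_gt0// divr_gt0// pi_gt0. Qed.

(** The constant is uniform in [n], which supplies the dominating function for the limit in Euler's
    product. *)
Lemma Gamma_rGamma_approx_bound N M s : strip N s -> 0 < a * s + M%:R ->
  exists2 C, 0 <= C & forall n y,
  normc (Gamma (Complex s y) * rGamma_approx M n (Complex s y)) <= C * expR (- (e * `|y|)).
Proof.
move=> sN sM; have [A A0 HA] := Gamma_line_bound sN e0.
have [B B0 HB] := @rising_bound M s e e0.
have [C C0 HC] := eulerG_bound sM e0.
exists (A * (B * C)); first by rewrite !mulr_ge0.
move=> n y; rewrite Normc.normcM /rGamma_approx [X in _ * X]Normc.normcM.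
rewrite [a%:C * _ + M%:R](_ : _ = Complex (a * s + M%:R) (a * y)); last first.
  by rewrite scale_line ComplexDn.
apply: (@le_trans _ _ (A * expR (- ((pi / 2 - e) * `|y|)) * (B * expR (e * `|y|) *
   (C * expR ((pi / 2 + e) * `|a * y|))))).
  apply: ler_pM; rewrite ?normc_ge0//; first by rewrite mulr_ge0 ?normc_ge0.
  by apply: ler_pM; rewrite ?normc_ge0.
rewrite [leLHS](_ : _ = A * (B * C) * (expR (- ((pi / 2 - e) * `|y|)) *
  (expR (e * `|y|) * expR ((pi / 2 + e) * `|a * y|)))); last by ring.
apply: ler_wpM2l; first by rewrite !mulr_ge0.
rewrite -!expRD ler_expR normrM gtr0_norm//.
have y0 := normr_ge0 y; have aye : a * e * `|y| <= e * `|y|.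
  by rewrite -mulrA; apply: ler_piMl; [rewrite mulr_ge0// ltW|exact: ltW].
have -> : - ((pi / 2 - e) * `|y|) + (e * `|y| + (pi / 2 + e) * (a * `|y|)) =
  - (e * `|y|) + (a * e * `|y| - e * `|y|).
  by rewrite /e; field.
by rewrite gerDl subr_le0.
Qed.

Lemma cmeas_rGamma_line M s : 0 < a * s + M%:R ->
  cmeas (fun y => rGamma (a%:C * Complex s y)).
Proof.
move=> sM; apply: (@cmeas_cvg _ _ _ (fun n y => rGamma_approx M n (Complex s y))).
  by move=> n; apply: cmeas_rGamma_approx; exact: cmeas_line.
by move=> y; apply: ccvg_rGamma_approx.
Qed.

Lemma strip_scale N s : strip N s -> 0 < a * s + N%:R.
Proof.
move=> /strip_gt sN; have -> : a * s + N%:R = a * (s + N%:R) + (1 - a) * N%:R by ring.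
by rewrite ltr_pwDl ?mulr_gt0// mulr_ge0// subr_ge0 ltW.
Qed.

Lemma Gamma_rGamma_bound N s : strip N s -> exists2 C, 0 <= C & forall y,
  normc (Gamma (Complex s y) * rGamma (a%:C * Complex s y)) <= C * expR (- (e * `|y|)).
Proof.
move=> sN; have sM := strip_scale sN.
have [C C0 HC] := Gamma_rGamma_approx_bound sN sM; exists C => // y.
have cv := ccvg_normc (ccvgM (ccvg_cst (Gamma (Complex s y)))
  (@ccvg_rGamma_approx N (Complex s y) sM)).
have := cvg_lim _ cv => /(_ (@Rhausdorff R)) <-.
apply: limr_le; first by apply/cvg_ex; eexists; exact: cv.
exact: nearW.
Qed.

Definition stab_integrand v z : R[i] :=
  Gamma z * (rGamma (a%:C * z) * cexp (- (z * v%:C))).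

Lemma cmeas_cexp_line s v : cmeas (fun y => cexp (- (Complex s y * v%:C))).
Proof.
apply: cmeas_cexp; apply: cmeasN; apply: cmeasM; first exact: cmeas_line.
exact: cmeas_cst.
Qed.

Lemma normc_cexp_line s y v : normc (cexp (- (Complex s y * v%:C))) = expR (- (s * v)).
Proof. by rewrite normc_cexp ReN ReM /= mulr0 subr0. Qed.

Lemma rGamma_line_limit N M s v : strip N s -> 0 < a * s + M%:R ->
  cintg (fun y => stab_integrand v (Complex s y)) /\
  ccvg (fun n => cint (fun y => Gamma (Complex s y) *
    (rGamma_approx M n (Complex s y) * cexp (- (Complex s y * v%:C)))))
    (cint (fun y => stab_integrand v (Complex s y))).
Proof.
move=> sN sM; have [C C0 HC] := Gamma_rGamma_approx_bound sN sM.
apply: (@cint_dominated _ _ _ (fun y => C * expR (- (s * v)) * expR (- (e * `|y|)))).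
- move=> n; apply: cmeasM; first exact: cmeas_Gamma_line sN.
  apply: cmeasM; last exact: cmeas_cexp_line.
  by apply: cmeas_rGamma_approx; exact: cmeas_line.
- move=> y; apply: ccvgM; first exact: ccvg_cst.
  apply: ccvgM; last exact: ccvg_cst.
  exact: ccvg_rGamma_approx.
- move=> n y; rewrite mulrA Normc.normcM normc_cexp_line [leRHS]mulrAC.
  by apply: ler_wpM2r => //; exact: expR_ge0.
- by apply: intgZ; exact: intg_expR_abs.
Qed.

(** The line Re s = 1 is one choice; [stabH_residues] with [N = 0] gives the same value on every
    line in the right half-plane. *)
Definition stabH v : R[i] :=
  (2 * pi)%:C^-1 * cint (fun y => stab_integrand v (Complex 1 y)).

Let tpi_neq0 : (2 * pi)%:C != 0 :> R[i].
Proof. by rewrite (inj_eq (@complexI R)) mulf_neq0 ?gt_eqF ?pi_gt0. Qed.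

Definition stab_res n v : R[i] :=
  ((-1) ^+ n / n`!%:R)%:C * (rGamma (- (a * n%:R)%:C) * cexp ((n%:R * v)%:C)).

(** For each approximant, the lines Re s = 1 and Re s = s share the constant [V] of [residual], so
    their difference is a finite sum of residues; then [n] tends to infinity. *)
Lemma stabH_residues N s v : strip N s ->
  cint (fun y => stab_integrand v (Complex s y)) =
  (2 * pi)%:C * (stabH v - \sum_(n < N) stab_res n v).
Proof.
move=> sN; have sM := strip_scale sN.
have s1M : 0 < a * 1 + N%:R by rewrite mulr1 ltr_wpDr.
(* The same shift [N] is used on both lines, so that the approximants coincide. *)
have [_ c1] := @rGamma_line_limit 0 N 1 v ltr01 s1M.
have [_ cs] := rGamma_line_limit v sN sM.
rewrite mulrBr mulrA divff// mul1r.
apply: (ccvg_unique cs).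
(* At -i the approximants converge as well, because a i < N for i < N. *)
have cr (i : 'I_N) : ccvg (fun n => ((-1) ^+ i / i`!%:R)%:C *
    (rGamma_approx N n (- i%:R) * cexp (- (- i%:R * v%:C)))) (stab_res i v).
  have -> : stab_res i v = ((-1) ^+ i / i`!%:R)%:C *
    (rGamma (a%:C * - i%:R) * cexp (- (- i%:R * v%:C))).
    rewrite /stab_res; congr (_ * (rGamma _ * cexp _)).
      by rewrite real_complexM natr_complex mulrN.
    by rewrite real_complexM natr_complex mulNr opprK.
  apply: ccvgM; first exact: ccvg_cst.
  apply: ccvgM; last exact: ccvg_cst.
  apply: ccvg_rGamma_approx; rewrite natr_complex ReN [Re _]/=.
  rewrite mulrN addrC subr_gt0 (@le_lt_trans _ _ (i%:R : R))// ?ltr_nat//.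
  by rewrite ler_piMl// ltW.
have := ccvgD c1 (ccvgM (ccvg_cst (- (2 * pi)%:C)) (ccvg_sum (index_enum 'I_N) cr)).
rewrite mulNr; congr ccvg; apply/funext => n.
have [V HV] := residual_rGamma_approx N n v.
have [_ ->] := HV 0 1 ltr01; have [_ ->] := HV N s sN.
by rewrite big_ord0 subr0 mulNr mulrBr.
Qed.

Lemma stabH_bound N s : strip N s -> exists2 C, 0 <= C & forall v,
  normc (stabH v - \sum_(n < N) stab_res n v) <= C * expR (- (s * v)).
Proof.
move=> sN; have [C C0 HC] := Gamma_rGamma_bound sN.
exists ((2 * pi)^-1 * (2 * (C * Rint (fun y => expR (- (e * `|y|)))))).
  rewrite !mulr_ge0 ?invr_ge0 ?mulr_ge0 ?pi_ge0//.
  by apply: Rint_ge0 => y; exact: expR_ge0.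
move=> v.
have -> : stabH v - \sum_(n < N) stab_res n v =
    (2 * pi)%:C^-1 * cint (fun y => stab_integrand v (Complex s y)).
  by rewrite (stabH_residues v sN) mulKf.
rewrite Normc.normcM -real_complexV normcR ger0_norm; last first.
  by rewrite invr_ge0 mulr_ge0// pi_ge0.
rewrite -mulrA; apply: ler_wpM2l; first by rewrite invr_ge0 mulr_ge0// pi_ge0.
have ie := intg_expR_abs e0.
have := @normc_cint_le R (fun y => stab_integrand v (Complex s y))
  (fun y => C * expR (- (s * v)) * expR (- (e * `|y|))).
rewrite RintZ// => H; apply: le_trans (H _ _ _) _.
- apply: cmeasM; first exact: cmeas_Gamma_line sN.
  apply: cmeasM; last exact: cmeas_cexp_line.
  exact: cmeas_rGamma_line (strip_scale sN).
- move=> y; rewrite /stab_integrand mulrA Normc.normcM normc_cexp_line [leRHS]mulrAC.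
  by apply: ler_wpM2r => //; exact: expR_ge0.
- exact: intgZ.
- by rewrite le_eqVlt; apply/orP; left; apply/eqP; ring.
Qed.

End ReciprocalGamma.

(** * Subordination of the stable density to Gaussians *)

Section Subordination.
Variables (R : realType) (a : R).
Hypothesis a01 : 0 < a < 1.
Implicit Types (s y v w l : R) (z : R[i]).

Let a0 : 0 < a. Proof. by case/andP: a01. Qed.
Let R1 := measurableTypeR R.

Lemma cmeas_stabH : cmeas (stabH a).
Proof.
apply: cmeasM; first exact: cmeas_cst.
apply: (@cmeas_cint_param R _ R1
  (fun p : R1 * R1 => stab_integrand a p.1 (Complex 1 p.2))).
have m1 : measurable_fun setT (fun p : R1 * R1 => p.1 : R) by exact: measurable_fst.
have m2 : measurable_fun setT (fun p : R1 * R1 => p.2 : R) by exact: measurable_snd.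
apply: cmeasM.
  exact: (cmeas_comp m2 (@cmeas_Gamma_line R 0 1 ltr01)).
apply: cmeasM.
  by apply: (cmeas_comp m2 (@cmeas_rGamma_line R a 0 1 _)); rewrite mulr1 addr0.
apply: cmeas_cexp; apply: cmeasN; apply: cmeasM; last exact: cmeas_real.
exact: cmeas_Complex.
Qed.

(* The density of the logarithm of the [a]-stable subordinator at time 1. *)
Definition subH w : R[i] := stabH a (- (a * w)).

Lemma cmeas_subH : cmeas subH.
Proof.
apply: (@cmeas_comp R _ _ R1 R1 (stabH a) (fun w => - (a * w))); last exact: cmeas_stabH.
by apply: measurableT_comp => //; exact: measurable_funM.
Qed.

Lemma subH_line s w : 0 < s -> subH w =
  (2 * pi)%:C^-1 * cint (fun y => stab_integrand a (- (a * w)) (Complex s y)).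
Proof.
move=> s0; rewrite (@stabH_residues R a a01 0)// big_ord0 subr0 mulKf//.
by rewrite (inj_eq (@complexI R)) mulf_neq0 ?gt_eqF ?pi_gt0.
Qed.

Lemma stab_integrandE s y w : stab_integrand a (- (a * w)) (Complex s y) =
  Gamma (Complex s y) * rGamma (a%:C * Complex s y) * cexp (a%:C * Complex s y * w%:C).
Proof.
rewrite /stab_integrand mulrA; congr (_ * cexp _).
by rewrite real_complexN real_complexM; ring.
Qed.

(** Fubini. It is applied to the Laplace kernel, and to [mixweight] for the Mellin-Barnes
    formula. *)
Lemma subH_pairing s (phi : R -> R) : 0 < s -> measurable_fun setT phi ->
  (forall w, 0 <= phi w) -> intg (fun w => phi w * expR (a * s * w)) ->
  let G y := Gamma (Complex s y) * rGamma (a%:C * Complex s y) *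
    cint (fun w => (phi w)%:C * cexp (a%:C * Complex s y * w%:C)) in
  cintg G /\ cint (fun w => subH w * (phi w)%:C) = (2 * pi)%:C^-1 * cint G.
Proof.
move=> s0 mphi phi0 iphi G.
have [C C0 HC] := @Gamma_rGamma_bound R a a01 0 s s0.
set e : R := pi / 2 * (1 - a) / 4 in HC.
have e0 : 0 < e.
  by case/andP: a01 => _ a1; rewrite /e divr_gt0// mulr_gt0 ?subr_gt0// divr_gt0// pi_gt0.
pose f (p : R1 * R1) : R[i] :=
  (phi p.1)%:C * stab_integrand a (- (a * p.1)) (Complex s p.2).
have m1 : measurable_fun setT (fun p : R1 * R1 => p.1 : R) by exact: measurable_fst.
have m2 : measurable_fun setT (fun p : R1 * R1 => p.2 : R) by exact: measurable_snd.
have mf : cmeas f.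
  apply: cmeasM; first by apply: cmeas_real; exact: (measurableT_comp mphi m1).
  rewrite (_ : (fun p => _) = fun p : R1 * R1 => Gamma (Complex s p.2) *
    rGamma (a%:C * Complex s p.2) * cexp (a%:C * Complex s p.2 * p.1%:C)); last first.
    by apply/funext => p; rewrite stab_integrandE.
  apply: cmeasM.
    apply: cmeasM; first exact: (cmeas_comp m2 (@cmeas_Gamma_line R 0 s s0)).
    by apply: (cmeas_comp m2 (@cmeas_rGamma_line R a 0 s _)); rewrite addr0 mulr_gt0.
  apply: cmeas_cexp; apply: cmeasM; last exact: cmeas_real.
  by apply: cmeasM; [exact: cmeas_cst|exact: cmeas_Complex].
pose h1 w := phi w * expR (a * s * w).
pose h2 y := C * expR (- (e * `|y|)).
have ih2 : intg h2 by apply: intgZ; exact: intg_expR_abs.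
have fh w y : normc (f (w, y)) <= h1 w * h2 y.
  rewrite /f /= stab_integrandE Normc.normcM Normc.normcM normcR normc_cexp.
  rewrite scale_line ReM [Re _]/= [Im w%:C]/= mulr0 subr0 [Re _]/= ger0_norm//.
  rewrite [leLHS]mulrCA [leLHS]mulrC; apply: ler_wpM2l.
    by rewrite mulr_ge0// expR_ge0.
  by rewrite -scale_line; exact: HC.
have fh' x y : normc (f (x, y)) <= (fun x y => h1 x * h2 y) x y := fh x y.
have ih x : intg (fun y => h1 x * h2 y) by exact: intgZ.
have ihh : intg (fun x => Rint (fun y => h1 x * h2 y)).
  rewrite (_ : (fun x => _) = (fun x => Rint h2 * h1 x)); first exact: intgZ.
  by apply/funext => x; rewrite RintZ// mulrC.
have GE y : G y = cint (fun w => f (w, y)).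
  rewrite /G -cintZ; last first.
    apply: (cintg_dom _ _ iphi); last first.
      move=> w; rewrite Normc.normcM normcR normc_cexp ger0_norm// scale_line ReM.
      by rewrite [Re _]/= [Im w%:C]/= mulr0 subr0.
    apply: cmeasM; first exact: cmeas_real.
    apply: cmeas_cexp; apply: cmeasM; first exact: cmeas_cst.
    by apply: cmeas_real; exact: measurable_id.
  by congr cint; apply/funext => w; rewrite /f /= stab_integrandE mulrCA.
split; first by rewrite (funext GE); exact: (cintg_cint_right mf ih fh' ihh).
rewrite (funext GE) -(cint_swap mf ih fh' ihh) -cintZ; last first.
  exact: (cintg_cint_left mf ih fh' ihh).
congr cint; apply/funext => w; rewrite /f /= cintZ.
  by rewrite (subH_line w s0); ring.
have sM : 0 < a * s + 0%:R by rewrite addr0 mulr_gt0.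
by have [] := @rGamma_line_limit R a a01 0 0 s (- (a * w)) s0 sM.
Qed.

Lemma mellin_kernel0E z w : mellin_kernel 0 z w = (expR (- expR w))%:C * cexp (z * w%:C).
Proof. by rewrite /mellin_kernel tay0. Qed.

Lemma cint_Gamma_shift z l : 0 < Re z ->
  cint (fun w => (expR (- expR (w + l)))%:C * cexp (z * w%:C)) =
  cexp (- (z * l%:C)) * GammaPos z.
Proof.
move=> z0; have iz := @cintg_mellin_kernel R 0 z z0.
rewrite GammaPosE /mellin (cint_shift l iz) -cintZ; last exact: cintg_shift.
congr cint; apply/funext => w; rewrite mellin_kernel0E mulrCA; congr (_ * _).
by rewrite -cexpD real_complexD; congr cexp; ring.
Qed.

Lemma cint_Gamma_refl z l : 0 < Re z ->
  cint (fun w => (expR (- expR (l - w)))%:C * cexp (- (z * w%:C))) =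
  cexp (- (z * l%:C)) * GammaPos z.
Proof.
move=> z0; have iz := @cintg_mellin_kernel R 0 z z0.
have iz' := cintg_shift l iz.
rewrite GammaPosE /mellin (cint_shift l iz) (cint_opp iz') -cintZ; last exact: (cintg_opp iz').
congr cint; apply/funext => w; rewrite mellin_kernel0E mulrCA addrC; congr (_ * _).
by rewrite -cexpD real_complexD real_complexN; congr cexp; ring.
Qed.

Lemma intg_Gamma_shift s l : 0 < s -> intg (fun w => expR (- expR (w + l)) * expR (s * w)).
Proof.
move=> s0; have := intgZ (expR (- (s * l))) (intg_affine l ltr01 (@intg_tay_expR R 0 s s0)).
congr intg; apply/funext => w; rewrite tay0 mul1r [LHS]mulrCA -[in LHS]expRD.
by congr (_ * expR _); ring.
Qed.

Lemma intg_Gamma_refl s l : 0 < s ->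
  intg (fun w => expR (- expR (l - w)) * expR (- (s * w))).
Proof.
move=> s0; have := intg_opp (intg_Gamma_shift l s0).
by congr intg; apply/funext => w; rewrite addrC mulrN.
Qed.

(** The pairing yields e^(- a s l) Gamma (a s), the Gamma factor cancels, and Mellin inversion in
    strip 0 gives exp (- e^(a l)). *)
Lemma laplace_subH l :
  cint (fun w => subH w * (expR (- expR (w + l)))%:C) = (expR (- expR (a * l)))%:C.
Proof.
have [||||_ ->] := @subH_pairing 1 (fun w => expR (- expR (w + l))).
- exact: ltr01.
- apply: measurable_expRT; apply: measurableT_comp => //; apply: measurable_expRT.
  exact: measurable_funD.
- by move=> w; exact: expR_ge0.
- by apply: intg_Gamma_shift; rewrite mulr1.
have := @mellin_inversion R 0 1 (a * l) ltr01; rewrite tay0 => E.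
rewrite (_ : (fun y => _) = (fun y => Gamma (Complex 1 y) *
   cexp (- (Complex 1 y * (a * l)%:C)))).
  rewrite E (real_complexM (2 * pi)) mulKf//.
  by rewrite (inj_eq (@complexI R)) mulf_neq0 ?gt_eqF ?pi_gt0.
apply/funext => y; have z0 : 0 < Re (a%:C * Complex 1 y).
  by rewrite scale_line /= mulr1.
rewrite cint_Gamma_shift// rGamma_pos// -mulrA; congr (_ * _).
rewrite mulrCA mulVf ?GammaPos_neq0// mulr1.
by congr cexp; rewrite real_complexM; ring.
Qed.

Lemma subH_bound_pos s : 0 < s -> exists2 C, 0 <= C & forall w,
  normc (subH w) <= C * expR (a * s * w).
Proof.
move=> s0; have [C C0 HC] := @stabH_bound R a a01 0 s s0; exists C => // w.
by have := HC (- (a * w)); rewrite big_ord0 subr0 mulrN opprK mulrCA mulrA.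
Qed.

Lemma stab_res0 v : stab_res a 0 v = 0.
Proof.
rewrite /stab_res mulr0; have := @rGamma0 R 0; rewrite natr_complex => ->.
by rewrite mul0r mulr0.
Qed.

(** The residue at 0 vanishes because 1 / Gamma (0) = 0, so the line may move to -1/2, which gives
    decay at plus infinity. *)
Lemma subH_bound_neg : exists2 C, 0 <= C & forall w,
  normc (subH w) <= C * expR (- (a / 2 * w)).
Proof.
have s1 : strip 1 (- 2^-1 : R) by rewrite /=; apply/andP; split; lra.
have [C C0 HC] := stabH_bound a01 s1; exists C => // w.
have := HC (- (a * w)); rewrite big_ord1 stab_res0 subr0 mulNr opprK => /le_trans; apply.
by apply: ler_wpM2l => //; rewrite ler_expR; lra.
Qed.

Lemma intg_subH k : intg (fun w => normc (subH w) * expR (- (k%:R / 2 * w))).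
Proof.
(* The line s = (k + 1) / (2 a) is chosen so that a s - k / 2 = 1 / 2. *)
have [A A0 HA] := @subH_bound_pos ((k.+1%:R / 2) / a) (divr_gt0 (divr_gt0 (ltr0Sn _ _) (ltr0Sn _ 1)) a0).
have [B B0 HB] := subH_bound_neg.
have mf : measurable_fun setT (fun w => normc (subH w) * expR (- (k%:R / 2 * w))).
  apply: measurable_funM; first exact: (measurable_normc cmeas_subH).
  by apply: measurable_expRT; apply: measurableT_comp => //; exact: measurable_funM.
have nE w : `|normc (subH w) * expR (- (k%:R / 2 * w))| =
    normc (subH w) * expR (- (k%:R / 2 * w)).
  by rewrite ger0_norm// mulr_ge0// ?normc_ge0// expR_ge0.
have hh : 0 < 1 / 2 :> R by lra.
have ka : 0 < a / 2 + k%:R / 2 by rewrite ltr_pwDl// ?divr_gt0// divr_ge0.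
apply: (@intg_expR_two_sided _ _ (1 / 2) (a / 2 + k%:R / 2) A B) => // w; rewrite nE.
  have -> : 1 / 2 * w = a * (k.+1%:R / 2 / a) * w + - (k%:R / 2 * w).
    by rewrite -natr1; field; rewrite gt_eqF.
  rewrite expRD mulrA; apply: ler_wpM2r; first exact: expR_ge0.
  exact: HA.
rewrite mulrDl opprD expRD mulrA; apply: ler_wpM2r; first exact: expR_ge0.
exact: HB.
Qed.

(** Total mass 1, as the limit of [laplace_subH] along l = - n. It covers the Laplace transform at
    0, reached when the frequency vanishes. *)
Lemma cint_subH : cint subH = 1.
Proof.
have iH : intg (fun w => normc (subH w)).
  have := intg_subH 0; congr intg; apply/funext => w.
  by rewrite !mul0r oppr0 expR0 mulr1.
have cE (c : R) : 0 < c -> expR (- expR (c * - n%:R)) @[n --> \oo] --> (1 : R).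
  move=> c0; have h : - expR (c * - n%:R) @[n --> \oo] --> (- 0 : R).
    by apply: cvgN; under eq_fun do rewrite mulrN; exact: cvg_expR_lin.
  have := cvg_comp _ _ h (@continuous_expR R (- 0)).
  by rewrite oppr0 expR0; apply.
have [] := @cint_dominated R (fun n w => subH w * (expR (- expR (w - n%:R)))%:C) subH
  (fun w => normc (subH w)).
- move=> n; apply: cmeasM; first exact: cmeas_subH.
  apply: cmeas_real; apply: measurable_expRT; apply: measurableT_comp => //.
  by apply: measurable_expRT; exact: measurable_funD.
- move=> w; have := ccvgM (ccvg_cst (subH w)) (_ : ccvg (fun n => (expR (- expR (w - n%:R)))%:C) 1).
  rewrite mulr1; apply; split; last exact: cvg_cst.
  have h : - (expR w * expR (- n%:R)) @[n --> \oo] --> (- (expR w * 0) : R).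
    apply: cvgN; apply: cvgMr; have := @cvg_expR_lin R 1 ltr01.
    by under eq_fun do rewrite mul1r.
  have := cvg_comp _ _ h (@continuous_expR R (- (expR w * 0))).
  by rewrite mulr0 oppr0 expR0 /=; under eq_fun do rewrite -expRD; apply.
- move=> n w; rewrite Normc.normcM normcR ger0_norm ?expR_ge0//.
  by rewrite ler_piMr ?normc_ge0// -[leRHS]expR0 ler_expR oppr_le0 expR_ge0.
- exact: iH.
move=> _ cv; apply: (ccvg_unique cv); under eq_fun do rewrite laplace_subH.
by split; [exact: cE|exact: cvg_cst].
Qed.

Lemma laplace_subH_ge0 (lam : R) : 0 <= lam ->
  cint (fun w => subH w * (expR (- (lam * expR w)))%:C) = (expR (- powR lam a))%:C.
Proof.
rewrite le_eqVlt => /predU1P[<-|l0].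
  rewrite powR0 ?gt_eqF// oppr0 expR0; under eq_fun do rewrite mul0r oppr0 expR0 mulr1.
  exact: cint_subH.
rewrite /powR gt_eqF// -laplace_subH; congr cint; apply/funext => w.
by rewrite (addrC w) expRD lnK ?posrE.
Qed.

End Subordination.

(** * Iterated Gaussian integrals under a mixture *)

Section GaussianMixture.
Variable R : realType.
Implicit Types (s xs : seq R) (x u w k l : R) (K : R -> R[i]).
Let R1 := measurableTypeR R.

Definition citer n (f : seq R -> R[i]) : R[i] :=
  Complex (iterint n (fun s => Re (f s))) (iterint n (fun s => Im (f s))).

Lemma citer0 f : citer 0 f = f [::].
Proof. exact: complex_eta. Qed.

Lemma citerS n f : citer n.+1 f = cint (fun u => citer n (fun s => f (u :: s))).
Proof. by []. Qed.

Lemma eq_citer n f g : (forall s, size s = n -> f s = g s) -> citer n f = citer n g.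
Proof.
elim: n f g => [|n IH] f g fg; first by rewrite !citer0 fg.
rewrite !citerS; congr cint; apply/funext => u.
by apply: IH => s sn; rewrite fg//= sn.
Qed.

(** One coordinate of exp (- i x.xi - k |xi|^2 e^w); [gval] is its integral over that coordinate. *)
Definition gker k x w u : R[i] := cexp (Complex (- (k * expR w * u ^+ 2)) (- (x * u))).

Definition gval k x w : R :=
  Num.sqrt (pi / k) * expR (- (w / 2)) * expR (- (x ^+ 2 / (4 * k) * expR (- w))).

Lemma sqrt_pi_div k w : 0 < k ->
  Num.sqrt (pi / (k * expR w)) = Num.sqrt (pi / k) * expR (- (w / 2)).
Proof.
move=> k0; have -> : pi / (k * expR w) = pi / k * expR (- (w / 2)) ^+ 2.
  rewrite -expRM_natl (_ : 2%:R * - (w / 2) = - w); last by field.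
  by rewrite expRN; field; rewrite !gt_eqF ?expR_gt0.
rewrite sqrtrM; last by rewrite divr_ge0 ?pi_ge0// ltW.
by rewrite sqrtr_sqr ger0_norm// expR_ge0.
Qed.

Lemma gker_gauss k x w : gker k x w = fun u =>
  cexp (Complex (- (k * expR w * u ^+ 2)) (- x * u)).
Proof. by apply/funext => u; rewrite mulNr. Qed.

Lemma cint_gker k x w : 0 < k -> cint (gker k x w) = (gval k x w)%:C.
Proof.
move=> k0; rewrite gker_gauss cint_gauss ?mulr_gt0 ?expR_gt0// sqrt_pi_div// /gval.
congr (_%:C); congr (_ * expR (- _)); rewrite sqrrN expRN; field.
by rewrite !gt_eqF ?expR_gt0.
Qed.

Lemma cintg_gker k x w : 0 < k -> cintg (gker k x w).
Proof. by move=> k0; rewrite gker_gauss; apply: cintg_gauss; rewrite mulr_gt0// expR_gt0. Qed.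

Lemma normc_gker k x w u : normc (gker k x w u) = expR (- (k * expR w * u ^+ 2)).
Proof. by rewrite normc_cexp. Qed.

Lemma normc_gker_le1 k x w u : 0 < k -> normc (gker k x w u) <= 1.
Proof.
move=> k0; rewrite normc_gker -[leRHS]expR0 ler_expR oppr_le0.
by apply: mulr_ge0; [rewrite mulr_ge0 ?expR_ge0// ltW|exact: sqr_ge0].
Qed.

Lemma gval_ge0 k x w : 0 <= gval k x w.
Proof. by rewrite !mulr_ge0// ?sqrtr_ge0// expR_ge0. Qed.

Lemma gval_le k x w : 0 < k -> gval k x w <= Num.sqrt (pi / k) * expR (- (w / 2)).
Proof.
move=> k0; apply: ler_piMr; first by rewrite mulr_ge0 ?sqrtr_ge0 ?expR_ge0.
rewrite -[leRHS]expR0 ler_expR oppr_le0; apply: mulr_ge0; last exact: expR_ge0.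
by rewrite divr_ge0 ?sqr_ge0// mulr_ge0// ltW.
Qed.

Lemma cmeas_gker k x : cmeas (fun p : R1 * R1 => gker k x p.1 p.2).
Proof.
have m1 : measurable_fun setT (fun p : R1 * R1 => p.1 : R) by exact: measurable_fst.
have m2 : measurable_fun setT (fun p : R1 * R1 => p.2 : R) by exact: measurable_snd.
apply: cmeas_cexp; apply: cmeas_Complex.
  apply: measurableT_comp => //; apply: measurable_funM.
    by apply: measurable_funM => //; exact: measurable_expRT.
  exact: measurable_funX.
by apply: measurableT_comp => //; exact: measurable_funM.
Qed.

Lemma measurable_gval k x : measurable_fun setT (gval k x).
Proof.
have mN : measurable_fun setT (fun w : R => - w) by exact: measurableT_comp.
apply: measurable_funM.
  apply: measurable_funM => //; apply: measurable_expRT.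
  by apply: measurableT_comp => //; exact: measurable_funM.
apply: measurable_expRT; apply: measurableT_comp => //; apply: measurable_funM => //.
exact: measurable_expRT.
Qed.

Lemma normc_prod_gval_le k xs w : 0 < k ->
  normc (\prod_(x <- xs) (gval k x w)%:C) <=
  Num.sqrt (pi / k) ^+ size xs * expR (- ((size xs)%:R / 2 * w)).
Proof.
move=> k0; rewrite normc_prod; elim: xs => [|x xs IH].
  by rewrite big_nil expr0 !mul0r oppr0 expR0 mulr1.
rewrite big_cons normcR ger0_norm ?gval_ge0// [size _]/=.
rewrite [leRHS](_ : _ = Num.sqrt (pi / k) * expR (- (w / 2)) *
  (Num.sqrt (pi / k) ^+ size xs * expR (- ((size xs)%:R / 2 * w)))); last first.
  rewrite mulrACA -exprS -expRD; congr (_ * expR _).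
  by rewrite -natr1; ring.
apply: ler_pM => //; [exact: gval_ge0| |exact: gval_le].
by apply: prodr_ge0 => y _; exact: normc_ge0.
Qed.

(** Induction on the coordinates: [K] absorbs the factor of the outer coordinate, of norm at most 1,
    so the hypothesis persists. Each swap costs a factor of order e^(- w / 2), whence the weights
    with every [j]. *)
Lemma citer_gauss k xs K : 0 < k -> cmeas K ->
  (forall j, intg (fun w => normc (K w) * expR (- (j%:R / 2 * w)))) ->
  citer (size xs) (fun s => cint (fun w => K w * \prod_(p <- zip xs s) gker k p.1 w p.2)) =
  cint (fun w => K w * \prod_(x <- xs) (gval k x w)%:C).
Proof.
move=> k0; elim: xs K => [|x xs IH] K mK iK.
  by rewrite citer0 /=; congr cint; apply/funext => w; rewrite !big_nil.
have mg u : cmeas (fun w => gker k x w u).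
  have mu : measurable_fun setT (fun w : R1 => (w, u) : R1 * R1) by exact: measurable_pair2.
  exact: (cmeas_comp mu (cmeas_gker k x)).
rewrite [size _]/= citerS.
pose P w : R[i] := \prod_(y <- xs) (gval k y w)%:C.
have mP : cmeas P.
  by apply: cmeas_prod => y; apply: cmeas_real; exact: measurable_gval.
pose f (p : R1 * R1) := K p.1 * P p.1 * gker k x p.1 p.2.
transitivity (cint (fun u => cint (fun w => f (w, u)))).
  congr cint; apply/funext => u.
  transitivity (citer (size xs) (fun s => cint (fun w => K w * gker k x w u *
      \prod_(p <- zip xs s) gker k p.1 w p.2))).
    apply: eq_citer => s _; congr cint; apply/funext => w.
    by rewrite big_cons mulrA.
  rewrite IH.
  - by congr cint; apply/funext => w; rewrite /f /= mulrAC.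
  - exact: cmeasM.
  - move=> j; apply: (le_intg _ _ (iK j)) => [|w].
      apply: measurable_funM; first by apply: measurable_normc; exact: cmeasM.
      by apply: measurable_expRT; apply: measurableT_comp => //; exact: measurable_funM.
    rewrite ger0_norm; last by rewrite mulr_ge0 ?normc_ge0 ?expR_ge0.
    rewrite Normc.normcM; apply: ler_wpM2r; first exact: expR_ge0.
    by apply: ler_piMr; [exact: normc_ge0|exact: normc_gker_le1].
have mf : cmeas f.
  have m1 : measurable_fun setT (fun p : R1 * R1 => p.1 : R1) by exact: measurable_fst.
  apply: cmeasM; last exact: cmeas_gker.
  by apply: cmeasM; [exact: (cmeas_comp m1 mK)|exact: (cmeas_comp m1 mP)].
pose h w u := normc (K w * P w) * expR (- (k * expR w * u ^+ 2)).
have kw w : 0 < k * expR w by rewrite mulr_gt0// expR_gt0.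
have ih w : intg (h w) by apply: intgZ; exact: intg_gauss_scaled.
have fh w u : normc (f (w, u)) <= h w u by rewrite /f Normc.normcM normc_gker.
have ihh : intg (fun w => Rint (h w)).
  have -> : (fun w => Rint (h w)) =
      (fun w => normc (K w * P w) * (Num.sqrt (pi / k) * expR (- (w / 2)))).
    apply/funext => w; rewrite RintZ ?Rint_gauss_scaled ?sqrt_pi_div//.
    exact: intg_gauss_scaled.
  have := intgZ (Num.sqrt (pi / k) ^+ (size xs).+1) (iK (size xs).+1).
  apply: le_intg => [|w].
    apply: measurable_funM; first by apply: measurable_normc; exact: cmeasM.
    apply: measurable_funM => //; apply: measurable_expRT; apply: measurableT_comp => //.
    exact: measurable_funM.
  rewrite ger0_norm; last by rewrite !mulr_ge0 ?normc_ge0 ?sqrtr_ge0 ?expR_ge0.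
  have := normc_prod_gval_le xs w k0; rewrite -/(P w) => HP.
  rewrite Normc.normcM -[leLHS]mulrA [leRHS]mulrCA; apply: ler_wpM2l; first exact: normc_ge0.
  rewrite [leRHS](_ : _ = Num.sqrt (pi / k) ^+ size xs * expR (- ((size xs)%:R / 2 * w)) *
    (Num.sqrt (pi / k) * expR (- (w / 2)))); last first.
    rewrite mulrACA -exprSr -expRD; congr (_ * expR _).
    by rewrite -natr1; ring.
  apply: ler_wpM2r HP; first by rewrite mulr_ge0 ?sqrtr_ge0 ?expR_ge0.
rewrite -(cint_swap mf ih fh ihh); congr cint; apply/funext => w.
rewrite /f /= cintZ; last exact: cintg_gker.
by rewrite cint_gker// big_cons -mulrA [P w * _]mulrC.
Qed.

End GaussianMixture.

(** * The density as a mixture of Gaussians *)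

Section StableDensity.
Variable R : realType.
Implicit Types (s : seq R) (w l t : R).

Lemma powRE (x r : R) : 0 < x -> powR x r = expR (r * ln x).
Proof. by move=> x0; rewrite /powR gt_eqF. Qed.

Lemma enorm_ge0 d (x : 'rV[R]_d) : 0 <= enorm x.
Proof. exact: sqrtr_ge0. Qed.

Lemma sqr_enorm d (x : 'rV[R]_d) : enorm x ^+ 2 = \sum_(i < d) x 0 i ^+ 2.
Proof. by rewrite sqr_sqrtr//; apply: sumr_ge0 => i _; exact: sqr_ge0. Qed.

Lemma enorm_gt0 d (x : 'rV[R]_d) : x != 0 -> 0 < enorm x.
Proof.
move=> x0; rewrite lt_neqAle enorm_ge0 andbT eq_sym; apply: contra x0 => /eqP e0.
apply/eqP/rowP => i; rewrite mxE; apply/eqP; rewrite -sqrf_eq0.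
have /eqP := sqr_enorm x; rewrite e0 expr0n /= eq_sym psumr_eq0; last first.
  by move=> j _; exact: sqr_ge0.
by move=> /allP /(_ i); rewrite mem_index_enum => /(_ isT).
Qed.

Definition coords d (x : 'rV[R]_d) : seq R := [seq x 0 i | i <- enum 'I_d].

Lemma size_coords d (x : 'rV[R]_d) : size (coords x) = d.
Proof. by rewrite size_map size_enum_ord. Qed.

Lemma big_zip_coords (V : Type) (idx : V) (op : Monoid.law idx) d (x : 'rV[R]_d) s
    (F : R -> R -> V) : size s = d ->
  \big[op/idx]_(p <- zip (coords x) s) F p.1 p.2 = \big[op/idx]_(i < d) F (x 0 i) (nth 0 s i).
Proof.
move=> sd; have szE : size (zip (coords x) s) = d.
  by rewrite size_zip size_coords sd minnn.
rewrite (big_nth (0, 0)) szE big_mkord; apply: eq_bigr => i _.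
rewrite nth_zip ?size_coords//=; congr F.
by rewrite (nth_map i) ?size_enum_ord// nth_ord_enum.
Qed.

Lemma cexp_sum (I : Type) (r : seq I) (F : I -> R[i]) :
  cexp (\sum_(i <- r) F i) = \prod_(i <- r) cexp (F i).
Proof. exact: (big_morph _ (@cexpD R) (@cexp0 R)). Qed.

Lemma prod_gker d (x : 'rV[R]_d) s k w : size s = d ->
  \prod_(p <- zip (coords x) s) gker k p.1 w p.2 =
  cexp (Complex 0 (- dotR x (\row_(i < d) nth 0 s i))) *
  (expR (- (k * enorm (\row_(i < d) nth 0 s i) ^+ 2 * expR w)))%:C.
Proof.
move=> sd; rewrite (big_zip_coords _ x (fun y u => gker k y w u) sd) -cexp_sum -cexpR -cexpD.
congr cexp; rewrite -[LHS]complex_eta Re_sum Im_sum.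
apply/eqP; rewrite eq_complex /= addr0 add0r sqr_enorm sumrN sumrN /dotR; apply/andP; split.
  rewrite eqr_opp mulr_sumr mulr_suml; apply/eqP.
  by apply: eq_bigr => i _; rewrite mxE; ring.
by rewrite eqr_opp; apply/eqP; apply: eq_bigr => i _; rewrite mxE.
Qed.

Lemma prod_gval (xs : seq R) k w : 0 < k ->
  \prod_(x <- xs) (gval k x w)%:C =
  (Num.sqrt (pi / k) ^+ size xs * (expR (- ((\sum_(x <- xs) x ^+ 2) / (4 * k) * expR (- w))) *
   expR (- ((size xs)%:R / 2 * w))))%:C.
Proof.
move=> k0; rewrite -rmorph_prod; congr (_%:C); elim: xs => [|x xs IH].
  by rewrite !big_nil expr0 !mul0r oppr0 expR0 !mulr1.
rewrite !big_cons IH /gval [size _]/= [_ ^+ (size xs).+1]exprS.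
rewrite (_ : - ((x ^+ 2 + \sum_(j <- xs) j ^+ 2) / (4 * k) * expR (- w)) =
  - (x ^+ 2 / (4 * k) * expR (- w)) +
  - ((\sum_(j <- xs) j ^+ 2) / (4 * k) * expR (- w))); last by ring.
rewrite (_ : - ((size xs).+1%:R / 2 * w) = - (w / 2) + - ((size xs)%:R / 2 * w)); last first.
  by rewrite -natr1; ring.
by rewrite !expRD; ring.
Qed.

Variables (d : nat) (alpha : R).
Hypothesis alpha02 : 0 < alpha < 2.
Let a := alpha / 2.
Let a01 : 0 < a < 1.
Proof. by case/andP: alpha02 => h1 h2; rewrite /a; apply/andP; split; lra. Qed.
Let alpha0 : 0 < alpha. Proof. by case/andP: alpha02. Qed.
Let a0 : 0 < a. Proof. by case/andP: a01. Qed.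

(** The part of the product of the [gval] that depends on [w], where e^l = |x|^2 / (4 k). *)
Definition mixweight l w : R := expR (- expR (l - w)) * expR (- (d%:R / 2 * w)).

Definition subJ l : R[i] := cint (fun w => subH a w * (mixweight l w)%:C).

Lemma mixweight_ge0 l w : 0 <= mixweight l w.
Proof. by rewrite mulr_ge0// expR_ge0. Qed.

Lemma measurable_mixweight l : measurable_fun setT (mixweight l).
Proof.
have mN : measurable_fun setT (fun w : R => - w) by exact: measurableT_comp.
apply: measurable_funM; apply: measurable_expRT; apply: measurableT_comp => //.
by apply: measurable_expRT; exact: measurable_funD.
Qed.

Lemma cintg_subJ l : cintg (fun w => subH a w * (mixweight l w)%:C).
Proof.
apply: (cintg_dom _ _ (intg_subH a01 d)).
  apply: cmeasM; first exact: cmeas_subH.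
  by apply: cmeas_real; exact: measurable_mixweight.
move=> w; rewrite Normc.normcM normcR (ger0_norm (mixweight_ge0 _ _)).
apply: ler_wpM2l; first exact: normc_ge0.
by apply: ler_piMl; rewrite ?expR_ge0// -[leRHS]expR0 ler_expR oppr_le0 expR_ge0.
Qed.

(** With k = t^(2 / alpha), (k |xi|^2)^a = t |xi|^alpha. *)
Lemma stable_integrand t (x : 'rV[R]_d) s : 0 < t -> size s = d ->
  cexp (Complex 0 (- dotR x (\row_(i < d) nth 0 s i))) *
    (expR (- (t * powR (enorm (\row_(i < d) nth 0 s i)) alpha)))%:C =
  cint (fun w => subH a w *
    \prod_(p <- zip (coords x) s) gker (powR t a^-1) p.1 w p.2).
Proof.
move=> t0 sd; set v := \row_(i < d) nth 0 s i; set k := powR t a^-1.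
have k0 : 0 < k by exact: powR_gt0.
have lam0 : 0 <= k * enorm v ^+ 2 by rewrite mulr_ge0 ?sqr_ge0// ltW.
have -> : t * powR (enorm v) alpha = powR (k * enorm v ^+ 2) a.
  rewrite powRM ?sqr_ge0// ?(ltW k0)// /k -powRrM mulVf ?gt_eqF// powRr1 ?(ltW t0)//.
  rewrite -(powR_mulrn 2 (enorm_ge0 v)) -powRrM; congr (_ * powR _ _).
  by rewrite /a; field.
rewrite -(laplace_subH_ge0 a01 lam0) -cintZ.
  congr cint; apply/funext => w; rewrite prod_gker// -/v.
  by rewrite mulrCA.
apply: (cintg_dom _ _ (intg_subH a01 0)).
  apply: cmeasM; first exact: cmeas_subH.
  apply: cmeas_real; apply: measurable_expRT; apply: measurableT_comp => //.
  apply: measurable_funM => //; exact: measurable_expRT.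
move=> w; rewrite Normc.normcM normcR (@ger0_norm _ (expR _)) ?expR_ge0//.
apply: ler_wpM2l; first exact: normc_ge0.
by rewrite !mul0r oppr0 ler_expR oppr_le0 mulr_ge0// expR_ge0.
Qed.

(** The argument of [subJ] satisfies e^l = (rho / 2)^2 = |x|^2 / (4 k) for rho = t^(-1 / alpha)
    |x|. *)
Lemma stable_density_subJ t (x : 'rV[R]_d) : 0 < t -> 0 < enorm x ->
  stable_density alpha t x =
  (powR t (- (d%:R / alpha)) / powR pi (d%:R / 2) * expR (- (d%:R * ln 2)))%:C *
  subJ (2 * (ln (powR t (- alpha^-1) * enorm x) - ln 2)).
Proof.
move=> t0 x0; set k := powR t a^-1; have k0 : 0 < k by exact: powR_gt0.
have p0 : 0 < pi :> R := pi_gt0 R.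
set l := 2 * _.
rewrite /stable_density.
rewrite -[X in _ * X = _]/(citer d (fun s =>
  cexp (Complex 0 (- dotR x (\row_(i < d) nth 0 s i))) *
  (expR (- (t * powR (enorm (\row_(i < d) nth 0 s i)) alpha)))%:C)).
have -> := eq_citer (fun s sd => stable_integrand x t0 sd).
rewrite -[X in citer X _](size_coords x) citer_gauss//; [|exact: cmeas_subH|exact: intg_subH].
have iJ := cintg_subJ l.
have lE : expR l = enorm x ^+ 2 / (4 * k).
  rewrite /l expRM_natl expRD expRN !lnK ?posrE ?mulr_gt0 ?powR_gt0//.
  rewrite !exprMn -(powR_mulrn 2 (powR_ge0 t _)) -powRrM exprVn.
  rewrite (_ : - alpha^-1 * 2%:R = - a^-1); last by rewrite /a; field; rewrite gt_eqF.
  by rewrite powRN -/k; field; rewrite gt_eqF.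
rewrite [X in _ * X = _](_ : _ = (Num.sqrt (pi / k) ^+ d)%:C * subJ l); last first.
  rewrite -cintZ//; congr cint; apply/funext => w.
  rewrite prod_gval// size_coords real_complexM mulrCA; congr (_ * (_ * (_ * _)%:C)).
  rewrite expRD lE big_map big_enum /= -sqr_enorm; congr expR.
rewrite mulrA -real_complexM; congr (_%:C * _).
have sqE : Num.sqrt (pi / k) = expR ((ln pi - a^-1 * ln t) / 2).
  have -> : pi / k = expR ((ln pi - a^-1 * ln t) / 2) ^+ 2.
    rewrite -expRM_natl [2%:R * _]mulrC divfK ?pnatr_eq0// expRD lnK ?posrE// expRN /k powRE//.
  by rewrite sqrtr_sqr ger0_norm// expR_ge0.
rewrite sqE !powRE// -!expRN -expRM_natl.
have -> : (2 * pi) ^- d = expR (- (d%:R * (ln 2 + ln pi))) :> R.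
  by rewrite expRN expRM_natl expRD !lnK ?posrE.
by rewrite -!expRD; congr expR; rewrite /a; field; rewrite gt_eqF.
Qed.

End StableDensity.

(** * The Mellin-Barnes formula and the asymptotic expansion *)

Section Expansion.
Variables (R : realType) (d : nat) (alpha : R).
Hypothesis alpha02 : 0 < alpha < 2.
Implicit Types (w l t c : R).
Let a := alpha / 2.
Let a01 : 0 < a < 1.
Proof. by case/andP: alpha02 => h1 h2; rewrite /a; apply/andP; split; lra. Qed.
Let alpha0 : 0 < alpha. Proof. by case/andP: alpha02. Qed.
Let a0 : 0 < a. Proof. by case/andP: a01. Qed.

Let tpi_neq0 : (2 * pi)%:C != 0 :> R[i].
Proof. by rewrite (inj_eq (@complexI R)) mulf_neq0 ?gt_eqF ?pi_gt0. Qed.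

(** Pair [subH] with [mixweight] on the line Re s = c / alpha and substitute z = alpha s. The bounds
    0 < c < d keep both s and (d - z) / 2 in the right half-plane. *)
Lemma stable_density_mellin_barnes c t (x : 'rV[R]_d) : 0 < c < d%:R -> 0 < t -> x != 0 ->
  stable_density alpha t x =
    (powR t (- (d%:R / alpha)) / (alpha * powR pi (d%:R / 2)))%:C *
    ((2 * pi)%:C * 'i)^-1 *
    vline_integral c (fun z =>
       Gamma (z / alpha%:C) * Gamma ((d%:R%:C - z) / 2%:C) * cpow 2 (- z)
       / Gamma (z / 2%:C)
       * cpow (powR t (- alpha^-1) * enorm x) (- d%:R%:C + z)).
Proof.
move=> /andP[c0 cd] t0 /enorm_gt0 x0; rewrite (stable_density_subJ alpha02 t0 x0).
set rho := powR t _ * enorm x; set l := 2 * (ln rho - ln 2).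
have s0 : 0 < c / alpha by exact: divr_gt0.
have [||||iG EG] := @subH_pairing R a a01 (c / alpha) (mixweight d l).
- exact: s0.
- exact: measurable_mixweight.
- by move=> w; exact: mixweight_ge0.
- have b0 : 0 < (d%:R - c) / 2 by rewrite divr_gt0// subr_gt0.
  have := intg_Gamma_refl l b0; congr intg; apply/funext => w.
  rewrite /mixweight -[RHS]mulrA -[in RHS]expRD; congr (_ * expR _).
  by rewrite /a; field; rewrite gt_eqF.
have ai : 0 < alpha^-1 by rewrite invr_gt0.
move: (cint_affine 0 ai iG) (cintg_affine 0 ai iG).
set G := (X in cintg X -> _) => AG iG'.
rewrite /subJ -/a EG (AG : _ = (alpha^-1)%:C * cint G) /vline_integral; set F := (X in _ * ('i * cint X)).
have -> : cint F = (expR (- (d%:R * ln 2)))%:C * cint G.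
  rewrite -cintZ//; congr cint; apply/funext => y; rewrite /F /G.
  set z := Complex (c / alpha) _.
  have zE : Complex c y = alpha%:C * z.
    by rewrite /z addr0; apply/eqP; rewrite eq_complex /= !mul0r subr0 addr0;
      apply/andP; split; apply/eqP; field; rewrite gt_eqF.
  have aC0 : alpha%:C != 0 :> R[i] by rewrite (inj_eq (@complexI R)) gt_eqF.
  have E1 : Complex c y / alpha%:C = z by rewrite zE mulrC mulKf.
  have E2 : Complex c y / 2%:C = a%:C * z by rewrite zE /a real_complexM real_complexV; ring.
  have Rez : Re (a%:C * z) = c / 2.
    by rewrite /z scale_line /= /a; field; rewrite gt_eqF.
  have z1 : 0 < Re (a%:C * z) by rewrite Rez divr_gt0.
  have E3 : (d%:R%:C - Complex c y) / 2%:C = (d%:R / 2)%:C - a%:C * z.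
    by rewrite mulrBl E2 (real_complexM d%:R) real_complexV.
  have z2 : 0 < Re ((d%:R / 2)%:C - a%:C * z).
    by rewrite ReD ReN Rez [Re _]/= -mulrBl divr_gt0// subr_gt0.
  rewrite E1 E2 E3 (Gamma_pos z1) (Gamma_pos z2) (rGamma_pos z1).
  rewrite [cint _](_ : _ = cexp (- (((d%:R / 2)%:C - a%:C * z) * l%:C)) *
    GammaPos ((d%:R / 2)%:C - a%:C * z)); last first.
    rewrite -cint_Gamma_refl//; congr cint; apply/funext => w.
    rewrite /mixweight (real_complexM (expR (- expR (l - w)))) -[LHS]mulrA.
    rewrite -[(expR (- (d%:R / 2 * w)))%:C]cexpR -cexpD; congr (_ * cexp _).
    by rewrite real_complexN real_complexM; ring.
  have -> : (expR (- (d%:R * ln 2)))%:C * (Gamma z * (GammaPos (a%:C * z))^-1 *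
      (cexp (- (((d%:R / 2)%:C - a%:C * z) * l%:C)) * GammaPos ((d%:R / 2)%:C - a%:C * z))) =
    Gamma z * GammaPos ((d%:R / 2)%:C - a%:C * z) / GammaPos (a%:C * z) *
    (cexp (- (d%:R * ln 2))%:C * cexp (- (((d%:R / 2)%:C - a%:C * z) * l%:C))).
    by rewrite cexpR; ring.
  (* Here e^(- l (d - z) / 2) = rho^(z - d) 2^(d - z), and the factor 2^(- d) leaves 2^(- z). *)
  have -> : cexp (- (d%:R * ln 2))%:C * cexp (- (((d%:R / 2)%:C - a%:C * z) * l%:C)) =
      cpow 2 (- Complex c y) * cpow rho (- d%:R%:C + Complex c y).
    rewrite /cpow -!cexpD; congr cexp; rewrite zE /l /a.
    by rewrite !(real_complexM, real_complexN, real_complexD, real_complexV); field.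
  by ring.
have i0 : 'i != 0 :> R[i] by rewrite eq_complex /= oner_eq0 andbF.
have p0 : powR pi (d%:R / 2) != 0 :> R by rewrite gt_eqF// powR_gt0// pi_gt0.
have cancel_i (A B E : R) (P J i : R[i]) : B != 0 -> P != 0 -> i != 0 ->
    (A / B * E)%:C * (P^-1 * ((alpha^-1)%:C * J)) =
    (A / (alpha * B))%:C * (P * i)^-1 * (i * (E%:C * J)).
  move=> B0 P0 j0; have -> : A / (alpha * B) = alpha^-1 * (A / B).
    by field; rewrite B0 gt_eqF.
  rewrite (real_complexM alpha^-1) (real_complexM (A / B)); field.
  by rewrite j0 P0 !fmorph_eq0 B0 gt_eqF.
exact: cancel_i.
Qed.


Lemma rGamma_real (x : R) : rGamma x%:C = (Re (rGamma x%:C))%:C.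
Proof.
suff [r ->] : exists r : R, rGamma x%:C = r%:C by [].
rewrite /rGamma; set n := gshift _.
exists (\prod_(k < n) (x + k%:R) / rgam (x + n%:R)).
rewrite real_complexM real_complexV rmorph_prod /= -GammaPos_real natr_complex -real_complexD.
by congr (_ / _); apply: eq_bigr => k _; rewrite natr_complex -real_complexD.
Qed.

Lemma rGamma_int (x : R) : 0 <= x -> x \is a Num.int -> rGamma (- x%:C) = 0.
Proof.
move=> x0 xi; have /natrP[m ->] : x \is a Num.nat by rewrite natrEint xi.
by rewrite -natr_complex rGamma0.
Qed.

Lemma cintg_Gamma_refl (z : R[i]) l : 0 < Re z ->
  cintg (fun w => (expR (- expR (l - w)))%:C * cexp (- (z * w%:C))).
Proof.
move=> z0; have iz := @cintg_mellin_kernel R 0 z z0.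
have := cintgZ (cexp (- (z * l%:C))) (cintg_opp (cintg_shift l iz)).
congr cintg; apply/funext => w; rewrite mellin_kernel0E mulrCA addrC; congr (_ * _).
by rewrite -cexpD real_complexD real_complexN; congr cexp; ring.
Qed.

Lemma Rint_Gamma_refl (b : R) l : 0 < b ->
  Rint (fun w => expR (- expR (l - w)) * expR (- (b * w))) = expR (- (b * l)) * rgam b.
Proof.
move=> b0; have := @cint_Gamma_refl R b%:C l b0.
rewrite GammaPos_real -real_complexM -real_complexN cexpR -real_complexM.
move=> /(congr1 (@complex.Re R)) /= <-; congr Rint; apply/funext => w.
by rewrite !mul0r !mulr0 !subr0 addr0 oppr0 cos0 mulr1.
Qed.

Definition subJ_coef n : R :=
  ((-1) ^+ n / n`!%:R) * Re (rGamma (- (a * n%:R)%:C)) * rgam (d%:R / 2 + a * n%:R).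

Let dn0 n : (0 < d)%N -> 0 < d%:R / 2 + a * n%:R.
Proof.
by move=> dp; rewrite ltr_pwDl// ?divr_gt0 ?ltr0n// mulr_ge0// ltW.
Qed.

(** Integrates the residue expansion of [subH] against [mixweight], term by term. The line -(N +
    1/2) lies past the poles 0, ..., -N, hence [N.+1] terms, and the remainder is again an explicit
    Gamma integral. *)
Lemma subJ_expansion N : (0 < d)%N -> exists2 C, 0 <= C & forall l,
  normc (subJ d alpha l -
    (\sum_(n < N.+1) subJ_coef n * expR (- ((d%:R / 2 + a * n%:R) * l)))%:C) <=
  C * expR (- ((d%:R / 2 + a * (N%:R + 2^-1)) * l)).
Proof.
move=> dp; have sN : strip N.+1 (- (N%:R + 2^-1) : R).
  by rewrite /= -natr1; apply/andP; split; lra.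
have [C C0 HC] := stabH_bound a01 sN.
set b := d%:R / 2 + a * (N%:R + 2^-1).
have b0 : 0 < b.
  by rewrite ltr_pwDl// ?divr_gt0 ?ltr0n// mulr_ge0 ?(ltW a0)// addr_ge0.
have rb0 := rgam_gt0 b0.
exists (2 * (C * rgam b)); first by rewrite !mulr_ge0// ltW.
move=> l.
pose k n : R[i] := ((-1) ^+ n / n`!%:R)%:C * rGamma (- (a * n%:R)%:C).
pose g n w : R[i] := (expR (- expR (l - w)))%:C * cexp (- ((d%:R / 2 + a * n%:R)%:C * w%:C)).
have ig n : cintg (g n) by apply: cintg_Gamma_refl; exact: dn0.
have gE n w : k n * g n w = stab_res a n (- (a * w)) * (mixweight d l w)%:C.
  rewrite /k /g /stab_res /mixweight (real_complexM (expR (- expR (l - w)))).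
  rewrite -[(expR (- (d%:R / 2 * w)))%:C]cexpR.
  rewrite [RHS](_ : _ = ((-1) ^+ n / n`!%:R)%:C * rGamma (- (a * n%:R)%:C) *
    ((expR (- expR (l - w)))%:C * (cexp (n%:R * - (a * w))%:C *
     cexp (- (d%:R / 2 * w))%:C))); last by ring.
  rewrite -cexpD; congr (_ * (_ * cexp _)).
  by rewrite -!real_complexM -!real_complexN -real_complexD; congr (_%:C); ring.
have iJ : cintg (fun w => subH a w * (mixweight d l w)%:C).
  exact: cintg_subJ.
have iS (n : 'I_N.+1) : cintg (fun w => k n * g n w) by apply: cintgZ; exact: ig.
have [iSum ESum] := cint_sum (index_enum 'I_N.+1) iS.
have -> : (\sum_(n < N.+1) subJ_coef n * expR (- ((d%:R / 2 + a * n%:R) * l)))%:C =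
    cint (fun w => \sum_(n < N.+1) k n * g n w).
  rewrite ESum rmorph_sum; apply: eq_bigr => n _; rewrite cintZ//.
  rewrite /g cint_Gamma_refl; last exact: dn0.
  rewrite GammaPos_real -real_complexM -real_complexN cexpR /k -real_complexN rGamma_real.
  rewrite -!real_complexM; congr (_%:C); rewrite /subJ_coef -real_complexN.
  by ring.
rewrite /subJ -cintB//.
have H := @normc_cint_le R (fun w => subH a w * (mixweight d l w)%:C - \sum_(n < N.+1) k n * g n w)
  (fun w => C * (expR (- expR (l - w)) * expR (- (b * w)))).
apply: le_trans (H _ _ _) _.
- have [m1 m2] := (cintg_meas iJ, cintg_meas iSum).
  by apply: cmeasD => //; exact: cmeasN.
- move=> w; rewrite (eq_bigr _ (fun (n : 'I_N.+1) _ => gE n w)) -mulr_suml -mulrBl.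
  rewrite Normc.normcM normcR (ger0_norm (mixweight_ge0 _ _ _)).
  apply: le_trans (ler_wpM2r (mixweight_ge0 _ _ _) (HC (- (a * w)))) _.
  rewrite /mixweight -[leLHS]mulrA; apply: ler_wpM2l => //.
  rewrite [leLHS]mulrCA; apply: ler_wpM2l; first exact: expR_ge0.
  by rewrite -expRD ler_expR /b le_eqVlt; apply/orP; left; apply/eqP; ring.
- by apply: intgZ; exact: intg_Gamma_refl.
rewrite RintZ; last exact: intg_Gamma_refl.
by rewrite Rint_Gamma_refl// le_eqVlt; apply/orP; left; apply/eqP; ring.
Qed.

Lemma asym_coefE n (rho : R) : (0 < d)%N -> 0 < rho ->
  expR (- (d%:R * ln 2)) * (subJ_coef n *
    expR (- ((d%:R / 2 + a * n%:R) * (2 * (ln rho - ln 2))))) =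
  asym_coef d alpha n * powR rho (- d%:R - n%:R * alpha).
Proof.
move=> dp r0; rewrite /asym_coef /subJ_coef.
have nE : n%:R * alpha / 2 = a * n%:R by rewrite /a; ring.
have -> : (d%:R + n%:R * alpha) / 2 = d%:R / 2 + a * n%:R by rewrite /a; ring.
rewrite nE Gamma_pos; last exact: dn0.
rewrite GammaPos_real [Re (rgam _)%:C]/= real_complexN.
have -> : (1 - ((a * n%:R) \is a Num.int)%:R) * ((-1) ^+ n / n`!%:R) *
    rgam (d%:R / 2 + a * n%:R) * powR 2 (n%:R * alpha) * Re (rGamma (- (a * n%:R)%:C)) =
    (-1) ^+ n / n`!%:R * Re (rGamma (- (a * n%:R)%:C)) * rgam (d%:R / 2 + a * n%:R) *
    powR 2 (n%:R * alpha).
  (* If a n is an integer, the left side vanishes by the indicator and the right side by the zeros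
     of 1 / Gamma. *)
  case: (boolP (_ \is a _)) => ni; last by rewrite subr0; ring.
  rewrite rGamma_int//; first by rewrite !mulr0 !mul0r.
  by rewrite mulr_ge0// ltW.
rewrite !powRE// mulrCA -[RHS]mulrA -!expRD; congr (_ * expR _).
by rewrite /a; field.
Qed.

Lemma stable_density_expansion N (eps : R) : (0 < d)%N -> 0 < eps ->
  exists r0 : R, forall t (x : 'rV[R]_d),
    0 < t -> r0 <= powR t (- alpha^-1) * enorm x ->
    Num.norm (stable_density alpha t x -
           (powR t (- (d%:R / alpha)) / powR pi (d%:R / 2) *
            \sum_(1 <= n < N.+1)
               asym_coef d alpha n *
               powR (powR t (- alpha^-1) * enorm x) (- d%:R - n%:R * alpha))%:C)
    <= (eps * powR t (- (d%:R / alpha)) *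
       powR (powR t (- alpha^-1) * enorm x) (- d%:R - N%:R * alpha))%:C.
Proof.
move=> dp eps0; have [C C0 HC] := subJ_expansion N dp.
have p0 : 0 < powR pi (d%:R / 2) :> R by rewrite powR_gt0// pi_gt0.
pose M := expR (- (d%:R * ln 2)) * C * expR ((d%:R + alpha * (N%:R + 2^-1)) * ln 2) /
  powR pi (d%:R / 2).
have M0 : 0 <= M.
  rewrite /M divr_ge0 ?(ltW p0)//.
  by rewrite mulr_ge0 ?expR_ge0// mulr_ge0 ?expR_ge0.
have M1 : 0 < M + 1 by rewrite ltr_wpDl.
(* This is ((M + 1) / eps)^(2 / alpha), beyond which M rho^(- alpha / 2) <= eps. Taking M + 1 keeps
   the argument of [ln] positive when M = 0. *)
exists (expR (2 / alpha * ln ((M + 1) / eps))) => t x t0.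
set rho := powR t _ * enorm x => rhoB.
have rho0 : 0 < rho := lt_le_trans (expR_gt0 _) rhoB.
have x0 : 0 < enorm x.
  rewrite lt_neqAle enorm_ge0 andbT eq_sym; apply/eqP => e0.
  by move: rho0; rewrite /rho e0 mulr0 ltxx.
rewrite (stable_density_subJ alpha02 t0 x0) -/rho.
set T := powR t _; have T0 : 0 < T by exact: powR_gt0.
set l := 2 * (ln rho - ln 2).
have -> : T / powR pi (d%:R / 2) * (\sum_(1 <= n < N.+1)
    asym_coef d alpha n * powR rho (- d%:R - n%:R * alpha)) =
  T / powR pi (d%:R / 2) * expR (- (d%:R * ln 2)) *
  \sum_(n < N.+1) subJ_coef n * expR (- ((d%:R / 2 + a * n%:R) * l)).
  rewrite -[RHS]mulrA; congr (_ * _).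
  (* The term n = 0 carries 1 / Gamma (0) = 0, which is why the expansion starts at n = 1. *)
  have c0 : subJ_coef 0 = 0.
    rewrite /subJ_coef mulr0; have := @rGamma0 R 0; rewrite natr_complex => ->.
    by rewrite mulr0 mul0r.
  rewrite -(big_mkord xpredT (fun n => subJ_coef n * expR (- ((d%:R / 2 + a * n%:R) * l)))).
  rewrite [in RHS]big_ltn// c0 mul0r add0r mulr_sumr.
  by apply: eq_bigr => n _; rewrite asym_coefE.
rewrite [X in _ * subJ _ _ _ - X]real_complexM -mulrBr normc_def lecR -normcE.
rewrite Normc.normcM normcR ger0_norm; last first.
  by rewrite mulr_ge0 ?expR_ge0// divr_ge0// ltW.
apply: le_trans (ler_wpM2l _ (HC l)) _.
  by rewrite mulr_ge0 ?expR_ge0// divr_ge0// ltW.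
have -> : expR (- ((d%:R / 2 + a * (N%:R + 2^-1)) * l)) =
    expR ((d%:R + alpha * (N%:R + 2^-1)) * ln 2) *
    (powR rho (- d%:R - N%:R * alpha) * expR (- (alpha / 2 * ln rho))).
  by rewrite powRE// -!expRD; congr expR; rewrite /l /a; field.
rewrite [leLHS](_ : _ = M * expR (- (alpha / 2 * ln rho)) *
  (T * powR rho (- d%:R - N%:R * alpha))); last by rewrite /M; ring.
rewrite -[leRHS]mulrA; apply: ler_wpM2r; first by rewrite mulr_ge0 ?powR_ge0// ltW.
have lr : 2 / alpha * ln ((M + 1) / eps) <= ln rho by rewrite -ler_expR lnK ?posrE.
have q0 : 0 < (M + 1) / eps by exact: divr_gt0.
apply: (@le_trans _ _ (M * (eps / (M + 1)))).
  have -> : eps / (M + 1) = expR (- ln ((M + 1) / eps)) by rewrite expRN lnK ?posrE// invf_div.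
  apply: ler_wpM2l => //; rewrite ler_expR lerN2.
  apply: le_trans (ler_wpM2l _ lr); last by rewrite divr_ge0// ltW.
  by rewrite le_eqVlt; apply/orP; left; apply/eqP; field; rewrite gt_eqF.
rewrite mulrCA ler_piMr ?(ltW eps0)// ler_pdivrMr// mul1r.
by rewrite lerDl.
Qed.

End Expansion.

Theorem theorem3p1 (R : realType) (d : nat) (alpha : R) :
  (2 <= d)%N -> 0 < alpha < 2 ->
  (forall (c t : R) (x : 'rV[R]_d),
     (d%:R - 1) / 2 < c < d%:R -> 0 < t -> x != 0 ->
     stable_density alpha t x =
       (powR t (- (d%:R / alpha)) / (alpha * powR pi (d%:R / 2)))%:C *
       ((2 * pi)%:C * 'i)^-1 *
       vline_integral c (fun z =>
          Gamma (z / alpha%:C) * Gamma ((d%:R%:C - z) / 2%:C) * cpow 2 (- z)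
          / Gamma (z / 2%:C)
          * cpow (powR t (- alpha^-1) * enorm x) (- d%:R%:C + z)))
  /\
  (forall (N : nat) (eps : R), 0 < eps ->
     exists r0 : R, forall (t : R) (x : 'rV[R]_d),
       0 < t -> r0 <= powR t (- alpha^-1) * enorm x ->
       Num.norm (stable_density alpha t x -
              (powR t (- (d%:R / alpha)) / powR pi (d%:R / 2) *
               \sum_(1 <= n < N.+1)
                  asym_coef d alpha n *
                  powR (powR t (- alpha^-1) * enorm x) (- d%:R - n%:R * alpha))%:C)
       <= (eps * powR t (- (d%:R / alpha)) *
          powR (powR t (- alpha^-1) * enorm x) (- d%:R - N%:R * alpha))%:C).
Proof.
move=> d2 alpha02; split=> [c t x /andP[c1 cd] t0 x0 | N eps eps0].
  apply: stable_density_mellin_barnes => //; apply/andP; split => //.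
  (* From d >= 2 the lower bound (d - 1) / 2 is positive, hence c > 0. *)
  by have : (2%:R : R) <= d%:R; [rewrite ler_nat|lra].
exact: stable_density_expansion (ltnW d2) eps0.
Qed.
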